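(* Consider a sequence, indexed by $N\to\infty$, of completely randomized nearly uniform designs with $\min_qN_q\ge2$, satisfying Conditions 1--4, where the constants $\underline c,\overline c,\sigma_F,c,c',\Delta,\nu,\underline S$ do not depend on $N$. Let $\hat V_{\hat\gamma}=F^\top\mathrm{diag}(N_q^{-1}\hat S(q,q))F$, $W_N=V_{\hat\gamma}^{1/2}\{\mathbb E\hat V_{\hat\gamma}\}^{-1}V_{\hat\gamma}^{1/2}\in\mathbb R^{H\times H}$, $\widehat T=(\hat\gamma-\gamma)^\top\hat V_{\hat\gamma}^{-1}(\hat\gamma-\gamma)$, and let $q_\alpha$ denote the upper $\alpha$-quantile of $\chi^2(H)$, $\alpha\in(0,1)$. (i) If $H$ is fixed and $W_N\to W_\infty$, then $\widehat T$ converges in distribution to the law $\mathcal L$ of $\xi_H^\top W_\infty\xi_H$ with $\xi_H\sim\mathcal N(0,I_H)$; $\mathcal L$ is stochastically dominated by $\chi^2(H)$; and $\lim_{N\to\infty}\mathbb P\{\widehat T\le q_\alpha\}\ge1-\alpha$. (ii) If $H\to\infty$ with $H^{19/4}N^{-1/2}\to0$, then $\{\widehat T-\mathrm{tr}(W_N)\}/\sqrt{2\,\mathrm{tr}(W_N^2)}$ converges in distribution to $\mathcal N(0,1)$, and $\liminf_{N\to\infty}\mathbb P\{\widehat T\le q_\alpha\}\ge1-\alpha$.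
   Context: Randomization model: there are $N$ units and $Q$ treatment levels with prescribed group sizes $N_1,\dots,N_Q\ge1$, $\sum_qN_q=N$; unit $i\in[N]$ has fixed real potential outcomes $Y_i(1),\dots,Y_i(Q)$. Under complete randomization the treatment vector $Z$ is uniform over all vectors in $[Q]^N$ with exactly $N_q$ coordinates equal to $q$; observed outcome $Y_i=Y_i(Z_i)$. Write $\overline Y(q)=N^{-1}\sum_iY_i(q)$, $\overline Y=(\overline Y(q))_q$, $S(q,q')=(N-1)^{-1}\sum_i(Y_i(q)-\overline Y(q))(Y_i(q')-\overline Y(q'))$, $S=(S(q,q'))$, $\hat Y_q=N_q^{-1}\sum_{i:Z_i=q}Y_i$, $\hat Y=(\hat Y_q)_q$, $\hat S(q,q)=(N_q-1)^{-1}\sum_{i:Z_i=q}(Y_i-\hat Y_q)^2$, $V_{\hat Y}=\mathrm{diag}(N_q^{-1}S(q,q))-N^{-1}S$. For fixed $F\in\mathbb R^{Q\times H}$: $\gamma=F^\top\overline Y$, $\hat\gamma=F^\top\hat Y$, $V_{\hat\gamma}=F^\top V_{\hat Y}F$ (nonsingular). $\|F\|_\infty$ is the max absolute entry, $\varrho_{\min}$ the smallest eigenvalue. Nearly uniform design: positive integer $N_0$ and constants $0<\underline c\le\overline c$ with $N_q=c_qN_0$, $\underline c\le c_q\le\overline c$. Condition 1: there exists $\sigma_F\ge1$ with $F^\top\mathrm{diag}(N_q^{-1}S(q,q))F\preceq\sigma_F^2F^\top V_{\hat Y}F$. Condition 2: $\|F\|_\infty\le cQ^{-1}$ and $\varrho_{\min}(F^\top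 F)\ge c'Q^{-1}$ for constants $c,c'>0$. Condition 3: $\max_qN^{-1}\sum_i\{Y_i(q)-\overline Y(q)\}^4\le\Delta^4$. Condition 4: $|Y_i(q)-\overline Y(q)|\le\nu$ for all $i,q$, and $S(q,q)\ge\underline S>0$ for all $q$. *)

(* Defs.v *)
From HB Require Import structures.
From mathcomp Require Import all_boot all_order all_algebra.
From mathcomp Require Import all_classical all_reals all_analysis.
Set Implicit Arguments. Unset Strict Implicit. Unset Printing Implicit Defensive.
Import Order.TTheory GRing.Theory Num.Theory.
Import numFieldNormedType.Exports.
Local Open Scope classical_set_scope.
Local Open Scope ring_scope.

Section Defs.
Variable R : realType.

Definition qform n (A : 'M[R]_n) (v : 'cV[R]_n) : R := (v^T *m A *m v) 0 0.

Definition loewner_le n (A B : 'M[R]_n) : Prop :=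
  forall v : 'cV[R]_n, qform A v <= qform B v.

Definition is_psd n (A : 'M[R]_n) : Prop := A^T = A /\ forall v, 0 <= qform A v.

Definition sqrtmx n (A : 'M[R]_n) : 'M[R]_n :=
  xget 0 [set S : 'M[R]_n | is_psd S /\ S *m S = A].

Definition assignments (N Q : nat) (Nq : 'I_Q -> nat) : {set {ffun 'I_N -> 'I_Q}} :=
  [set z : {ffun 'I_N -> 'I_Q} | [forall q, #|[set i | z i == q]| == Nq q]]%SET.

Definition prob N Q (Nq : 'I_Q -> nat) (E : {ffun 'I_N -> 'I_Q} -> bool) : R :=
  #|[set z in assignments N Nq | E z]%SET|%:R / #|assignments N Nq|%:R.

Definition expect N Q (Nq : 'I_Q -> nat) (f : {ffun 'I_N -> 'I_Q} -> R) : R :=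
  (\sum_(z in assignments N Nq) f z) / #|assignments N Nq|%:R.

Section Design.
Variables (N Q H : nat) (Nq : 'I_Q -> nat) (Y : 'M[R]_(N, Q)) (F : 'M[R]_(Q, H)).

Definition Ybar : 'cV[R]_Q := \col_q (N%:R^-1 * \sum_i Y i q).

Definition Smat : 'M[R]_Q :=
  \matrix_(q, q') ((N%:R - 1)^-1 *
     \sum_i (Y i q - Ybar q 0) * (Y i q' - Ybar q' 0)).

Definition Yhat (z : {ffun 'I_N -> 'I_Q}) : 'cV[R]_Q :=
  \col_q ((Nq q)%:R^-1 * \sum_(i | z i == q) Y i q).

Definition Shat (z : {ffun 'I_N -> 'I_Q}) (q : 'I_Q) : R :=
  ((Nq q)%:R - 1)^-1 * \sum_(i | z i == q) (Y i q - Yhat z q 0) ^+ 2.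

Definition V_Yhat : 'M[R]_Q :=
  diag_mx (\row_q (Smat q q / (Nq q)%:R)) - N%:R^-1 *: Smat.

Definition gamma : 'cV[R]_H := F^T *m Ybar.
Definition gammahat z : 'cV[R]_H := F^T *m Yhat z.
Definition V_gammahat : 'M[R]_H := F^T *m V_Yhat *m F.

Definition Vhat z : 'M[R]_H := F^T *m diag_mx (\row_q (Shat z q / (Nq q)%:R)) *m F.

Definition EVhat : 'M[R]_H := \matrix_(i, j) expect Nq (fun z => Vhat z i j).

Definition W_N : 'M[R]_H :=
  sqrtmx V_gammahat *m invmx EVhat *m sqrtmx V_gammahat.

Definition That (z : {ffun 'I_N -> 'I_Q}) : R :=
  qform (invmx (Vhat z)) (gammahat z - gamma).

End Design.

(* The standing assumptions of the theorem for one design of the sequence;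
   the constants are passed in (they are the same for every N). *)
Definition design_conditions (clo chi sigF c c' Delta nu Slo : R)
    (N Q H : nat) (Nq : 'I_Q -> nat) (Y : 'M[R]_(N, Q)) (F : 'M[R]_(Q, H)) : Prop :=
      (\sum_q Nq q)%N = N /\ (forall q, 2 <= Nq q)%N /\
      (exists (N0 : nat) (cq : 'I_Q -> R), (0 < N0)%N /\
         forall q, (Nq q)%:R = cq q * N0%:R /\ clo <= cq q <= chi) /\
      V_gammahat Nq Y F \in unitmx /\
      loewner_le (F^T *m diag_mx (\row_q (Smat Y q q / (Nq q)%:R)) *m F)
                 (sigF ^+ 2 *: V_gammahat Nq Y F) /\
      ((forall q h, `|F q h| <= c / Q%:R) /\
       (forall a, eigenvalue (F^T *m F) a -> c' / Q%:R <= a)) /\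
      [/\ forall q, N%:R^-1 * \sum_i (Y i q - Ybar Y q 0) ^+ 4 <= Delta ^+ 4,
          forall i q, `|Y i q - Ybar Y q 0| <= nu &
          forall q, Slo <= Smat Y q q].

(* E g(xi) for xi ~ N(0, I_n), as an iterated Lebesgue integral against the
   standard normal density (meaningful for bounded measurable g) *)
Fixpoint gaussE (n : nat) : ('rV[R]_n -> R) -> R :=
  match n return ('rV[R]_n -> R) -> R with
  | 0 => fun g => g 0
  | n'.+1 => fun g =>
      Rintegral (@lebesgue_measure R) setT
        (fun t : R => normal_pdf 0 1 t *
                      gaussE (fun x : 'rV[R]_n' => g (row_mx (t%:M : 'rV[R]_1) x)))
  end.

Definition gauss_qf_cdf H (W : 'M[R]_H) (x : R) : R :=
  gaussE (fun xi : 'rV[R]_H => if (xi *m W *m xi^T) 0 0 <= x then 1 else 0).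

Definition chi2_cdf H (x : R) : R := gauss_qf_cdf (1%:M : 'M[R]_H) x.

Definition chi2_upper_quantile H (alpha : R) : R :=
  inf [set x : R | 1 - alpha <= chi2_cdf H x].

Definition std_normal_cdf (x : R) : R :=
  Rintegral (@lebesgue_measure R) `]-oo, x] (normal_pdf 0 1).

End Defs.

(* Main.v *)
(* Write U = V^(-1/2) (gammahat - gamma) = sum_i a(i, Z_i). A Poincare inequality for random swaps
   shows that the entries of Vhat concentrate, so That is U^T W_N U up to a negligible error.
   Swapping the treatments of two units makes (U, U') an exchangeable pair, and its Taylor
   expansion yields Stein's identity for the quadratic forms T = U^T W U,
     E (T - tr W) f(T) = 2 E (U^T W^2 U) f'(T) + O(H^4 / sqrt N).
   Integrated along the Ornstein-Uhlenbeck interpolation it gives the normal limit as H -> oo;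
   integrated along an interpolation of Laplace transforms it gives, for fixed H,
   E exp(- U^T A U / 2) -> det(1 + A)^(-1/2), the transform of a Gaussian quadratic form.
   Polynomials in exp(- lambda T) turn the latter into convergence of distribution functions,
   because Gaussian quadratic forms do not concentrate near points. Since V <= E Vhat, W_N is a
   contraction, so the limit is dominated by chi^2(H). The chi^2 quantile for H -> oo comes
   from applying both limits to sums of random signs of basis vectors. *)
Require Import Defs.
From HB Require Import structures.
From mathcomp Require Import all_boot all_order all_algebra.
From mathcomp Require Import all_fingroup.
From mathcomp Require Import all_classical all_reals all_analysis.
From mathcomp Require Import measurable_realfun.
From mathcomp Require Import ring lra.
From mathcomp Require complex.
Set Implicit Arguments. Unset Strict Implicit. Unset Printing Implicit Defensive.
Import Order.TTheory GRing.Theory Num.Theory.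
Import numFieldNormedType.Exports.
Local Open Scope classical_set_scope.
Local Open Scope ring_scope.

(** * Symmetric matrices *)

(** Two interpolations are used because of the random term [U^T W^2 U] in Stein's identity. For
    [H -> oo] it is replaced by its mean [tr W^2]: Condition 1 gives [tr W^2 >= sigF^(-4) H], and
    the fluctuations of the form are of smaller order. For fixed [H] no such averaging takes place;
    the path of Laplace transforms is built so that its derivative is Stein's expression with this
    random term kept. Conditions 1, 2 and 4 together make every summand of [U] of size at most a
    constant times [sqrt (H / N)], with all powers of [Q] cancelling. All estimates are explicit
    inequalities for a single array, uniform in the design. They serve both the given sequence and
    an auxiliary design whose [N] is chosen after [H]; this order of choices turns them into
    statements about [chi^2(H)] alone. The Gaussian law is given as an iterated integral, so the
    passage from transforms to distribution functions is carried out by explicit approximation. *)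

Section RealEigenvalue.
Import complex.

(** Over the complex numbers the matrix is Hermitian, so its spectral diagonal is real; a real root
    of the characteristic polynomial of the embedded matrix is a root over [R]. One eigenvalue is
    enough for the deflation in [real_spectral]. *)
Lemma sym_eigenvalue (R : realType) n (A : 'M[R]_n.+1) : A^T = A -> exists a, eigenvalue A a.
Proof.
move=> sA.
pose f : {rmorphism R -> complex.complex R} := complex.real_complex R.
have Asym : map_mx f A \is hermsymmx.
  apply: realsym_hermsym.
    apply/is_hermitianmxP; rewrite expr0 scale1r; apply/matrixP => i j.
    by rewrite !mxE /= -[in LHS]sA mxE.
  by apply/mxOverP => i j; rewrite mxE /f /= complex.complex_real.
have /mxOverP dreal := hermitian_spectral_diag_real Asym.
have /complex.complex_realP[a aE] := dreal 0 0.
exists a; rewrite eigenvalue_root_char -(fmorph_root f) map_char_poly.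
rewrite -eigenvalue_root_char (_ : f a = spectral_diag (map_mx f A) 0 0) //.
apply/eigenvalueP.
have /hermitian_normalmx /orthomx_spectralP {1}-> := Asym.
have u := spectral_unit (map_mx f A).
exists (row 0 (spectralmx (map_mx f A))).
  rewrite -!row_mul !mulmxA mulmxV // mul1mx.
  by rewrite row_mul row_diag_mx -scalemxAl -rowE.
apply/negP => /eqP z.
have : delta_mx 0 0 *m spectralmx (map_mx f A) = 0 :> 'rV_n.+1 by rewrite -rowE.
move/(congr1 (mulmx^~ (invmx (spectralmx (map_mx f A))))).
rewrite mulmxK // mul0mx => /matrixP/(_ 0 0)/eqP.
by rewrite !mxE !eqxx oner_eq0.
Qed.

End RealEigenvalue.

Lemma quadratic_ge0_discr (R : realFieldType) (a b c : R) : 0 <= c ->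
  (forall t, 0 <= a + 2 * t * b + t ^+ 2 * c) -> b ^+ 2 <= a * c.
Proof.
move=> c0 H; have [cz|cn0] := eqVneq c 0.
  rewrite cz mulr0; have [->|b0] := eqVneq b 0; first by rewrite expr0n.
  (* With [c = 0] the expression is affine in [t]; for nonzero [b] it would equal [-1] at this
     point. *)
  have := H (- (a + 1) / (2 * b)); rewrite cz mulr0 addr0.
  have -> : a + 2 * (- (a + 1) / (2 * b)) * b = -1 by field.
  lra.
have cp : 0 < c by rewrite lt_neqAle eq_sym cn0.
have := H (- b / c).
have -> : a + 2 * (- b / c) * b + (- b / c) ^+ 2 * c = (a * c - b ^+ 2) / c by field.
by rewrite pmulr_lge0 ?invr_gt0 // subr_ge0.
Qed.

Lemma sum_cauchy_schwarz (R : realFieldType) (I : finType) (x y : I -> R) :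
  (\sum_i x i * y i) ^+ 2 <= (\sum_i x i ^+ 2) * (\sum_i y i ^+ 2).
Proof.
apply: quadratic_ge0_discr => [|t]; first by apply: sumr_ge0 => i _; apply: sqr_ge0.
rewrite !mulr_sumr -!big_split; apply: sumr_ge0 => i _ /=.
by have := sqr_ge0 (x i + t * y i); congr (_ <= _); ring.
Qed.

Section SymmetricMatrices.
Variable R : realType.

Definition bform n (A : 'M[R]_n) (u v : 'cV[R]_n) : R := (u^T *m A *m v) 0 0.
Definition sqnorm n (v : 'cV[R]_n) : R := \sum_i v i 0 ^+ 2.

Lemma bformE n (A : 'M[R]_n) u v :
  bform A u v = \sum_i \sum_j u i 0 * A i j * v j 0.
Proof.
rewrite /bform mxE exchange_big; apply: eq_bigr => j _ /=.
rewrite mxE mulr_suml; apply: eq_bigr => i _; by rewrite mxE.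
Qed.

Lemma qformE n (A : 'M[R]_n) v : qform A v = bform A v v. Proof. by []. Qed.

Lemma bformDl n (A : 'M[R]_n) u v w : bform A (u + v) w = bform A u w + bform A v w.
Proof. by rewrite /bform linearD /= !mulmxDl mxE. Qed.
Lemma bformDr n (A : 'M[R]_n) u v w : bform A w (u + v) = bform A w u + bform A w v.
Proof. by rewrite /bform mulmxDr mxE. Qed.
Lemma bformZl n (A : 'M[R]_n) c u w : bform A (c *: u) w = c * bform A u w.
Proof. by rewrite /bform linearZ /= -!scalemxAl mxE. Qed.
Lemma bformZr n (A : 'M[R]_n) c u w : bform A w (c *: u) = c * bform A w u.
Proof. by rewrite /bform -scalemxAr mxE. Qed.
Lemma bform_sumr n (A : 'M[R]_n) I (r : seq I) (P : pred I) (u : I -> 'cV[R]_n) w :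
  bform A w (\sum_(i <- r | P i) u i) = \sum_(i <- r | P i) bform A w (u i).
Proof. by rewrite /bform mulmx_sumr summxE. Qed.

Lemma bformC n (A : 'M[R]_n) u v : A^T = A -> bform A u v = bform A v u.
Proof.
move=> sA; rewrite !bformE exchange_big; apply: eq_bigr => i _.
by apply: eq_bigr => j _; rewrite -{1}sA mxE; ring.
Qed.

Lemma bform_mulmxl n (A B : 'M[R]_n) u v : bform A (B *m u) v = bform (B^T *m A) u v.
Proof. by rewrite /bform trmx_mul !mulmxA. Qed.
Lemma bform_mulmxr n (A B : 'M[R]_n) u v : bform A u (B *m v) = bform (A *m B) u v.
Proof. by rewrite /bform !mulmxA. Qed.

Lemma qformD n (A : 'M[R]_n) u v : A^T = A ->
  qform A (u + v) = qform A u + 2 * bform A u v + qform A v.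
Proof.
by move=> sA; rewrite !qformE bformDl !bformDr (bformC v u sA); ring.
Qed.

Lemma bform1 n (u : 'cV[R]_n) : bform 1%:M u u = sqnorm u.
Proof. by rewrite /bform mulmx1 mxE; apply: eq_bigr => i _; rewrite mxE expr2. Qed.

Lemma qform1 n (u : 'cV[R]_n) : qform 1%:M u = sqnorm u. Proof. exact: bform1. Qed.

Lemma sqnorm_ge0 n (u : 'cV[R]_n) : 0 <= sqnorm u.
Proof. by apply: sumr_ge0 => i _; exact: sqr_ge0. Qed.

Lemma sqnorm_eq0 n (u : 'cV[R]_n) : sqnorm u = 0 -> u = 0.
Proof.
move=> /eqP; rewrite psumr_eq0 => [/allP u0|i _]; last exact: sqr_ge0.
apply/matrixP => i j; rewrite ord1 mxE; apply/eqP; rewrite -sqrf_eq0.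
by apply: u0; rewrite mem_index_enum.
Qed.

Lemma psd1 n : is_psd (1%:M : 'M[R]_n).
Proof. by split=> [|v]; rewrite ?trmx1 // qform1 sqnorm_ge0. Qed.

Lemma psd_cauchy_schwarz n (A : 'M[R]_n) u v : is_psd A ->
  bform A u v ^+ 2 <= qform A u * qform A v.
Proof.
move=> [sA pA].
have H t : 0 <= qform A u + 2 * t * bform A u v + t ^+ 2 * qform A v.
  have := pA (u + t *: v); rewrite qformD // bformZr.
  by rewrite [qform A (t *: v)]qformE bformZl bformZr -qformE; lra.
exact: quadratic_ge0_discr.
Qed.

Lemma invmx_sym n (A : 'M[R]_n) : A^T = A -> (invmx A)^T = invmx A.
Proof. by move=> sA; rewrite trmx_inv sA. Qed.

Lemma qform_inv n (A : 'M[R]_n) b : A^T = A -> A \in unitmx ->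
  qform (invmx A) b = qform A (invmx A *m b).
Proof.
move=> sA uA; rewrite !qformE bform_mulmxr bform_mulmxl invmx_sym //.
by rewrite mulmxV // mulmx1.
Qed.

(** [invmx] leaves a singular matrix unchanged, which covers the singular case; [That_ge0] uses it
    for a possibly singular [Vhat]. *)
Lemma psd_inv n (A : 'M[R]_n) : is_psd A -> is_psd (invmx A).
Proof.
move=> [sA pA]; split; first exact: invmx_sym.
have [uA|nuA] := boolP (A \in unitmx); last by rewrite invmx_out.
by move=> v; rewrite qform_inv.
Qed.

(** With [y = B^-1 b] and [w = A^-1 b], the number [e = b^T B^-1 b] is both [y^T B y] and [y^T A w].
    Cauchy-Schwarz for [A] gives [e^2 <= (y^T A y) (w^T A w) <= k e (b^T A^-1 b)], and one factor
    [e] is divided out. *)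
Lemma psd_inv_le n (A B : 'M[R]_n) k b : is_psd A -> is_psd B ->
  A \in unitmx -> B \in unitmx -> 0 <= k -> (forall v, qform A v <= k * qform B v) ->
  qform (invmx B) b <= k * qform (invmx A) b.
Proof.
move=> pA pB uA uB k0 AB.
have sA := pA.1; have sB := pB.1.
set y := invmx B *m b; set w := invmx A *m b; set e := qform (invmx B) b.
have eE : e = qform B y by rewrite /e qform_inv.
have eA : e = bform A y w.
  rewrite bform_mulmxr mulmxV // /bform mulmx1 /y trmx_mul invmx_sym //.
have wE : qform (invmx A) b = qform A w by rewrite qform_inv.
have e0 : 0 <= e by rewrite eE; apply: pB.2.
have := psd_cauchy_schwarz y w pA; rewrite -eA -wE => H.
have A0 : 0 <= qform (invmx A) b by rewrite wE; apply: pA.2.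
have H2 : e ^+ 2 <= k * e * qform (invmx A) b.
  apply: (le_trans H); rewrite ler_wpM2r //; by rewrite eE; apply: AB.
have [e00|ep] := eqVneq e 0; first by rewrite e00 mulr_ge0.
have ep' : 0 < e by rewrite lt_neqAle eq_sym ep.
rewrite -(ler_pM2l ep') -expr2.
by have -> : e * (k * qform (invmx A) b) = k * e * qform (invmx A) b by ring.
Qed.

Lemma sqnormE n (u : 'cV[R]_n) : u^T *m u = (sqnorm u)%:M.
Proof. by rewrite [LHS]mx11_scalar -[u in _ *m u]mul1mx mulmxA -bform1. Qed.

(** The reflection that exchanges [v] and the first basis vector; conjugation with it moves an
    eigenvector to the first coordinate. *)
Lemma householder n (v : 'cV[R]_(1 + n)) : sqnorm v = 1 ->
  exists Q : 'M[R]_(1 + n),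
    [/\ Q^T = Q, Q *m Q = 1%:M & Q *m delta_mx 0 0 = v].
Proof.
move=> v1; have [->|nv] := eqVneq v (delta_mx 0 0).
  by exists 1%:M; split; rewrite ?trmx1 ?mulmx1 // mul1mx.
pose w := v - delta_mx 0 0.
have w0 : sqnorm w != 0.
  by apply: contra nv => /eqP/sqnorm_eq0/eqP; rewrite subr_eq0.
have we : w^T *m delta_mx 0 0 = (v 0 0 - 1)%:M :> 'M[R]_1.
  rewrite [LHS]mx11_scalar; congr (_%:M); rewrite mxE (bigD1 0) //= big1.
    by rewrite !mxE !eqxx addr0 mulr1.
  by move=> i /negbTE i0; rewrite !mxE i0 mulr0.
have sw : sqnorm w = 2 - 2 * v 0 0.
  move: v1; rewrite /sqnorm !(big_ord_recl n) !mxE !eqxx /= => v1.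
  under eq_bigr => i _ do rewrite !mxE /= subr0.
  by move: v1; set s := \sum_(i < n) _; lra.
pose c := 2 / sqnorm w.
have ww : (w *m w^T) *m (w *m w^T) = sqnorm w *: (w *m w^T).
  by rewrite mulmxA -(mulmxA w) sqnormE mul_mx_scalar scalemxAl.
exists (1%:M - c *: (w *m w^T)); split.
- by rewrite linearB /= linearZ /= trmx1 trmx_mul trmxK.
- rewrite mulmxBl mul1mx mulmxBr mulmx1 -scalemxAl -scalemxAr ww !scalerA.
  have -> : c * c * sqnorm w = c + c by rewrite /c; field.
  by rewrite scalerDl; apply/matrixP => i j; rewrite !mxE; ring.
- rewrite mulmxBl mul1mx -scalemxAl -mulmxA we mul_mx_scalar scalerA.
  have -> : c * (v 0 0 - 1) = -1.
    rewrite /c sw; field; move: w0; rewrite sw; apply: contra => /eqP H.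
    by apply/eqP; lra.
  by rewrite scaleN1r opprK addrC /w subrK.
Qed.

(** Deflation: in a basis that starts with an eigenvector, symmetry clears the first row together
    with the first column, and the induction hypothesis diagonalizes the remaining block. *)
Theorem real_spectral n (A : 'M[R]_n) : A^T = A ->
  exists (O : 'M[R]_n) (d : 'rV[R]_n),
    O *m O^T = 1%:M /\ A = O^T *m diag_mx d *m O.
Proof.
elim: n A => [|n IH] A sA.
  by exists 1%:M, 0; split; apply/matrixP => -[].
have [a /eigenvalueP[u uA u0]] := sym_eigenvalue sA.
have nu : 0 < sqnorm u^T.
  rewrite lt_neqAle sqnorm_ge0 andbT eq_sym; apply: contra u0 => /eqP.
  by move/sqnorm_eq0/eqP; rewrite trmx_eq0.
pose v := (Num.sqrt (sqnorm u^T))^-1 *: u^T.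
have v1 : sqnorm v = 1.
  rewrite -bform1 bformZl bformZr bform1 mulrA -expr2 exprVn sqr_sqrtr ?ltW //.
  by rewrite mulVf // gt_eqF.
have Av : A *m v = a *: v.
  rewrite -scalemxAr scalerA mulrC -scalerA; congr (_ *: _).
  by rewrite -{1}sA -trmx_mul uA linearZ.
have [Q [sQ QQ Qe]] := @householder n v v1.
have [A' A'd] : exists A' : 'M[R]_(1 + n), A' = Q *m A *m Q by eexists.
have sA' : A'^T = A' by rewrite A'd !trmx_mul sQ sA mulmxA.
have A'e : A' *m delta_mx 0 0 = a *: delta_mx 0 0 :> 'cV[R]_(1 + n).
  rewrite A'd -!mulmxA Qe Av -scalemxAr -Qe mulmxA QQ mul1mx //.
have A'0 i : A' i 0 = a * (i == 0)%:R.
  by have /matrixP/(_ i 0) := A'e; rewrite -colE !mxE eqxx andbT.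
pose B := drsubmx A'.
have sB : B^T = B by rewrite /B trmx_drsub sA'.
have [P [d [PP BE]]] := IH B sB.
have A'E : A' = block_mx (a%:M : 'M[R]_1) 0 0 B.
  rewrite -[A']submxK; congr block_mx.
  - by apply/matrixP => i j; rewrite !ord1 !mxE lshift0 A'0 eqxx mulr1.
  - apply/matrixP => i j; rewrite !ord1 !mxE -[A']sA' mxE lshift0 A'0.
    by rewrite (_ : rshift 1 j == 0 = false) ?mulr0 //; apply/eqP.
  - apply/matrixP => i j; rewrite !ord1 !mxE lshift0 A'0.
    by rewrite (_ : rshift 1 i == 0 = false) ?mulr0 //; apply/eqP.
pose O' : 'M[R]_(1 + n) := block_mx (1%:M : 'M[R]_1) 0 0 P.
pose dd : 'rV[R]_(1 + n) := row_mx (a%:M : 'rV[R]_1) d.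
have OO : O' *m O'^T = 1%:M.
  rewrite /O' tr_block_mx !trmx0 trmx1.
  by rewrite mulmx_block !(mul0mx, mulmx0, mulmx1, addr0, add0r) PP -scalar_mx_block.
have OdO : A' = O'^T *m diag_mx dd *m O'.
  rewrite A'E /O' tr_block_mx !trmx0 trmx1 diag_mx_row.
  rewrite !mulmx_block !(mul0mx, mulmx0, mulmx1, mul1mx, addr0, add0r) -BE.
  by congr block_mx; apply/matrixP => i j; rewrite !ord1 !mxE eqxx.
have AE : A = Q *m A' *m Q by rewrite A'd !mulmxA QQ mul1mx -mulmxA QQ mulmx1.
exists (O' *m Q), dd; split.
  by rewrite trmx_mul sQ mulmxA -(mulmxA O') QQ mulmx1.
by rewrite trmx_mul sQ AE OdO !mulmxA.
Qed.

Lemma qform_diag n (d : 'rV[R]_n) v : qform (diag_mx d) v = \sum_i d 0 i * v i 0 ^+ 2.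
Proof.
rewrite qformE bformE; apply: eq_bigr => i _; rewrite (bigD1 i) //= big1.
  by rewrite mxE eqxx addr0 mulr1n; ring.
by move=> j ji; rewrite mxE eq_sym (negbTE ji) mulr0n mulr0 mul0r.
Qed.

Lemma qform_conj n m (A : 'M[R]_n) (O : 'M[R]_(n, m)) v :
  qform (O^T *m A *m O) v = qform A (O *m v).
Proof. by rewrite /qform trmx_mul !mulmxA. Qed.

Lemma ortho_sqnorm n (O : 'M[R]_n) v : O *m O^T = 1%:M -> sqnorm (O *m v) = sqnorm v.
Proof.
move=> OO; rewrite -!qform1 -qform_conj mulmx1; congr (qform _ _).
exact: mulmx1C.
Qed.

Lemma spectral_eigenvalue n (O : 'M[R]_n) d i : O *m O^T = 1%:M ->
  eigenvalue (O^T *m diag_mx d *m O) (d 0 i).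
Proof.
move=> OO; apply/eigenvalueP; exists (row i O).
  rewrite -!row_mul !mulmxA OO mul1mx row_mul row_diag_mx -scalemxAl -rowE //.
apply/negP => /eqP z; have : row i (O *m O^T) = 0 by rewrite row_mul z mul0mx.
by rewrite OO => /rowP/(_ i)/eqP; rewrite !mxE eqxx oner_eq0.
Qed.

Lemma qform_ge_eigenvalue n (A : 'M[R]_n) m v : A^T = A ->
  (forall a, eigenvalue A a -> m <= a) -> m * sqnorm v <= qform A v.
Proof.
move=> sA H; have [P [d [PP AE]]] := real_spectral sA.
rewrite {1}AE qform_conj qform_diag -(ortho_sqnorm _ PP) mulr_sumr.
apply: ler_sum => i _; rewrite ler_wpM2r ?sqr_ge0 //; apply: H.
by rewrite AE spectral_eigenvalue.
Qed.

Lemma qform_delta n (A : 'M[R]_n) i : qform A (delta_mx i 0) = A i i.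
Proof. by rewrite /qform trmx_delta -rowE -colE !mxE. Qed.

Lemma spectral_psd n (O : 'M[R]_n) d i : O *m O^T = 1%:M ->
  is_psd (O^T *m diag_mx d *m O) -> 0 <= d 0 i.
Proof.
move=> OO [_ /(_ (O^T *m delta_mx i 0))].
by rewrite qform_conj mulmxA OO mul1mx qform_delta mxE eqxx.
Qed.

Lemma sqrtmxP n (A : 'M[R]_n) : is_psd A ->
  is_psd (sqrtmx A) /\ sqrtmx A *m sqrtmx A = A.
Proof.
move=> pA; have [P [d [PP AE]]] := real_spectral pA.1.
have dp i : 0 <= d 0 i by apply: (@spectral_psd _ P) => //; rewrite -AE.
pose r : 'rV[R]_n := \row_i Num.sqrt (d 0 i).
suff : [set S : 'M[R]_n | is_psd S /\ S *m S = A] (P^T *m diag_mx r *m P).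
  by move=> /(xgetI 0).
split; first split.
- by rewrite !trmx_mul trmxK tr_diag_mx mulmxA.
- move=> v; rewrite qform_conj qform_diag; apply: sumr_ge0 => i _.
  by rewrite mulr_ge0 ?sqr_ge0 // mxE sqrtr_ge0.
- rewrite [RHS]AE !mulmxA -(mulmxA _ P) PP mulmx1 -(mulmxA _ (diag_mx r) (diag_mx r)) mulmx_diag.
  congr (_ *m diag_mx _ *m _); apply/rowP => i.
  by rewrite !mxE -expr2 sqr_sqrtr.
Qed.

Lemma psd_unitmx n (A : 'M[R]_n) m : 0 < m ->
  (forall v, m * sqnorm v <= qform A v) -> A \in unitmx.
Proof.
move=> m0 H; rewrite -unitmx_tr -row_free_unit -kermx_eq0.
apply/eqP/row_matrixP => i; rewrite row0; set u := row i _.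
have uA : u *m A^T = 0 by rewrite -row_mul mulmx_ker row0.
have := H u^T; rewrite /qform -mulmxA -[A *m _]trmxK trmx_mul trmxK uA.
rewrite trmx0 mulmx0 mxE pmulr_rle0 // => le.
have /sqnorm_eq0 : sqnorm u^T = 0 by apply/le_anti; rewrite le sqnorm_ge0.
by move/(congr1 trmx); rewrite trmxK trmx0.
Qed.

(** The matrices between 0 and the identity. The Stein bounds see the matrix only through this
    property, so they are uniform in its eigenvalues. *)
Definition psd_contraction n (B : 'M[R]_n) :=
  is_psd B /\ forall v, qform B v <= sqnorm v.

Lemma contraction_bform n (B : 'M[R]_n) u v : psd_contraction B ->
  bform B u v ^+ 2 <= sqnorm u * sqnorm v.
Proof.
move=> [pB cB]; apply: (le_trans (psd_cauchy_schwarz _ _ pB)).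
by apply: ler_pM => //; apply: pB.2.
Qed.

Lemma contraction_sqnorm n (B : 'M[R]_n) u : psd_contraction B ->
  sqnorm (B *m u) <= sqnorm u.
Proof.
move=> cB; have := contraction_bform u (B *m u) cB.
have <- : sqnorm (B *m u) = bform B u (B *m u).
  by rewrite -bform1 bform_mulmxl mulmx1 cB.1.1.
have := sqnorm_ge0 (B *m u); rewrite le_eqVlt => /orP[/eqP<- _|p].
  exact: sqnorm_ge0.
by rewrite expr2 ler_pM2r.
Qed.

Lemma contraction_mul n (B : 'M[R]_n) : psd_contraction B -> psd_contraction (B *m B).
Proof.
move=> cB; have sB := cB.1.1.
have E v : qform (B *m B) v = sqnorm (B *m v).
  by rewrite -bform1 bform_mulmxl bform_mulmxr sB mulmx1.
split=> [|v]; last by rewrite E contraction_sqnorm.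
by split=> [|v]; rewrite ?trmx_mul ?sB // E sqnorm_ge0.
Qed.

Lemma sqnorm_delta n (i : 'I_n) : sqnorm (delta_mx i 0 : 'cV[R]_n) = 1.
Proof. by rewrite -qform1 qform_delta mxE eqxx. Qed.

Lemma contraction_entry n (B : 'M[R]_n) i j : psd_contraction B -> B i j ^+ 2 <= 1.
Proof.
move=> cB; have := contraction_bform (delta_mx i 0) (delta_mx j 0) cB.
by rewrite /bform trmx_delta -rowE -colE !mxE !sqnorm_delta mulr1.
Qed.

End SymmetricMatrices.

(** * Functions of a random assignment *)

Section Randomization.
Variables (R : realType) (N Q : nat) (Nq : 'I_Q -> nat).
Local Notation assignment := {ffun 'I_N -> 'I_Q}.
Local Notation Z := (assignments N Nq).
Local Notation E := (@expect R N Q Nq).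
Implicit Types (z : assignment) (f g : assignment -> R).

Definition swap (z : assignment) (a b : 'I_N) : assignment :=
  [ffun i => z (tperm a b i)].

Lemma swapC z a b : swap z a b = swap z b a.
Proof. by apply/ffunP => i; rewrite !ffunE tpermC. Qed.

Lemma swap_id z a : swap z a a = z.
Proof. by apply/ffunP => i; rewrite !ffunE tperm1 perm1. Qed.

Lemma swapK a b : involutive (fun z => swap z a b).
Proof. by move=> z; apply/ffunP => i; rewrite !ffunE tpermK. Qed.

(** Conjugation of one transposition by another. It carries a swap past an averaging swap at the
    price of relabelling its two units. *)
Lemma swap_conj z a b c d :
  swap (swap z a b) c d = swap (swap z c d) (tperm c d a) (tperm c d b).
Proof.
apply/ffunP => i; rewrite !ffunE; congr (z _).
have /permP/(_ i) : (tperm c d * tperm a b = tperm (tperm c d a) (tperm c d b) * tperm c d)%g.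
  by rewrite -tpermJ /conjg tpermV !mulgA -(mulgA _ (tperm c d)) tperm2 mulg1.
by rewrite !permM.
Qed.

Lemma card_fiber_perm z q (p : {perm 'I_N}) :
  #|[set i | z (p i) == q]%SET| = #|[set i | z i == q]%SET|.
Proof.
rewrite -(card_imset _ (@perm_inj _ p)); apply: eq_card => i.
rewrite inE; apply/imsetP/idP => [[j]|zi]; first by rewrite inE => ? ->.
by exists ((p^-1)%g i); rewrite ?inE permKV.
Qed.

Lemma swap_assignments z a b : (swap z a b \in Z) = (z \in Z).
Proof.
rewrite !inE; apply: eq_forallb => q; rewrite -(card_fiber_perm z q (tperm a b)).
by congr (_ == _); apply: eq_card => i; rewrite !inE ffunE.
Qed.

Lemma assignments_card z q : z \in Z -> #|[set i | z i == q]%SET| = Nq q.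
Proof. by rewrite inE => /forallP/(_ q)/eqP. Qed.

Lemma assignments_sum z q : z \in Z -> \sum_a (z a == q)%:R = (Nq q)%:R :> R.
Proof.
move=> zZ; rewrite -(assignments_card q zZ) -sum1_card natr_sum [RHS]big_mkcond /=.
by apply: eq_bigr => i _; rewrite inE; case: (z i == q).
Qed.

Lemma eq_expect f g : {in Z, f =1 g} -> E f = E g.
Proof. by move=> fg; congr (_ / _); apply: eq_bigr => z; exact: fg. Qed.

Lemma expectD f g : E (fun z => f z + g z) = E f + E g.
Proof. by rewrite /expect big_split mulrDl. Qed.

Lemma expectZ c f : E (fun z => c * f z) = c * E f.
Proof. by rewrite /expect -mulr_sumr mulrA. Qed.

Lemma expectN f : E (fun z => - f z) = - E f.
Proof. by rewrite /expect sumrN mulNr. Qed.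

Lemma expectB f g : E (fun z => f z - g z) = E f - E g.
Proof. by rewrite expectD expectN. Qed.

Lemma expect_sum I (r : seq I) (P : pred I) (F : I -> assignment -> R) :
  E (fun z => \sum_(i <- r | P i) F i z) = \sum_(i <- r | P i) E (F i).
Proof. by rewrite /expect exchange_big -mulr_suml. Qed.

Lemma le_expect f g : {in Z, forall z, f z <= g z} -> E f <= E g.
Proof. by move=> fg; rewrite /expect ler_wpM2r ?invr_ge0 //; apply: ler_sum. Qed.

Lemma expect_ge0 f : {in Z, forall z, 0 <= f z} -> 0 <= E f.
Proof. by move=> f0; rewrite mulr_ge0 ?invr_ge0 //; apply: sumr_ge0. Qed.

Lemma normr_expect f : `|E f| <= E (fun z => `|f z|).
Proof.
rewrite /expect normrM [X in _ * X]ger0_norm ?invr_ge0 // ler_wpM2r ?invr_ge0 //.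
exact: ler_norm_sum.
Qed.

Lemma expect_swap f a b : E (fun z => f (swap z a b)) = E f.
Proof.
congr (_ / _); rewrite [RHS](reindex_inj (inv_inj (@swapK a b))) /=.
by apply: eq_bigl => z; rewrite swap_assignments.
Qed.

Lemma expect_cauchy_schwarz f g :
  E (fun z => f z * g z) ^+ 2 <= E (fun z => f z ^+ 2) * E (fun z => g z ^+ 2).
Proof.
set A := E (fun z => f z ^+ 2); set B := E (fun z => f z * g z).
set C := E (fun z => g z ^+ 2).
have H t : 0 <= A + 2 * t * B + t ^+ 2 * C.
  have <- : E (fun z => (f z + t * g z) ^+ 2) = A + 2 * t * B + t ^+ 2 * C.
    rewrite -!expectZ -!expectD; apply: eq_expect => z _; ring.
  by apply: expect_ge0 => z _; apply: sqr_ge0.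
by apply: quadratic_ge0_discr => //; apply: expect_ge0 => z _; apply: sqr_ge0.
Qed.

Definition lower_avg (k : 'I_N) f z := (k.+1%:R)^-1 * \sum_(j : 'I_N | (j <= k)%N) f (swap z j k).

(* The swaps (j k), j <= k, are coset representatives of S_k in S_(k+1), so [prefix_avg f m]
   averages [f] over all permutations of the first [m] units, one swap at a time. *)
Fixpoint prefix_avg f (m : nat) : assignment -> R :=
  if m is m'.+1 then
    if insub m' is Some k then lower_avg k (prefix_avg f m') else prefix_avg f m'
  else f.

Lemma lower_sum_const (k : 'I_N) (c : R) : \sum_(j : 'I_N | (j <= k)%N) c = k.+1%:R * c.
Proof.
have := big_ord_widen N (fun _ => c) (ltn_ord k); rewrite /= => <-.
by rewrite big_const_ord iter_addr_0 mulr_natl.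
Qed.

(** Centering at the mean is optimal. With [c] the value of the function before averaging, the loss
    of second moment in one averaging step is bounded by squared increments. *)
Lemma lower_avg_variance (k : 'I_N) (x : 'I_N -> R) c
    (m := (k.+1%:R)^-1 * \sum_(j : 'I_N | (j <= k)%N) x j) :
  (k.+1%:R)^-1 * \sum_(j : 'I_N | (j <= k)%N) x j ^+ 2 - m ^+ 2 <=
  (k.+1%:R)^-1 * \sum_(j : 'I_N | (j <= k)%N) (x j - c) ^+ 2.
Proof.
have -> : \sum_(j : 'I_N | (j <= k)%N) (x j - c) ^+ 2 =
  \sum_(j : 'I_N | (j <= k)%N) x j ^+ 2 - 2 * c * \sum_(j : 'I_N | (j <= k)%N) x j
   + \sum_(j : 'I_N | (j <= k)%N) c ^+ 2.
  rewrite mulr_sumr -sumrB -big_split; apply: eq_bigr => j _ /=; ring.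
rewrite lower_sum_const mulrDr mulrBr [in X in _ <= _ + X]mulrA mulVf ?pnatr_eq0 // mul1r.
rewrite [X in _ <= _ - X + _](_ : _ = 2 * c * m); last by rewrite /m; ring.
move: (_ * \sum_(j < N | _) x j ^+ 2) (sqr_ge0 (m - c)) => P; clearbody m; nra.
Qed.

Lemma lower_avg_jensen (k : 'I_N) (x : 'I_N -> R) :
  ((k.+1%:R)^-1 * \sum_(j : 'I_N | (j <= k)%N) x j) ^+ 2 <=
  (k.+1%:R)^-1 * \sum_(j : 'I_N | (j <= k)%N) x j ^+ 2.
Proof.
set m := _ * _; have : 0 <= (k.+1%:R)^-1 * \sum_(j : 'I_N | (j <= k)%N) (x j - m) ^+ 2.
  by rewrite mulr_ge0 ?invr_ge0 //; apply: sumr_ge0 => j _; apply: sqr_ge0.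
have -> : \sum_(j : 'I_N | (j <= k)%N) (x j - m) ^+ 2 =
  \sum_(j : 'I_N | (j <= k)%N) x j ^+ 2 - 2 * m * \sum_(j : 'I_N | (j <= k)%N) x j
   + \sum_(j : 'I_N | (j <= k)%N) m ^+ 2.
  rewrite mulr_sumr -sumrB -big_split; apply: eq_bigr => j _ /=; ring.
rewrite lower_sum_const mulrDr mulrBr [in X in _ <= _ + X]mulrA mulVf ?pnatr_eq0 // mul1r.
rewrite [X in _ <= _ - X + _](_ : _ = 2 * m * m); last by rewrite {3}/m; ring.
move: (_ * \sum_(j < N | _) x j ^+ 2) => P; clearbody m; nra.
Qed.

Definition influence_le D f :=
  forall a b, E (fun z => (f (swap z a b) - f z) ^+ 2) <= D.

Lemma lower_avg_mean_sqr_le (k : 'I_N) (F : 'I_N -> assignment -> R) D :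
  (forall j, E (F j) <= D) ->
  E (fun z => (k.+1%:R)^-1 * \sum_(j : 'I_N | (j <= k)%N) F j z) <= D.
Proof.
move=> H; rewrite expectZ expect_sum.
have -> : D = (k.+1%:R)^-1 * (k.+1%:R * D) by rewrite mulrA mulVf ?pnatr_eq0 // mul1r.
rewrite ler_wpM2l ?invr_ge0 // -lower_sum_const; exact: ler_sum.
Qed.

(** Jensen's inequality moves the square inside the average over [j]; [swap_conj] turns each summand
    into an increment of [g] at [swap z j k], and the law of [z] is invariant under that swap. *)
Lemma prefix_avg_influence D f m : influence_le D f -> influence_le D (prefix_avg f m).
Proof.
move=> fD; elim: m => [|m IH] //=; case: insubP => [k _ _|_] //.
set g := prefix_avg f m in IH *; move=> a b.
apply: (@le_trans _ _ (E (fun z => (k.+1%:R)^-1 * \sum_(j : 'I_N | (j <= k)%N)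
  (g (swap (swap z j k) (tperm j k a) (tperm j k b)) - g (swap z j k)) ^+ 2))).
  apply: le_expect => z _; rewrite /lower_avg -mulrBr -sumrB.
  under eq_bigr => j _ do rewrite swap_conj.
  exact: lower_avg_jensen.
apply: lower_avg_mean_sqr_le => j.
by rewrite (expect_swap (fun z => (g (swap z (tperm j k a) (tperm j k b)) - g z) ^+ 2)).
Qed.

Lemma lower_avg_sqr_drop D (k : 'I_N) g : influence_le D g ->
  E (fun z => g z ^+ 2) - E (fun z => lower_avg k g z ^+ 2) <= D.
Proof.
move=> gD.
have -> : E (fun z => g z ^+ 2) =
  E (fun z => (k.+1%:R)^-1 * \sum_(j : 'I_N | (j <= k)%N) g (swap z j k) ^+ 2).
  rewrite expectZ expect_sum.
  under eq_bigr => j _ do rewrite (expect_swap (fun z => g z ^+ 2)).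
  by rewrite lower_sum_const mulrA mulVf ?pnatr_eq0 // mul1r.
rewrite -expectB.
apply: (@le_trans _ _ (E (fun z => (k.+1%:R)^-1 * \sum_(j : 'I_N | (j <= k)%N)
  (g (swap z j k) - g z) ^+ 2))).
  by apply: le_expect => z _; apply: lower_avg_variance.
exact: lower_avg_mean_sqr_le.
Qed.

Lemma prefix_avg_sqr_drop D f m : 0 <= D -> influence_le D f ->
  E (fun z => f z ^+ 2) - E (fun z => prefix_avg f m z ^+ 2) <= m%:R * D.
Proof.
move=> D0 fD; elim: m => [|m IH] /=; first by rewrite subrr mul0r.
rewrite -natr1 mulrDl mul1r; case: insubP => [k _ _|_]; last lra.
have := lower_avg_sqr_drop k (prefix_avg_influence m fD); lra.
Qed.

Lemma prefix_avg_expect f m : E (prefix_avg f m) = E f.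
Proof.
elim: m => //= m <-; case: insubP => [k _ _|_] //.
rewrite /lower_avg expectZ expect_sum.
under eq_bigr => j _ do rewrite expect_swap.
by rewrite lower_sum_const mulrA mulVf ?pnatr_eq0 // mul1r.
Qed.

(** Multiplication by a swap of units up to [k] permutes the coset representatives, up to swaps
    below [k] that [g] absorbs. So each averaging step enlarges the symmetry group from [S_k] to
    [S_(k+1)]. *)
Lemma lower_avg_invariant (k : 'I_N) g :
  (forall z (a b : 'I_N), (a < k)%N -> (b < k)%N -> g (swap z a b) = g z) ->
  forall z (a b : 'I_N), (a <= k)%N -> (b <= k)%N ->
  lower_avg k g (swap z a b) = lower_avg k g z.
Proof.
move=> gI.
have inj (a b : 'I_N) : (a <= k)%N -> (b <= k)%N -> forall j : 'I_N, (tperm a b j <= k)%N = (j <= k)%N.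
  by move=> ak bk j; case: tpermP => [->|->|]; rewrite ?ak ?bk.
have last (z : assignment) (a : 'I_N) : (a < k)%N -> lower_avg k g (swap z a k) = lower_avg k g z.
  move=> ak; congr (_ * _); rewrite [RHS](reindex_inj (@perm_inj _ (tperm a k))) /=.
  apply: eq_big => [j|j jk]; first by rewrite inj // ltnW.
  have [->|ja] := eqVneq j a; first by rewrite tpermL swapK swap_id.
  have [->|jk'] := eqVneq j k; first by rewrite tpermR swap_id.
  rewrite (tpermD (z := j)) 1?eq_sym //.
  rewrite swap_conj tpermR.
  have ka : k != a by apply: contraTneq ak => ->; rewrite ltnn.
  rewrite (tpermD (z := a)) ?(eq_sym a) // 1?eq_sym //.
  by apply: gI => //; rewrite ltn_neqAle jk andbT -(inj_eq val_inj) in jk' *.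
move=> z a b; rewrite leq_eqVlt => /orP[/eqP/val_inj->|ak];
  rewrite leq_eqVlt => /orP[/eqP/val_inj->|bk].
- by rewrite swap_id.
- by rewrite swapC last.
- by rewrite last.
congr (_ * _); rewrite [RHS](reindex_inj (@perm_inj _ (tperm a b))) /=.
apply: eq_big => [j|j jk]; first by rewrite inj // ltnW.
have tk : tperm a b k = k by rewrite tpermD // -(inj_eq val_inj) neq_ltn ?ak ?bk.
by rewrite -[RHS](@gI _ a b) // [in RHS]swap_conj tpermK tk.
Qed.

Lemma prefix_avg_invariant f m z (a b : 'I_N) : (a < m)%N -> (b < m)%N ->
  prefix_avg f m (swap z a b) = prefix_avg f m z.
Proof.
elim: m z a b => //= m IH z a b am bm; case: insubP => [k _ km|]; last first.
  by rewrite -leqNgt => Nm; apply: IH; apply: leq_trans Nm; apply: ltn_ord.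
by apply: lower_avg_invariant => [z' a' b'||]; rewrite km //; apply: IH.
Qed.

Lemma prefix_avg_perm f z (p : {perm 'I_N}) :
  prefix_avg f N [ffun i => z (p i)] = prefix_avg f N z.
Proof.
have [ts -> _] := prod_tpermP p; elim/last_ind: ts z => [|ts t IH] z.
  by congr prefix_avg; apply/ffunP => i; rewrite ffunE big_nil perm1.
rewrite -[RHS](prefix_avg_invariant f _ (ltn_ord t.1) (ltn_ord t.2)) -(IH (swap z t.1 t.2)).
congr prefix_avg; apply/ffunP => i; rewrite !ffunE; congr (z _).
by rewrite -cats1 big_cat big_seq1 permM.
Qed.

Lemma assignments_perm z z' : z \in Z -> z' \in Z ->
  exists p : {perm 'I_N}, z' = [ffun i => z (p i)].
Proof.
move=> zZ z'Z.
have : perm_eq [tuple z' i | i < N] [tuple z i | i < N].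
  have cE q y : y \in Z -> count_mem q [tuple y i | i < N] = Nq q.
    move=> yZ; rewrite -(assignments_card q yZ) -sum1_count big_map val_ord_tuple.
    by rewrite big_enum_cond -sum1_card; apply: eq_bigl => i; rewrite !inE.
  apply/allP => q _; apply/eqP; exact: etrans (cE q _ z'Z) (esym (cE q _ zZ)).
move=> /tuple_permP[p pE]; exists p; apply/ffunP => i; rewrite ffunE.
have : [tuple z' i | i < N] = [tuple tnth [tuple z i | i < N] (p i) | i < N].
  exact: val_inj.
by move/(congr1 (fun t => tnth t i)); rewrite !tnth_mktuple.
Qed.

Hypothesis NqN : (\sum_q Nq q)%N = N.

(** Expectations divide by the number of assignments, so constants have the right mean only if one
    exists. Enumerating the pairs of a group and a position in it yields one by taking first
    components. *)
Lemma assignments_neq0 : (0 < #|Z|)%N.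
Proof.
pose T := {q : 'I_Q & 'I_(Nq q)}.
have cT : #|{: T}| = N.
  by rewrite card_tagged sumnE big_map big_enum /= -NqN; apply: eq_bigr => q _; rewrite card_ord.
apply/card_gt0P; exists [ffun i => tag (enum_val (cast_ord (esym cT) i))].
rewrite inE; apply/forallP => q; apply/eqP.
rewrite -[RHS]card_ord.
have injT : injective (fun j : 'I_(Nq q) => cast_ord cT (enum_rank (Tagged (fun q => 'I_(Nq q)) j))).
  by move=> j j' /cast_ord_inj/enum_rank_inj/eqP; rewrite eq_Tagged => /eqP.
rewrite -(card_imset _ injT).
apply: eq_card => i; rewrite inE ffunE; apply/eqP/imsetP => [|[j _ ->]]; last first.
  by rewrite cast_ordK enum_rankK.
case uE: (enum_val _) => [q0 j] /= q0q.
case: _ / q0q; exists j => //; apply: (canRL (cast_ordKV cT)).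
by apply: enum_val_inj; rewrite uE enum_rankK.
Qed.

Lemma expect_cst c : E (fun=> c) = c.
Proof.
rewrite /expect sumr_const -[_ *+ _]mulr_natl mulrAC mulfV ?mul1r //.
by rewrite pnatr_eq0 -lt0n assignments_neq0.
Qed.

Lemma prefix_avg_const f z : z \in Z -> prefix_avg f N z = E f.
Proof.
move=> zZ; rewrite -(prefix_avg_expect f N) -[LHS]expect_cst; apply: eq_expect => z' z'Z.
by have [p ->] := assignments_perm zZ z'Z; rewrite prefix_avg_perm.
Qed.

(** The Poincare inequality. Averaging over all [N] units produces the constant [E f], so the
    variance is the total loss of second moment over [N] steps, each at most [D]. *)
Lemma variance_le_influence D f : 0 <= D -> influence_le D f ->
  E (fun z => (f z - E f) ^+ 2) <= N%:R * D.
Proof.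
move=> D0 fD; apply: le_trans (prefix_avg_sqr_drop N D0 fD).
have -> : E (fun z => prefix_avg f N z ^+ 2) = E f ^+ 2.
  by rewrite -[RHS]expect_cst; apply: eq_expect => z zZ; rewrite prefix_avg_const.
have -> : E (fun z => (f z - E f) ^+ 2) =
    E (fun z => f z ^+ 2 - (2 * E f) * f z + E f ^+ 2).
  by apply: eq_expect => z _; ring.
rewrite expectD expectB expectZ expect_cst; lra.
Qed.

Lemma expect_pair_swap (h : 'I_Q -> 'I_Q -> R) a b a' b' : a != b -> a' != b' ->
  E (fun z => h (z a) (z b)) = E (fun z => h (z a') (z b')).
Proof.
move=> ab a'b'.
pose c := tperm a a' b; have ca' : c != a'.
  by rewrite -(tpermL a a') (inj_eq perm_inj) eq_sym.
pose f z := h (z a) (z b).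
rewrite -(expect_swap f a a') -(expect_swap (fun z => f (swap z a a')) c b').
apply: eq_expect => z _; rewrite /f !ffunE tpermL -/c tpermL.
by rewrite tpermD // eq_sym.
Qed.

Lemma expect_swap1 (h : 'I_Q -> R) a a' : E (fun z => h (z a)) = E (fun z => h (z a')).
Proof.
by rewrite -(expect_swap _ a a'); apply: eq_expect => z _; rewrite ffunE tpermL.
Qed.

Hypothesis N_gt0 : (0 < N)%N.

Lemma expect1 (h : 'I_Q -> R) a : E (fun z => h (z a)) = \sum_q (Nq q)%:R / N%:R * h q.
Proof.
have N0 : N%:R != 0 :> R by rewrite pnatr_eq0 -lt0n.
apply: (mulfI N0); rewrite mulr_sumr.
have -> : N%:R * E (fun z => h (z a)) = \sum_(b < N) E (fun z => h (z b)).
  under eq_bigr => b _ do rewrite (expect_swap1 h b a).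
  by rewrite sumr_const card_ord mulr_natl.
rewrite -expect_sum -[RHS]expect_cst; apply: eq_expect => z zZ.
transitivity (\sum_(b < N) \sum_q (z b == q)%:R * h q).
  apply: eq_bigr => b _; rewrite (bigD1 (z b)) //= eqxx mul1r big1 ?addr0 //.
  by move=> q /negbTE; rewrite eq_sym => ->; rewrite mul0r.
rewrite exchange_big; apply: eq_bigr => q _ /=.
by rewrite -mulr_suml assignments_sum //; field.
Qed.

(** The law of [(z a, z b)] is the same for all ordered pairs of distinct units, so it is found by
    summing over all pairs, a sum that the group sizes determine. Sampling without replacement is
    responsible for the [(q == q')] correction. *)
Lemma expect2 (h : 'I_Q -> 'I_Q -> R) (a b : 'I_N) : a != b ->
  E (fun z => h (z a) (z b)) = \sum_q \sum_q'
   (Nq q)%:R * ((Nq q')%:R - (q == q')%:R) / (N%:R * (N%:R - 1)) * h q q'.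
Proof.
move=> ab.
have N2 : (1 < N)%N.
  case: N a b ab => [|[|n]] // a b; [by case: a|by rewrite !ord1].
have N0 : N%:R != 0 :> R by rewrite pnatr_eq0 -lt0n.
have N1 : N%:R - 1 != 0 :> R by rewrite subr_eq0 pnatr_eq1 gtn_eqF.
apply: (mulfI N0); apply: (mulfI N1); rewrite mulr_sumr.
have -> : (N%:R - 1) * (N%:R * E (fun z => h (z a) (z b))) =
   \sum_(c < N) \sum_(d < N | d != c) E (fun z => h (z c) (z d)).
  have S (c : 'I_N) : \sum_(d < N | d != c) E (fun z => h (z c) (z d)) =
     (N%:R - 1) * E (fun z => h (z a) (z b)).
    rewrite (eq_bigr (fun=> E (fun z => h (z a) (z b)))); last first.
      by move=> d dc; apply: expect_pair_swap; rewrite // eq_sym.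
    rewrite sumr_const cardC1 card_ord -[LHS]mulr_natl; congr (_ * _).
    by rewrite -subn1 natrB.
  rewrite (eq_bigr _ (fun c _ => S c)) sumr_const card_ord -[RHS]mulr_natl; ring.
under eq_bigr => c _ do rewrite -expect_sum.
rewrite -expect_sum -[RHS]expect_cst; apply: eq_expect => z zZ.
pose I c q : R := (z c == q)%:R.
have hE c d : h (z c) (z d) = \sum_q \sum_q' I c q * I d q' * h q q'.
  rewrite (bigD1 (z c)) //= [X in _ + X]big1 ?addr0 => [|q /negbTE]; last first.
    by rewrite eq_sym /I => ->; apply: big1 => q' _; rewrite !mul0r.
  rewrite (bigD1 (z d)) //= [X in _ + X]big1 ?addr0 => [|q /negbTE]; last first.
    by rewrite eq_sym /I => ->; rewrite mulr0 mul0r.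
  by rewrite /I !eqxx !mul1r.
transitivity (\sum_q \sum_q' (\sum_(c < N) \sum_(d < N | d != c) I c q * I d q') * h q q').
  under eq_bigr => c _ do under eq_bigr => d _ do rewrite hE.
  under eq_bigr => c _ do rewrite exchange_big.
  rewrite exchange_big; apply: eq_bigr => q _ /=.
  under eq_bigr => c _ do rewrite exchange_big.
  rewrite exchange_big; apply: eq_bigr => q' _ /=.
  by rewrite mulr_suml; apply: eq_bigr => c _; rewrite mulr_suml.
rewrite !mulr_sumr; apply: eq_bigr => q _; rewrite !mulr_sumr; apply: eq_bigr => q' _.
have -> : \sum_(c < N) \sum_(d < N | d != c) I c q * I d q' =
   (Nq q)%:R * ((Nq q')%:R - (q == q')%:R).
  have S (c : 'I_N) : \sum_(d < N | d != c) I c q * I d q' =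
       I c q * ((Nq q')%:R - (q == q')%:R).
    rewrite -mulr_sumr -(assignments_sum q' zZ) (bigD1 c (P := xpredT)) //= /I.
    have [<-|] := eqVneq (z c) q; last by rewrite !mul0r.
    by rewrite addrC addrK.
  by rewrite (eq_bigr _ (fun c _ => S c)) -mulr_suml assignments_sum.
by field; rewrite N0 N1.
Qed.

(** The joint weights do not depend on the pair of units. Hence in the off-diagonal part the sum of
    [psi b] over [b != a] is the total minus [psi a]; the total is multiplied by the sum of [phi a],
    which is 0, and only a diagonal term with a minus sign survives. *)
Lemma expect_mul_centered (phi psi : 'I_N -> 'I_Q -> R) :
  (forall q, \sum_a phi a q = 0) ->
  E (fun z => (\sum_a phi a (z a)) * (\sum_b psi b (z b))) =
  \sum_q (Nq q)%:R / N%:R * (\sum_a phi a q * psi a q) -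
  \sum_q \sum_q' (Nq q)%:R * ((Nq q')%:R - (q == q')%:R) / (N%:R * (N%:R - 1))
     * (\sum_a phi a q * psi a q').
Proof.
move=> phi0.
transitivity (\sum_(a < N) (E (fun z => phi a (z a) * psi a (z a)) +
   \sum_(b < N | b != a) E (fun z => phi a (z a) * psi b (z b)))).
  transitivity (E (fun z => \sum_(a < N) \sum_(b < N) phi a (z a) * psi b (z b))).
    by apply: eq_expect => z _; rewrite mulr_suml; apply: eq_bigr => a _; rewrite mulr_sumr.
  by rewrite expect_sum; apply: eq_bigr => a _; rewrite expect_sum (bigD1 a).
rewrite big_split /=; congr (_ + _).
  under eq_bigr => a _ do rewrite (expect1 (fun q => phi a q * psi a q)).
  by rewrite exchange_big; apply: eq_bigr => q _; rewrite mulr_sumr.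
pose w q q' : R := (Nq q)%:R * ((Nq q')%:R - (q == q')%:R) / (N%:R * (N%:R - 1)).
transitivity (\sum_q \sum_q' \sum_(a < N) \sum_(b < N | b != a)
    w q q' * (phi a q * psi b q')).
  under eq_bigr => a _.
    under eq_bigr => b ba do
      rewrite (@expect2 (fun q q' => phi a q * psi b q') a b) 1?eq_sym //.
    rewrite exchange_big /=.
    over.
  rewrite exchange_big /=; apply: eq_bigr => q _.
  under eq_bigr => a _ do rewrite exchange_big /=.
  by rewrite exchange_big.
rewrite -sumrN; apply: eq_bigr => q _; rewrite -sumrN; apply: eq_bigr => q' _.
rewrite -/(w q q') -mulrN -sumrN.
transitivity (w q q' * (\sum_(a < N) phi a q * (\sum_b psi b q' - psi a q'))).
  rewrite mulr_sumr; apply: eq_bigr => a _.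
  by rewrite -mulr_sumr -mulr_sumr (bigD1 a (P := xpredT)) //= addrC addrK.
congr (_ * _); under eq_bigr => a _ do rewrite mulrBr.
by rewrite sumrB -mulr_suml phi0 mul0r sub0r -sumrN.
Qed.

End Randomization.

(** * Exchangeable pairs and quadratic forms *)

Lemma normrM_le_sqr (R : realDomainType) (x y c : R) :
  x ^+ 2 <= c -> y ^+ 2 <= c -> `|x * y| <= c.
Proof.
move=> x2 y2; have := (sqr_ge0 (x - y), sqr_ge0 (x + y)) => -[s1 s2].
by rewrite ler_norml; apply/andP; split; nra.
Qed.

Section ExchangeablePair.
Variables (R : realType) (N Q H : nat) (Nq : 'I_Q -> nat).
Variables (a : 'I_N -> 'I_Q -> 'cV[R]_H) (e : R).
Hypothesis NqN : (\sum_q Nq q)%N = N.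
Hypothesis N_gt0 : (0 < N)%N.
Hypothesis a_centered : forall q, \sum_i a i q = 0.
Hypothesis e_ge0 : 0 <= e.
Hypothesis a_small : forall i q, 16 * sqnorm (a i q) <= e ^+ 2.
Local Notation assignment := {ffun 'I_N -> 'I_Q}.
Local Notation E := (@expect R N Q Nq).

Definition assignment_sum (z : assignment) : 'cV[R]_H := \sum_i a i (z i).
Local Notation U := assignment_sum.
Hypothesis U_isotropic : forall h k, E (fun z => U z h 0 * U z k 0) = (h == k)%:R.

Definition swap_diff (z : assignment) i j : 'cV[R]_H := U (swap z i j) - U z.
Local Notation D := swap_diff.

Lemma swap_diffE z i j :
  D z i j = if i == j then 0 else a i (z j) + a j (z i) - a i (z i) - a j (z j).
Proof.
have [<-|ij] := eqVneq i j; first by rewrite /D swap_id subrr.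
rewrite /D /U (bigD1 i) //= [X in _ - X](bigD1 i) //= (bigD1 j) 1?eq_sym //=.
rewrite [X in _ - (_ + X)](bigD1 j) 1?eq_sym //= !ffunE tpermL tpermR.
rewrite (eq_bigr (fun k => a k (z k))) => [|k /andP[ki kj]]; last first.
  by rewrite ffunE tpermD // eq_sym.
by apply/matrixP => k l; rewrite !mxE; ring.
Qed.

Lemma swap_diff_addE z i j :
  D z i j = a i (z j) + a j (z i) - a i (z i) - a j (z j).
Proof.
rewrite swap_diffE; case: eqP => // <-.
by apply/matrixP => k l; rewrite !mxE; ring.
Qed.

(** The 16 in [a_small] is made for this: the increment has four terms, and the squared norm of a
    sum of four vectors is at most 4 times the sum of the squared norms. *)
Lemma swap_diff_sqnorm z i j : sqnorm (D z i j) <= e ^+ 2.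
Proof.
have H4 (w x y v : 'cV[R]_H) : sqnorm (w + x - y - v) <=
    4 * (sqnorm w + sqnorm x + sqnorm y + sqnorm v).
  rewrite /sqnorm -!big_split mulr_sumr; apply: ler_sum => k _ /=.
  rewrite !mxE; set p := w k 0; set q := x k 0; set r := y k 0; set s := v k 0.
  have := (sqr_ge0 (p - q), sqr_ge0 (p + r), sqr_ge0 (p + s), sqr_ge0 (q + r), sqr_ge0 (q + s), sqr_ge0 (r - s)).
  case=> [[[[[]]]]]; clearbody p q r s; nra.
rewrite swap_diff_addE; apply: (le_trans (H4 _ _ _ _)).
have := (a_small i (z j), a_small j (z i), a_small i (z i), a_small j (z j)).
case=> [[[]]]; lra.
Qed.

Lemma swap_diff_local z i j b c : i != b -> i != c -> j != b -> j != c ->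
  D (swap z b c) i j = D z i j.
Proof.
move=> ib ic jb jc; rewrite !swap_diffE !ffunE.
by rewrite !tpermD // eq_sym.
Qed.

(** The linear regression condition of an exchangeable pair, here without remainder: the terms with
    a new treatment sum to 0 because the contributions of each treatment are centered. *)
Lemma sum_swap_diff z : \sum_i \sum_j D z i j = - (2 * N%:R) *: U z.
Proof.
under eq_bigr => i _ do under eq_bigr => j _ do rewrite swap_diff_addE.
under eq_bigr => i _ do rewrite !sumrB big_split /=.
have S1 : \sum_(i < N) \sum_(j < N) a i (z j) = 0.
  by rewrite exchange_big big1 //= => j _; apply: a_centered.
have S2 : \sum_(i < N) \sum_(j < N) a j (z i) = 0.
  by rewrite big1 //= => j _; apply: a_centered.
rewrite !sumrB big_split /= S1 S2 addr0 sub0r.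
have -> : \sum_(i < N) \sum_(j < N) a i (z i) = N%:R *: U z.
  rewrite /U scaler_sumr; apply: eq_bigr => i _.
  by rewrite sumr_const card_ord scaler_nat.
have -> : \sum_(i < N) \sum_(j < N) a j (z j) = N%:R *: U z.
  by rewrite sumr_const card_ord scaler_nat.
by apply/matrixP => k l; rewrite !mxE; ring.
Qed.

Lemma swap_UE z i j : U (swap z i j) = U z + D z i j.
Proof. by rewrite /D addrC subrK. Qed.

Let N0 : N%:R != 0 :> R. Proof. by rewrite pnatr_eq0 -lt0n. Qed.
Let Np : 0 < N%:R :> R. Proof. by rewrite ltr0n. Qed.

(** Since [U] and its swapped copy have the same second moments, the regression forces the sum of
    [D D^T] over all pairs to have mean [4 N] times the identity. Hence the normalization: this is a
    mean-zero deviation. *)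
Definition second_moment_dev z h k : R :=
  (4 * N%:R)^-1 * (\sum_i \sum_j D z i j h 0 * D z i j k 0) - (h == k)%:R.
Local Notation M := second_moment_dev.

Lemma second_momentE z h k :
  \sum_i \sum_j D z i j h 0 * D z i j k 0 = 4 * N%:R * (M z h k + (h == k)%:R).
Proof. by rewrite /M subrK mulrA mulfV ?mul1r // mulf_neq0 ?pnatr_eq0 // -lt0n. Qed.

Lemma expect_second_moment_dev h k : E (fun z => M z h k) = 0.
Proof.
suff S : E (fun z => \sum_i \sum_j D z i j h 0 * D z i j k 0) = 4 * N%:R * (h == k)%:R.
  rewrite /M expectB expectZ S expect_cst // mulrA mulVf ?mul1r ?subrr //.
  by rewrite mulf_neq0 ?pnatr_eq0 // -lt0n.
have Z : E (fun z => \sum_i \sum_j (U (swap z i j) h 0 * U (swap z i j) k 0 - U z h 0 * U z k 0)) = 0.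
  rewrite expect_sum big1 // => i _; rewrite expect_sum big1 // => j _.
  by rewrite expectB (expect_swap _ (fun z => U z h 0 * U z k 0)) subrr.
have X z : \sum_i \sum_j (U (swap z i j) h 0 * U (swap z i j) k 0 - U z h 0 * U z k 0) =
   \sum_i \sum_j D z i j h 0 * D z i j k 0 - 4 * N%:R * (U z h 0 * U z k 0).
  have S1 l : \sum_i \sum_j D z i j l 0 = - (2 * N%:R) * U z l 0.
    have /matrixP/(_ l 0) := sum_swap_diff z; rewrite !mxE => <-.
    by rewrite summxE; apply: eq_bigr => i _; rewrite summxE.
  transitivity (\sum_i \sum_j D z i j h 0 * D z i j k 0 + U z h 0 * (\sum_i \sum_j D z i j k 0)
     + U z k 0 * (\sum_i \sum_j D z i j h 0)); last by rewrite !S1; ring.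
  rewrite !mulr_sumr -!big_split; apply: eq_bigr => i _ /=.
  rewrite !mulr_sumr -!big_split; apply: eq_bigr => j _ /=.
  by rewrite swap_UE !mxE; ring.
have := Z; rewrite (eq_expect (fun z _ => X z)) expectB expectZ U_isotropic.
lra.
Qed.

Lemma sqr_entry_le n (u : 'cV[R]_n) h : u h 0 ^+ 2 <= sqnorm u.
Proof.
rewrite /sqnorm (bigD1 h) //= lerDl; apply: sumr_ge0 => i _; exact: sqr_ge0.
Qed.

(** Swapping [b] and [c] affects only the pairs [(i, j)] that meet [{b, c}], counted by [I i + I j]
    with total [4 N]. Each product moves by at most [2 e^2], so after division by [4 N] the change
    is at most [2 e^2]. *)
Lemma second_moment_dev_influence h k :
  influence_le Nq (4 * e ^+ 4) (fun z => M z h k).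
Proof.
move=> b c; rewrite -[X in _ <= X](expect_cst NqN); apply: le_expect => z _.
have B z' i j : `|D z' i j h 0 * D z' i j k 0| <= e ^+ 2.
  have x2 := le_trans (sqr_entry_le (D z' i j) h) (swap_diff_sqnorm z' i j).
  have y2 := le_trans (sqr_entry_le (D z' i j) k) (swap_diff_sqnorm z' i j).
  exact: normrM_le_sqr.
pose I (i : 'I_N) : R := (i == b)%:R + (i == c)%:R.
have I0 i : 0 <= I i by rewrite addr_ge0.
have SI : \sum_i I i = 2.
  rewrite big_split /= (bigD1 b) //= eqxx big1 ?addr0 => [|i /negbTE->//].
  by rewrite (bigD1 c) //= eqxx big1 ?addr0 // => i /negbTE->.
have T i j : `|D (swap z b c) i j h 0 * D (swap z b c) i j k 0 - D z i j h 0 * D z i j k 0|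
   <= 2 * e ^+ 2 * (I i + I j).
  have [Ip|In] := leP 1 (I i + I j).
    apply: (le_trans (ler_normB _ _)).
    have := (B (swap z b c) i j, B z i j, sqr_ge0 e) => -[[]]; nra.
  suff -> : D (swap z b c) i j = D z i j.
    by rewrite subrr normr0; apply: mulr_ge0; rewrite ?addr_ge0 // mulr_ge0 ?sqr_ge0.
  have Ib : 1 <= I b by rewrite /I eqxx lerDl.
  have Ic : 1 <= I c by rewrite /I eqxx lerDr.
  apply: swap_diff_local; apply: contraTneq In => ->; rewrite -leNgt.
  - by apply: (le_trans Ib); rewrite lerDl.
  - by apply: (le_trans Ic); rewrite lerDl.
  - by apply: (le_trans Ib); rewrite lerDr.
  - by apply: (le_trans Ic); rewrite lerDr.
have -> : 4 * e ^+ 4 = (2 * e ^+ 2) ^+ 2 by ring.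
rewrite -real_normK ?num_real // ler_pXn2r ?nnegrE ?mulr_ge0 ?sqr_ge0 //.
rewrite /M opprB addrA subrK -mulrBr normrM ger0_norm ?invr_ge0 ?mulr_ge0 //.
rewrite mulrC ler_pdivrMr ?mulr_gt0 // -sumrB.
apply: (le_trans (ler_norm_sum _ _ _)).
apply: (@le_trans _ _ (\sum_i \sum_j 2 * e ^+ 2 * (I i + I j))).
  apply: ler_sum => i _; rewrite -sumrB.
  by apply: (le_trans (ler_norm_sum _ _ _)); apply: ler_sum => j _; apply: T.
rewrite (eq_bigr (fun i => 2 * e ^+ 2 * (N%:R * I i + 2))) => [|i _]; last first.
  by rewrite -mulr_sumr big_split /= SI sumr_const card_ord -[I i *+ N]mulr_natl.
rewrite -mulr_sumr big_split /= -mulr_sumr SI sumr_const card_ord -[2 *+ N]mulr_natl.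
by rewrite le_eqVlt; apply/orP; left; apply/eqP; ring.
Qed.

Definition second_moment_dev_fro z : R := \sum_h \sum_k M z h k ^+ 2.
Local Notation Fr := second_moment_dev_fro.

Lemma second_moment_dev_fro_ge0 z : 0 <= Fr z.
Proof. by apply: sumr_ge0 => h _; apply: sumr_ge0 => k _; apply: sqr_ge0. Qed.

Lemma expect_second_moment_dev_fro : E Fr <= H%:R ^+ 2 * (N%:R * (4 * e ^+ 4)).
Proof.
rewrite /Fr expect_sum.
under eq_bigr => h _ do rewrite expect_sum.
apply: (@le_trans _ _ (\sum_(h < H) \sum_(k < H) N%:R * (4 * e ^+ 4))); last first.
  by rewrite !sumr_const card_ord -mulrnA -[_ *+ (H * H)]mulr_natl natrM expr2.
apply: ler_sum => h _; apply: ler_sum => k _.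
have := variance_le_influence NqN _ (second_moment_dev_influence h k).
rewrite expect_second_moment_dev; under eq_expect do rewrite subr0.
by apply; rewrite mulr_ge0 ?exprn_even_ge0.
Qed.

Local Notation s_ z := (sqnorm (U z)).

Lemma expect_sqnorm : E (fun z => s_ z) = H%:R.
Proof.
rewrite /sqnorm expect_sum (eq_bigr (fun=> 1)) => [|h _].
  by rewrite sumr_const card_ord.
rewrite (eq_expect (g := fun z => U z h 0 * U z h 0)) => [|z _]; last by rewrite expr2.
by rewrite U_isotropic eqxx.
Qed.

Lemma normr_le_sqr (x c : R) : 0 <= c -> x ^+ 2 <= c ^+ 2 -> `|x| <= c.
Proof.
move=> c0 xc; rewrite -(@ler_pXn2r _ 2) ?nnegrE // real_normK ?num_real //.
Qed.

Lemma bform_swap_diff B z i j : psd_contraction B ->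
  bform B (U z) (D z i j) ^+ 2 <= s_ z * e ^+ 2.
Proof.
move=> cB; apply: (le_trans (contraction_bform _ _ cB)).
by rewrite ler_wpM2l ?sqnorm_ge0 // swap_diff_sqnorm.
Qed.

Lemma qform_swap_diff B z i j : psd_contraction B ->
  0 <= qform B (D z i j) <= e ^+ 2.
Proof.
move=> cB; rewrite cB.1.2 /=; apply: (le_trans (cB.2 _)).
exact: swap_diff_sqnorm.
Qed.

Lemma contraction1 : psd_contraction (1%:M : 'M[R]_H).
Proof. by split=> [|v]; [exact: psd1|rewrite qform1]. Qed.

Lemma qform_swapE B z i j : B^T = B ->
  qform B (U (swap z i j)) - qform B (U z) =
  2 * bform B (U z) (D z i j) + qform B (D z i j).
Proof. by move=> sB; rewrite swap_UE qformD //; ring. Qed.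

(** The fourth moment through the Poincare inequality for [|U|^2]: a swap changes it by [2 p + q]
    with [p^2 <= |U|^2 e^2] and [q <= e^2], and [(2 p + q)^2 <= 8 p^2 + 2 q^2]. *)
Lemma expect_sqnorm_sqr :
  E (fun z => s_ z ^+ 2) <= H%:R ^+ 2 + N%:R * (8 * e ^+ 2 * H%:R + 2 * e ^+ 4).
Proof.
have infl : influence_le Nq (8 * e ^+ 2 * H%:R + 2 * e ^+ 4) (fun z => s_ z).
  move=> b c; rewrite -[X in _ <= _ + X](expect_cst NqN) -expect_sqnorm -expectZ -expectD.
  apply: le_expect => z _; rewrite -!qform1 qform_swapE ?trmx1 //.
  have := (bform_swap_diff z b c contraction1, qform_swap_diff z b c contraction1).
  move: (bform _ _ _) (qform _ (D _ _ _)) (sqnorm_ge0 (U z)) => p q s0 [p2 /andP[q0 q1]].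
  have q2 : q ^+ 2 <= e ^+ 4.
    have -> : e ^+ 4 = (e ^+ 2) ^+ 2 by ring.
    by rewrite ler_pXn2r ?nnegrE ?sqr_ge0.
  have := sqr_ge0 (2 * p - q); rewrite qform1; nra.
have := variance_le_influence NqN _ infl; rewrite expect_sqnorm => V.
have {}V : E (fun z => (s_ z - H%:R) ^+ 2) <= N%:R * (8 * e ^+ 2 * H%:R + 2 * e ^+ 4).
  by apply: V; rewrite addr_ge0 ?mulr_ge0 ?sqr_ge0 ?exprn_even_ge0.
have VE : E (fun z => (s_ z - H%:R) ^+ 2) = E (fun z => s_ z ^+ 2) - H%:R ^+ 2.
  have -> : E (fun z => (s_ z - H%:R) ^+ 2) =
      E (fun z => s_ z ^+ 2 - (2 * H%:R) * s_ z + H%:R ^+ 2).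
    by apply: eq_expect => z _; ring.
  rewrite expectD expectB expectZ expect_cst // expect_sqnorm; ring.
by move: V; rewrite VE; lra.
Qed.

(** [w^T M w], and next [tr (B M)]: the two errors made when the second moment of the increments,
    given [z], is replaced by its mean. *)
Definition qform_dev z (w : 'cV[R]_H) : R := \sum_h \sum_k w h 0 * w k 0 * M z h k.
Definition trace_dev z (B : 'M[R]_H) : R := \sum_h \sum_k B h k * M z h k.

Lemma pair_cauchy_schwarz (x y : 'I_H -> 'I_H -> R) :
  (\sum_h \sum_k x h k * y h k) ^+ 2 <=
  (\sum_h \sum_k x h k ^+ 2) * (\sum_h \sum_k y h k ^+ 2).
Proof. by rewrite !pair_bigA /=; apply: sum_cauchy_schwarz. Qed.

Lemma qform_dev_le z w : qform_dev z w ^+ 2 <= sqnorm w ^+ 2 * Fr z.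
Proof.
apply: (le_trans (pair_cauchy_schwarz _ _)).
rewrite ler_wpM2r ?second_moment_dev_fro_ge0 //.
rewrite le_eqVlt; apply/orP; left; apply/eqP.
rewrite /sqnorm [RHS]expr2 mulr_suml; apply: eq_bigr => h _.
by rewrite mulr_sumr; apply: eq_bigr => k _; ring.
Qed.

Lemma trace_dev_le z B : psd_contraction B -> trace_dev z B ^+ 2 <= H%:R ^+ 2 * Fr z.
Proof.
move=> cB; apply: (le_trans (pair_cauchy_schwarz _ _)).
rewrite ler_wpM2r ?second_moment_dev_fro_ge0 //.
apply: (@le_trans _ _ (\sum_(h < H) \sum_(k < H) 1)).
  by apply: ler_sum => h _; apply: ler_sum => k _; apply: contraction_entry.
by rewrite !sumr_const card_ord -mulrnA natrM expr2.
Qed.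

Lemma sum_bform_sqr B z : B^T = B ->
  \sum_i \sum_j bform B (U z) (D z i j) ^+ 2 =
  4 * N%:R * (qform_dev z (B *m U z) + sqnorm (B *m U z)).
Proof.
move=> sB; set w := B *m U z.
have bE i j : bform B (U z) (D z i j) = \sum_h w h 0 * D z i j h 0.
  rewrite bformE exchange_big; apply: eq_bigr => h _ /=.
  rewrite [w h 0]mxE mulr_suml; apply: eq_bigr => k _.
  by rewrite -{1}sB mxE; ring.
transitivity (\sum_h \sum_k w h 0 * w k 0 * (4 * N%:R * (M z h k + (h == k)%:R))).
  under eq_bigr => i _ do under eq_bigr => j _ do rewrite bE expr2 mulr_suml.
  under eq_bigr => i _ do rewrite exchange_big /=.
  rewrite exchange_big /=; apply: eq_bigr => h _.
  under eq_bigr => i _ do under eq_bigr => j _ do rewrite mulr_sumr.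
  under eq_bigr => i _ do rewrite exchange_big /=.
  rewrite exchange_big /=; apply: eq_bigr => k _.
  rewrite -second_momentE mulr_sumr; apply: eq_bigr => i _.
  by rewrite mulr_sumr; apply: eq_bigr => j _; ring.
rewrite mulrDr !mulr_sumr -big_split; apply: eq_bigr => h _ /=.
rewrite mulr_sumr (bigD1 h) //= [X in _ = X + _](bigD1 h) //= eqxx.
rewrite (eq_bigr (fun k => 4 * N%:R * (w h 0 * w k 0 * M z h k))) => [|k /negbTE]; last first.
  by rewrite eq_sym => -> /=; ring.
rewrite /=; ring.
Qed.

Lemma sum_qform B z :
  \sum_i \sum_j qform B (D z i j) = 4 * N%:R * (trace_dev z B + \tr B).
Proof.
transitivity (\sum_h \sum_k B h k * (4 * N%:R * (M z h k + (h == k)%:R))).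
  under eq_bigr => i _ do under eq_bigr => j _ do rewrite qformE bformE.
  under eq_bigr => i _ do rewrite exchange_big /=.
  rewrite exchange_big /=; apply: eq_bigr => h _.
  under eq_bigr => i _ do rewrite exchange_big /=.
  rewrite exchange_big /=; apply: eq_bigr => k _.
  rewrite -second_momentE mulr_sumr; apply: eq_bigr => i _.
  by rewrite mulr_sumr; apply: eq_bigr => j _; ring.
rewrite mulrDr !mulr_sumr -big_split; apply: eq_bigr => h _ /=.
rewrite mulr_sumr (bigD1 h) //= [X in _ = X + _](bigD1 h) //= eqxx.
rewrite (eq_bigr (fun k => 4 * N%:R * (B h k * M z h k))) => [|k /negbTE]; last first.
  by rewrite eq_sym => -> /=; ring.
rewrite /=; ring.
Qed.

Lemma sum_qform_swap B z : B^T = B ->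
  \sum_i \sum_j (qform B (U (swap z i j)) - qform B (U z)) =
  4 * N%:R * (trace_dev z B + \tr B - qform B (U z)).
Proof.
move=> sB.
under eq_bigr => i _ do under eq_bigr => j _ do rewrite qform_swapE //.
under eq_bigr => i _ do rewrite big_split /= -mulr_sumr.
rewrite big_split /= sum_qform -mulr_sumr.
have -> : \sum_i \sum_j bform B (U z) (D z i j) = - (2 * N%:R) * qform B (U z).
  rewrite qformE -bformZr -sum_swap_diff bform_sumr; apply: eq_bigr => i _.
  by rewrite bform_sumr.
ring.
Qed.

Lemma expect_antisymmetric (g : assignment -> R) i j :
  (forall z, g (swap z i j) = - g z) -> E g = 0.
Proof.
move=> gN; have := expect_swap Nq g i j.
by under eq_expect do rewrite gN; rewrite expectN; lra.
Qed.

Lemma expect_exchange B (f : R -> R) :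
  E (fun z => \sum_i \sum_j (qform B (U (swap z i j)) - qform B (U z)) *
    (f (qform B (U (swap z i j))) + f (qform B (U z)))) = 0.
Proof.
rewrite expect_sum big1 // => i _; rewrite expect_sum big1 // => j _.
by apply: (@expect_antisymmetric _ i j) => z; rewrite swapK; ring.
Qed.

Lemma expect_abs_le (f : assignment -> R) b : 0 <= b ->
  E (fun z => f z ^+ 2) <= b ^+ 2 -> E (fun z => `|f z|) <= b.
Proof.
move=> b0 fb; apply: le_trans (ler_norm _) _; apply: normr_le_sqr => //.
have := expect_cauchy_schwarz Nq (fun z => `|f z|) (fun=> 1).
rewrite (eq_expect (f := fun z => `|f z| * 1) (g := fun z => `|f z|)) => [|z _]; last first.
  by rewrite mulr1.
rewrite (eq_expect (f := fun z => `|f z| ^+ 2) (g := fun z => f z ^+ 2)) => [|z _]; last first.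
  by rewrite real_normK ?num_real.
rewrite (eq_expect (f := fun=> 1 ^+ 2) (g := fun=> 1)) => [|z _]; last by rewrite expr1n.
rewrite (expect_cst NqN) mulr1.
by move/le_trans; apply.
Qed.

Variable kap : R.
Hypothesis kap1 : 1 <= kap.
Hypothesis H_gt0 : (0 < H)%N.
Hypothesis Ne2 : N%:R * e ^+ 2 <= kap * H%:R.
Let r : R := (Num.sqrt N%:R)^-1.
Let h : R := H%:R.

Let h1 : 1 <= h. Proof. by rewrite ler1n. Qed.
Let r0 : 0 < r. Proof. by rewrite invr_gt0 sqrtr_gt0. Qed.
Let Nr2 : N%:R * r ^+ 2 = 1.
Proof. by rewrite exprVn sqr_sqrtr ?ltW // mulfV. Qed.
Let r1 : r <= 1.
Proof.
have : r ^+ 2 <= 1 ^+ 2.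
  rewrite expr1n -Nr2 ler_peMl ?sqr_ge0 // ler1n //.
by rewrite ler_pXn2r // nnegrE ?ltW.
Qed.

Let k0 : 0 <= kap. Proof. exact: le_trans kap1. Qed.
Let h0 : 0 <= h. Proof. exact: ler0n. Qed.
Let kh1 : 1 <= kap * h. Proof. by rewrite -[1]mulr1 ler_pM. Qed.
Let e2r : e ^+ 2 <= kap * h * r ^+ 2.
Proof.
have r2 : 0 < r ^+ 2 by rewrite exprn_gt0.
by rewrite -[X in X <= _]mul1r -Nr2 mulrAC ler_pM2r.
Qed.

Let er : e <= kap * h * r.
Proof.
have khr0 : 0 <= kap * h * r by rewrite mulr_ge0 ?(ltW r0) // (le_trans ler01).
rewrite -(@ler_pXn2r _ 2) ?nnegrE //; apply: (le_trans e2r).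
by rewrite exprMn ler_wpM2r ?sqr_ge0 // expr2 ler_peMl // (le_trans ler01).
Qed.

(** With [r = N^(-1/2)], the bound [N e^2 <= kap h] gives [e <= kap h r], so a third power of [e]
    gains the factor [r] that makes Taylor remainders vanish. *)
Lemma Ne3_le : N%:R * e ^+ 3 <= kap ^+ 2 * h ^+ 2 * r.
Proof.
have -> : N%:R * e ^+ 3 = (N%:R * e ^+ 2) * e by ring.
have -> : kap ^+ 2 * h ^+ 2 * r = (kap * h) * (kap * h * r) by ring.
by apply: ler_pM => //; rewrite mulr_ge0 ?sqr_ge0 // ltW.
Qed.

Lemma Ne4_le : N%:R * e ^+ 4 <= kap ^+ 2 * h ^+ 2 * r ^+ 2.
Proof.
have -> : N%:R * e ^+ 4 = (N%:R * e ^+ 2) * e ^+ 2 by ring.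
have -> : kap ^+ 2 * h ^+ 2 * r ^+ 2 = (kap * h) * (kap * h * r ^+ 2) by ring.
by apply: ler_pM => //; rewrite ?mulr_ge0 ?sqr_ge0 // ltW.
Qed.

Let r2r : r ^+ 2 <= r. Proof. by rewrite expr2 ler_piMl // ltW. Qed.
Let khn n : 1 <= (kap * h) ^+ n. Proof. by rewrite exprn_ege1. Qed.

Lemma expect_sqnorm_sqr_le : E (fun z => s_ z ^+ 2) <= 11 * kap ^+ 2 * h ^+ 2.
Proof.
apply: (le_trans expect_sqnorm_sqr); rewrite -/h.
have := Ne4_le; have := Ne2; rewrite -/h.
have -> : N%:R * (8 * e ^+ 2 * h + 2 * e ^+ 4) = 8 * (N%:R * e ^+ 2) * h + 2 * (N%:R * e ^+ 4) by ring.
move: (N%:R * e ^+ 2) (N%:R * e ^+ 4) => x y xk yk.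
have {}yk : y <= kap ^+ 2 * h ^+ 2.
  apply: (le_trans yk); rewrite ler_piMr ?mulr_ge0 ?sqr_ge0 //.
  by apply: (le_trans r2r).
have k2 : kap <= kap ^+ 2 by rewrite expr2 ler_peMl // (le_trans ler01).
have hh : 0 <= h ^+ 2 by apply: sqr_ge0.
have xk2 : x * h <= kap ^+ 2 * h ^+ 2.
  apply: (@le_trans _ _ (kap * h * h)); first by rewrite ler_wpM2r // (le_trans ler01).
  by rewrite -mulrA -expr2 ler_wpM2r.
have : h ^+ 2 <= kap ^+ 2 * h ^+ 2.
  by rewrite ler_peMl // (le_trans kap1).
lra.
Qed.

Lemma expect_fro_le : E Fr <= (2 * kap * h ^+ 2 * r) ^+ 2.
Proof.
apply: (le_trans expect_second_moment_dev_fro); rewrite -/h.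
have -> : h ^+ 2 * (N%:R * (4 * e ^+ 4)) = (4 * h ^+ 2) * (N%:R * e ^+ 4) by ring.
have -> : (2 * kap * h ^+ 2 * r) ^+ 2 = (4 * h ^+ 2) * (kap ^+ 2 * h ^+ 2 * r ^+ 2) by ring.
by rewrite ler_wpM2l ?Ne4_le // mulr_ge0 ?sqr_ge0.
Qed.

Lemma expect_trace_dev B : psd_contraction B ->
  E (fun z => `|trace_dev z B|) <= 2 * kap * h ^+ 3 * r.
Proof.
move=> cB; 
apply: expect_abs_le; first by rewrite !mulr_ge0 ?exprn_ge0 // ltW.
apply: (@le_trans _ _ (E (fun z => h ^+ 2 * Fr z))).
  by apply: le_expect => z _; apply: trace_dev_le.
rewrite expectZ.
have -> : (2 * kap * h ^+ 3 * r) ^+ 2 = h ^+ 2 * (2 * kap * h ^+ 2 * r) ^+ 2 by ring.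
by rewrite ler_wpM2l ?sqr_ge0 // expect_fro_le.
Qed.

(** Cauchy-Schwarz between [E |U|^4 <= 11 kap^2 h^2] and [E Fr <= (2 kap h^2 r)^2]; the 7 bounds the
    square root of 44. *)
Lemma expect_sqnorm_fro (g : assignment -> R) : (forall z, g z ^+ 2 <= Fr z) ->
  E (fun z => s_ z * `|g z|) <= 7 * kap ^+ 2 * h ^+ 3 * r.
Proof.
move=> gF; apply: le_trans (ler_norm _) _; apply: normr_le_sqr.
  by rewrite !mulr_ge0 ?exprn_ge0 // ltW.
apply: (le_trans (expect_cauchy_schwarz _ _ _)).
apply: (@le_trans _ _ ((11 * kap ^+ 2 * h ^+ 2) * (2 * kap * h ^+ 2 * r) ^+ 2)).
  apply: ler_pM.
  - by apply: expect_ge0 => z _; apply: sqr_ge0.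
  - by apply: expect_ge0 => z _; apply: sqr_ge0.
  - exact: expect_sqnorm_sqr_le.
  - apply: le_trans expect_fro_le; apply: le_expect => z _.
    by rewrite real_normK ?num_real.
have -> : 11 * kap ^+ 2 * h ^+ 2 * (2 * kap * h ^+ 2 * r) ^+ 2 =
  44 * (kap ^+ 2 * h ^+ 3 * r) ^+ 2 by ring.
have -> : (7 * kap ^+ 2 * h ^+ 3 * r) ^+ 2 = 49 * (kap ^+ 2 * h ^+ 3 * r) ^+ 2 by ring.
by rewrite ler_wpM2r ?sqr_ge0 // ler_nat.
Qed.

Lemma expect_qform_dev B : psd_contraction B ->
  E (fun z => `|qform_dev z (B *m U z)|) <= 7 * kap ^+ 2 * h ^+ 3 * r.
Proof.
move=> cB; apply: le_trans (@expect_sqnorm_fro (fun z => Num.sqrt (Fr z)) _).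
  apply: le_expect => z _; apply: normr_le_sqr; rewrite ?mulr_ge0 ?sqnorm_ge0 //.
  apply: (le_trans (qform_dev_le _ _)).
  rewrite exprMn real_normK ?num_real // sqr_sqrtr ?second_moment_dev_fro_ge0 //.
  rewrite ler_wpM2r ?second_moment_dev_fro_ge0 // ler_pXn2r ?nnegrE ?sqnorm_ge0 //.
  exact: contraction_sqnorm.
by move=> z; rewrite sqr_sqrtr ?second_moment_dev_fro_ge0.
Qed.

Lemma expect_sqnorm_trace_dev B : psd_contraction B ->
  E (fun z => s_ z * `|trace_dev z B|) <= 7 * kap ^+ 2 * h ^+ 4 * r.
Proof.
move=> cB; have hp : 0 < h := lt_le_trans ltr01 h1.
have -> : 7 * kap ^+ 2 * h ^+ 4 * r = h * (7 * kap ^+ 2 * h ^+ 3 * r) by ring.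
apply: le_trans (ler_wpM2l (ltW hp) (@expect_sqnorm_fro (fun z => trace_dev z B / h) _)).
  rewrite -expectZ; apply: le_expect => z _.
  rewrite normrM (gtr0_norm (x := h^-1)) ?invr_gt0 //.
  by rewrite le_eqVlt; apply/orP; left; apply/eqP; field; rewrite gt_eqF.
move=> z; rewrite exprMn exprVn ler_pdivrMr ?exprn_gt0 // mulrC.
exact: trace_dev_le.
Qed.

(** The two remainders of the expansion: the part of [(2 p + q)^2] beyond [4 p^2], and the cube that
    Taylor's formula leaves. Bounding [e sqrt s] by [e (1 + s) / 2] keeps to integer powers of
    [s = |U|^2]. *)
Lemma swap_terms_le (p q s : R) : 0 <= s -> p ^+ 2 <= s * e ^+ 2 -> 0 <= q <= e ^+ 2 ->
  `|4 * p * q + q ^+ 2| <= 2 * e ^+ 3 * (1 + s) + e ^+ 4 /\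
  `|2 * p + q| ^+ 3 <= 16 * e ^+ 3 * (s + s ^+ 2) + 4 * e ^+ 6.
Proof.
move=> s0 p2 /andP[q0 qe].
have pe : `|p| <= e * (1 + s) / 2.
  apply: normr_le_sqr; first by rewrite divr_ge0 // mulr_ge0 // addr_ge0.
  apply: (le_trans p2).
  have -> : (e * (1 + s) / 2) ^+ 2 = e ^+ 2 * (((1 + s) / 2) ^+ 2) by field.
  rewrite mulrC ler_wpM2l ?sqr_ge0 //; have := sqr_ge0 (1 - s); nra.
have p0 := normr_ge0 p.
have pq : `|p| * q <= (e * (1 + s) / 2) * e ^+ 2 by apply: ler_pM.
have qq : q ^+ 2 <= e ^+ 4.
  have -> : e ^+ 4 = (e ^+ 2) ^+ 2 by ring.
  by rewrite ler_pXn2r ?nnegrE ?sqr_ge0.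
split.
  apply: (le_trans (ler_normD _ _)); rewrite normrX !normrM (ger0_norm q0) normr_nat.
  have -> : 2 * e ^+ 3 * (1 + s) = 4 * ((e * (1 + s) / 2) * e ^+ 2) by field.
  by rewrite -mulrA; lra.
have q3 : q ^+ 3 <= e ^+ 6.
  have -> : e ^+ 6 = (e ^+ 2) ^+ 3 by ring.
  by rewrite ler_pXn2r ?nnegrE ?sqr_ge0.
have p3 : `|p| ^+ 3 <= (s * e ^+ 2) * (e * (1 + s) / 2).
  rewrite exprSr; apply: ler_pM => //; rewrite ?exprn_ge0 //.
  by rewrite real_normK ?num_real.
have tri : `|2 * p + q| <= 2 * `|p| + q.
  by apply: (le_trans (ler_normD _ _)); rewrite normrM normr_nat (ger0_norm q0).
have c3 (x y : R) : 0 <= x -> 0 <= y -> (x + y) ^+ 3 <= 4 * (x ^+ 3 + y ^+ 3).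
  move=> x0 y0; rewrite -subr_ge0.
  have -> : 4 * (x ^+ 3 + y ^+ 3) - (x + y) ^+ 3 = 3 * ((x + y) * (x - y) ^+ 2) by ring.
  by rewrite mulr_ge0 // mulr_ge0 ?sqr_ge0 ?addr_ge0.
apply: (@le_trans _ _ ((2 * `|p| + q) ^+ 3)).
  by rewrite ler_pXn2r ?nnegrE ?addr_ge0 ?mulr_ge0.
apply: (le_trans (c3 _ _ _ q0)); first by rewrite mulr_ge0.
rewrite exprMn; have -> : 16 * e ^+ 3 * (s + s ^+ 2) + 4 * e ^+ 6 =
   4 * (2 ^+ 3 * ((s * e ^+ 2) * (e * (1 + s) / 2)) + e ^+ 6) by field.
by rewrite ler_wpM2l // lerD // ler_wpM2l // exprn_ge0.
Qed.

Lemma sum_pairs_le (F : 'I_N -> 'I_N -> R) c : (forall i j, `|F i j| <= c) ->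
  `|\sum_i \sum_j F i j| <= N%:R ^+ 2 * c.
Proof.
move=> Fc; apply: (le_trans (ler_norm_sum _ _ _)).
apply: (@le_trans _ _ (\sum_(i < N) \sum_(j < N) c)).
  apply: ler_sum => i _; apply: (le_trans (ler_norm_sum _ _ _)).
  by apply: ler_sum => j _.
by rewrite !sumr_const card_ord -mulrnA -[_ *+ (N * N)]mulr_natl natrM expr2.
Qed.

Lemma e4N_le : N%:R * e ^+ 4 <= kap ^+ 2 * h ^+ 2 * r.
Proof. by apply: (le_trans Ne4_le); rewrite ler_wpM2l // mulr_ge0 ?sqr_ge0. Qed.

Lemma e6N_le : N%:R * e ^+ 6 <= kap ^+ 4 * h ^+ 4 * r.
Proof.
have -> : N%:R * e ^+ 6 = (N%:R * e ^+ 4) * e ^+ 2 by ring.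
have -> : kap ^+ 4 * h ^+ 4 * r = (kap ^+ 2 * h ^+ 2 * r) * (kap * h) ^+ 2 by ring.
apply: ler_pM => //; first by rewrite mulr_ge0 ?exprn_ge0.
- exact: sqr_ge0.
- exact: e4N_le.
have er' : e <= kap * h.
  by apply: (le_trans er); rewrite ler_piMr // mulr_ge0.
by rewrite ler_pXn2r ?nnegrE // mulr_ge0.
Qed.

Lemma expect_quad_remainder :
  (8 * N%:R)^-1 * E (fun z => N%:R ^+ 2 * (2 * e ^+ 3 * (1 + s_ z) + e ^+ 4)) <=
  kap ^+ 2 * h ^+ 3 * r.
Proof.
rewrite expectZ expectD expectZ expectD !expect_cst // expect_sqnorm -/h.
have -> : (8 * N%:R)^-1 * (N%:R ^+ 2 * (2 * e ^+ 3 * (1 + h) + e ^+ 4)) =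
   8^-1 * (2 * (N%:R * e ^+ 3) * (1 + h) + N%:R * e ^+ 4) by field.
have h3 : kap ^+ 2 * h ^+ 2 * r <= kap ^+ 2 * h ^+ 3 * r.
  by rewrite ler_wpM2r ?(ltW r0) // ler_wpM2l ?sqr_ge0 // [X in _ <= X]exprS ler_peMl ?sqr_ge0.
have A : 2 * (N%:R * e ^+ 3) * (1 + h) <= 2 * (kap ^+ 2 * h ^+ 2 * r) * (2 * h).
  apply: ler_pM; rewrite ?mulr_ge0 ?exprn_ge0 ?addr_ge0 // ?ler_wpM2l ?Ne3_le //.
  by have := h1; lra.
have B : 2 * (kap ^+ 2 * h ^+ 2 * r) * (2 * h) = 4 * (kap ^+ 2 * h ^+ 3 * r) by ring.
have : 0 <= kap ^+ 2 * h ^+ 3 * r by rewrite !mulr_ge0 ?exprn_ge0 // ltW.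
move: A e4N_le h3; rewrite B.
move: (2 * (N%:R * e ^+ 3) * (1 + h)) (N%:R * e ^+ 4) (kap ^+ 2 * h ^+ 3 * r) (kap ^+ 2 * h ^+ 2 * r).
by move=> x y z w; lra.
Qed.

Lemma expect_cubic_remainder :
  (8 * N%:R)^-1 * E (fun z => N%:R ^+ 2 * (16 * e ^+ 3 * (s_ z + s_ z ^+ 2) + 4 * e ^+ 6)) <=
  25 * kap ^+ 4 * h ^+ 4 * r.
Proof.
rewrite expectZ expectD expectZ expectD !expect_cst // expect_sqnorm -/h.
set S2 := E _.
have -> : (8 * N%:R)^-1 * (N%:R ^+ 2 * (16 * e ^+ 3 * (h + S2) + 4 * e ^+ 6)) =
   2 * ((N%:R * e ^+ 3) * (h + S2)) + 2^-1 * (N%:R * e ^+ 6) by field.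
have S2le : h + S2 <= 12 * kap ^+ 2 * h ^+ 2.
  have := expect_sqnorm_sqr_le; rewrite -/S2.
  have : h <= kap ^+ 2 * h ^+ 2.
    apply: (@le_trans _ _ (kap * h)); first by rewrite ler_peMl.
    by rewrite -exprMn expr2 ler_peMl // mulr_ge0.
  lra.
have A : (N%:R * e ^+ 3) * (h + S2) <= (kap ^+ 2 * h ^+ 2 * r) * (12 * kap ^+ 2 * h ^+ 2).
  apply: ler_pM; rewrite ?mulr_ge0 ?exprn_ge0 ?addr_ge0 ?Ne3_le //.
  by apply: expect_ge0 => z _; apply: sqr_ge0.
have B : (kap ^+ 2 * h ^+ 2 * r) * (12 * kap ^+ 2 * h ^+ 2) = 12 * (kap ^+ 4 * h ^+ 4 * r) by ring.
have := e6N_le; move: A; rewrite B.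
have : 0 <= kap ^+ 4 * h ^+ 4 * r by rewrite !mulr_ge0 ?exprn_ge0 // ltW.
lra.
Qed.

(* The exchangeable-pair identity E sum_ij (T^ij - T)(f(T^ij) + f(T)) = 0, Taylor expanded. *)
Theorem stein_qform (B : 'M[R]_H) (f f1 : R -> R) (K0 K1 K2 : R) :
  psd_contraction B ->
  (forall x, 0 <= x -> `|f x| <= K0) -> (forall x, 0 <= x -> `|f1 x| <= K1) ->
  (forall x y, 0 <= x -> 0 <= y -> `|f y - f x - f1 x * (y - x)| <= K2 * (y - x) ^+ 2) ->
  `|E (fun z => (qform B (U z) - \tr B) * f (qform B (U z)) -
        2 * qform (B *m B) (U z) * f1 (qform B (U z)))| <=
  25 * kap ^+ 4 * r * (K0 * h ^+ 3 + K1 * h ^+ 3 + K2 * h ^+ 4).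
Proof.
move=> cB fK0 fK1 fK2; have sB := cB.1.1.
have K00 : 0 <= K0 := le_trans (normr_ge0 _) (fK0 0 (lexx 0)).
have K10 : 0 <= K1 := le_trans (normr_ge0 _) (fK1 0 (lexx 0)).
have K20 : 0 <= K2.
  by have := le_trans (normr_ge0 _) (fK2 0 1 (lexx 0) ler01); rewrite subr0 expr1n mulr1.
pose T z := qform B (U z).
have T0 z : 0 <= T z by apply: cB.1.2.
pose p z i j := bform B (U z) (D z i j).
pose q z i j := qform B (D z i j).
have dE z i j : T (swap z i j) - T z = 2 * p z i j + q z i j by apply: qform_swapE.
pose rho z i j := f (T (swap z i j)) - f (T z) - f1 (T z) * (T (swap z i j) - T z).
pose S1 z := \sum_i \sum_j (4 * p z i j * q z i j + q z i j ^+ 2).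
pose S2 z := \sum_i \sum_j ((2 * p z i j + q z i j) * rho z i j).
pose G z := \sum_i \sum_j (T (swap z i j) - T z) * (f (T (swap z i j)) + f (T z)).
pose X z := (T z - \tr B) * f (T z) - 2 * qform (B *m B) (U z) * f1 (T z).
have N8 : 8 * N%:R != 0 :> R by rewrite mulf_neq0 // pnatr_eq0.
(* With [f(T') + f(T) = 2 f(T) + f1(T) (T' - T) + rho], the regression produces [tr B - T] and the
   squared increments produce [U^T B^2 U]. The factor [1 / (8 N)] makes both cancel against [X],
   leaving deviations and remainders; [G] has mean 0, so it may be added freely. *)
have XE z : X z + (8 * N%:R)^-1 * G z = f (T z) * trace_dev z B +
   2 * f1 (T z) * qform_dev z (B *m U z) + (8 * N%:R)^-1 * (f1 (T z) * S1 z + S2 z).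
  have GE : G z = 2 * f (T z) * (4 * N%:R * (trace_dev z B + \tr B - T z)) +
    f1 (T z) * (4 * (4 * N%:R * (qform_dev z (B *m U z) + qform (B *m B) (U z))) + S1 z) + S2 z.
    rewrite -sum_qform_swap // -/(T z).
    have -> : qform (B *m B) (U z) = sqnorm (B *m U z).
      by rewrite -bform1 bform_mulmxl bform_mulmxr sB mulmx1.
    rewrite -sum_bform_sqr // /S1 /S2 /G !mulr_sumr -!big_split /=.
    rewrite mulr_sumr -!big_split /=; apply: eq_bigr => i _.
    rewrite !mulr_sumr -!big_split /= mulr_sumr -!big_split /=; apply: eq_bigr => j _.
    rewrite -!/(T _) /rho -/(p z i j) !dE; ring.
  by rewrite GE /X; field.
have EG : E G = 0 by exact: expect_exchange.
have -> : E (fun z => (qform B (U z) - \tr B) * f (qform B (U z)) -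
        2 * qform (B *m B) (U z) * f1 (qform B (U z))) =
     E (fun z => X z + (8 * N%:R)^-1 * G z) by rewrite [RHS]expectD (expectZ _ _ G) EG mulr0 addr0.
apply: (le_trans (normr_expect _ _)).
pose R1 z := N%:R ^+ 2 * (2 * e ^+ 3 * (1 + s_ z) + e ^+ 4).
pose R2 z := N%:R ^+ 2 * (16 * e ^+ 3 * (s_ z + s_ z ^+ 2) + 4 * e ^+ 6).
apply: (@le_trans _ _ (E (fun z => K0 * `|trace_dev z B| +
   2 * K1 * `|qform_dev z (B *m U z)| + (K1 * ((8 * N%:R)^-1 * R1 z) + K2 * ((8 * N%:R)^-1 * R2 z))))).
  apply: le_expect => z _; rewrite XE.
  have pqb i j := swap_terms_le (sqnorm_ge0 (U z)) (bform_swap_diff z i j cB) (qform_swap_diff z i j cB).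
  have S1le : `|S1 z| <= R1 z by apply: sum_pairs_le => i j; exact: (pqb i j).1.
  have S2le : `|S2 z| <= K2 * R2 z.
    rewrite /R2 mulrCA; apply: sum_pairs_le => i j; rewrite normrM.
    apply: le_trans (ler_wpM2l K20 (pqb i j).2).
    rewrite exprS mulrCA; apply: ler_wpM2l => //.
    by rewrite real_normK ?num_real // -dE; apply: fK2; apply: T0.
  apply: (le_trans (ler_normD _ _)); apply: lerD.
    apply: (le_trans (ler_normD _ _)); apply: lerD.
      by rewrite normrM ler_wpM2r // fK0.
    by rewrite !normrM normr_nat ler_wpM2r // ler_wpM2l // fK1.
  have i8 : 0 <= (8 * N%:R)^-1 :> R by rewrite invr_ge0 mulr_ge0.
  rewrite normrM (ger0_norm i8) (mulrCA K1) (mulrCA K2) -mulrDr ler_wpM2l //.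
  apply: (le_trans (ler_normD _ _)); apply: lerD => //.
  by rewrite normrM ler_pM // fK1.
rewrite !expectD !expectZ.
have hT := expect_trace_dev cB; have hq := expect_qform_dev cB.
have hR1 : (8 * N%:R)^-1 * (N%:R ^+ 2 * E (fun z => 2 * e ^+ 3 * (1 + s_ z) + e ^+ 4)) <= kap ^+ 2 * h ^+ 3 * r.
  by rewrite -expectZ; apply: expect_quad_remainder.
have hR2 : (8 * N%:R)^-1 * (N%:R ^+ 2 * E (fun z => 16 * e ^+ 3 * (s_ z + s_ z ^+ 2) + 4 * e ^+ 6)) <= 25 * kap ^+ 4 * h ^+ 4 * r.
  by rewrite -expectZ; apply: expect_cubic_remainder.
apply: (@le_trans _ _ (K0 * (2 * kap * h ^+ 3 * r) + 2 * K1 * (7 * kap ^+ 2 * h ^+ 3 * r) +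
   (K1 * (kap ^+ 2 * h ^+ 3 * r) + K2 * (25 * kap ^+ 4 * h ^+ 4 * r)))).
  by apply: lerD; apply: lerD; rewrite ler_wpM2l // mulr_ge0.
have kle n : (n <= 4)%N -> kap ^+ n <= kap ^+ 4 by move=> ?; rewrite ler_weXn2l.
have hr0 : 0 <= h ^+ 3 * r by rewrite mulr_ge0 ?exprn_ge0 // ltW.
have A1 : K0 * (2 * kap * h ^+ 3 * r) <= 2 * (kap ^+ 4 * (K0 * (h ^+ 3 * r))).
  have -> : K0 * (2 * kap * h ^+ 3 * r) = 2 * (kap ^+ 1 * (K0 * (h ^+ 3 * r))) by ring.
  by apply: ler_wpM2l => //; apply: ler_wpM2r; [rewrite mulr_ge0 | exact: kle].
have A2 : 2 * K1 * (7 * kap ^+ 2 * h ^+ 3 * r) + K1 * (kap ^+ 2 * h ^+ 3 * r)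
   <= 15 * (kap ^+ 4 * (K1 * (h ^+ 3 * r))).
  have -> : 2 * K1 * (7 * kap ^+ 2 * h ^+ 3 * r) + K1 * (kap ^+ 2 * h ^+ 3 * r)
    = 15 * (kap ^+ 2 * (K1 * (h ^+ 3 * r))) by ring.
  by apply: ler_wpM2l => //; apply: ler_wpM2r; [rewrite mulr_ge0 | exact: kle].
have A3 : 0 <= kap ^+ 4 * (K0 * (h ^+ 3 * r)) by rewrite !mulr_ge0 ?exprn_ge0 // ltW.
have A4 : 0 <= kap ^+ 4 * (K1 * (h ^+ 3 * r)) by rewrite !mulr_ge0 ?exprn_ge0 // ltW.
have -> : 25 * kap ^+ 4 * r * (K0 * h ^+ 3 + K1 * h ^+ 3 + K2 * h ^+ 4) =
  25 * (kap ^+ 4 * (K0 * (h ^+ 3 * r))) + 25 * (kap ^+ 4 * (K1 * (h ^+ 3 * r))) + K2 * (25 * kap ^+ 4 * h ^+ 4 * r) by ring.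
lra.
Qed.

(** The exchangeable-pair identity for [f = id], an unbounded function outside the scope of
    [stein_qform]. It is applied to [C = B^2], to show that [U^T B^2 U] stays close to its trace. *)
Theorem variance_qform (C : 'M[R]_H) : psd_contraction C ->
  E (fun z => (qform C (U z) - \tr C) ^+ 2) <= 4 * h + 40 * kap ^+ 2 * h ^+ 4 * r.
Proof.
move=> cC; have sC := cC.1.1.
pose T z := qform C (U z).
pose G z := \sum_i \sum_j (T (swap z i j) - T z) * (T (swap z i j) + T z).
have EG : E G = 0 by exact: (expect_exchange C id).
pose S z := \sum_i \sum_j (T (swap z i j) - T z) ^+ 2.
have ET : E T = \tr C.
  have Z : E (fun z => \sum_i \sum_j (T (swap z i j) - T z)) = 0.
    rewrite expect_sum big1 // => i _; rewrite expect_sum big1 // => j _.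
    by rewrite expectB (expect_swap _ T) subrr.
  move: Z; under eq_expect do rewrite sum_qform_swap //.
  rewrite expectZ => /eqP; rewrite mulf_eq0 mulf_eq0 !pnatr_eq0 /= -[(N == 0)%N]negbK -lt0n N_gt0 /=.
  rewrite expectB expectD expect_cst // /trace_dev expect_sum big1 => [|g _]; last first.
    rewrite expect_sum big1 // => k _; by rewrite expectZ expect_second_moment_dev mulr0.
  by rewrite add0r subr_eq0 => /eqP.
have GE z : G z = 8 * N%:R * (T z * (trace_dev z C + \tr C - T z)) + S z.
  have -> : 8 * N%:R * (T z * (trace_dev z C + \tr C - T z)) =
    (2 * T z) * (4 * N%:R * (trace_dev z C + \tr C - T z)) by ring.
  rewrite -sum_qform_swap // -/(T z) /S mulr_sumr -big_split; apply: eq_bigr => i _ /=.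
  rewrite mulr_sumr -big_split; apply: eq_bigr => j _ /=; rewrite /G -!/(T _); ring.
have i8 : 0 <= (8 * N%:R)^-1 :> R by rewrite invr_ge0 mulr_ge0.
have VE : E (fun z => (T z - \tr C) ^+ 2) =
    E (fun z => T z * trace_dev z C + (8 * N%:R)^-1 * S z).
  have TGE z : T z * trace_dev z C + (8 * N%:R)^-1 * S z =
      (8 * N%:R)^-1 * G z + (T z - \tr C) ^+ 2 + \tr C * (T z - \tr C).
    by rewrite GE; field.
  under [RHS]eq_expect do rewrite TGE.
  rewrite !expectD !expectZ EG expectB ET expect_cst // subrr; ring.
rewrite VE; apply: (@le_trans _ _ (E (fun z => s_ z * `|trace_dev z C| +
   (4 * (`|qform_dev z (C *m U z)| + s_ z) + (N%:R * e ^+ 4) / 4)))).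
  apply: le_expect => z _; apply: lerD.
    apply: (le_trans (ler_norm _)); rewrite normrM ler_wpM2r //.
    by rewrite ger0_norm ?cC.2 // cC.1.2.
  have : S z <= 8 * (4 * N%:R * (qform_dev z (C *m U z) + sqnorm (C *m U z))) + N%:R ^+ 2 * (2 * e ^+ 4).
    rewrite -sum_bform_sqr //.
    have -> : N%:R ^+ 2 * (2 * e ^+ 4) = \sum_(i < N) \sum_(j < N) (2 * e ^+ 4).
      by rewrite !sumr_const card_ord -mulrnA -[_ *+ (N * N)]mulr_natl natrM expr2.
    rewrite mulr_sumr -big_split; apply: ler_sum => i _ /=.
    rewrite mulr_sumr -big_split; apply: ler_sum => j _ /=.
    rewrite /T qform_swapE //; have := qform_swap_diff z i j cC.
    move: (bform _ _ _) (qform _ _) => p q /andP[q0 qe].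
    have qq : q ^+ 2 <= e ^+ 4.
      have -> : e ^+ 4 = (e ^+ 2) ^+ 2 by ring.
      by rewrite ler_pXn2r ?nnegrE ?sqr_ge0.
    have := sqr_ge0 (2 * p - q); nra.
  move/(ler_wpM2l i8)/le_trans; apply.
  have -> : (8 * N%:R)^-1 * (8 * (4 * N%:R * (qform_dev z (C *m U z) + sqnorm (C *m U z))) +
     N%:R ^+ 2 * (2 * e ^+ 4)) = 4 * (qform_dev z (C *m U z) + sqnorm (C *m U z)) + N%:R * e ^+ 4 / 4.
    by field.
  rewrite lerD2r ler_wpM2l // lerD ?ler_norm //; exact: contraction_sqnorm.
rewrite expectD expectD expect_cst // (expectZ _ 4) expectD expect_sqnorm -/h.
have := expect_sqnorm_trace_dev cC; have := expect_qform_dev cC; have := e4N_le.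
have h34 : kap ^+ 2 * h ^+ 3 * r <= kap ^+ 2 * h ^+ 4 * r.
  by rewrite ler_wpM2r ?(ltW r0) // ler_wpM2l ?sqr_ge0 // ler_weXn2l.
have h24 : kap ^+ 2 * h ^+ 2 * r <= kap ^+ 2 * h ^+ 4 * r.
  by rewrite ler_wpM2r ?(ltW r0) // ler_wpM2l ?sqr_ge0 // ler_weXn2l.
have : 0 <= kap ^+ 2 * h ^+ 4 * r by rewrite !mulr_ge0 ?exprn_ge0 // ltW.
lra.
Qed.

End ExchangeablePair.

(** * The normal distribution function *)

Section PointwiseDerivatives.
Variable R : realType.
Implicit Types (f g : R -> R) (x a b c : R).

Lemma is_derive_addf f g x a b : is_derive x 1 f a -> is_derive x 1 g b ->
  is_derive x 1 (fun t => f t + g t) (a + b).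
Proof. exact: is_deriveD. Qed.

Lemma is_derive_mulf f g x a b : is_derive x 1 f a -> is_derive x 1 g b ->
  is_derive x 1 (fun t => f t * g t) (a * g x + f x * b).
Proof.
move=> fa gb; have := is_deriveM fa gb; congr (is_derive _ _ _ _).
by rewrite /GRing.scale /= addrC [a * _]mulrC.
Qed.

Lemma is_derive_cstf c x : is_derive x 1 (fun=> c) 0.
Proof. exact: is_derive_cst. Qed.

Lemma is_derive_idf x : is_derive x 1 (fun t : R => t) 1.
Proof. exact: is_derive_id. Qed.

Lemma is_derive_scalef c f x a : is_derive x 1 f a ->
  is_derive x 1 (fun t => c * f t) (c * a).
Proof.
move=> fa; have := is_derive_mulf (is_derive_cstf c x) fa.
by rewrite mul0r add0r.
Qed.

Lemma is_derive_oppf f x a : is_derive x 1 f a -> is_derive x 1 (fun t => - f t) (- a).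
Proof. exact: is_deriveN. Qed.

Lemma is_derive_invf f x a : f x != 0 -> is_derive x 1 f a ->
  is_derive x 1 (fun t => (f t)^-1) (- (a / f x ^+ 2)).
Proof.
move=> f0 fa; have := is_deriveV f0 fa; congr (is_derive _ _ _ _).
by rewrite /GRing.scale /= mulNr mulrC.
Qed.

Lemma is_derive_compf f g x a b : is_derive (g x) 1 f a -> is_derive x 1 g b ->
  is_derive x 1 (fun t => f (g t)) (a * b).
Proof. exact: is_derive1_comp. Qed.

Lemma is_derive_sqrf f x a : is_derive x 1 f a ->
  is_derive x 1 (fun t => f t ^+ 2) (2 * f x * a).
Proof.
move=> fa; have := is_derive_mulf fa fa.
rewrite (_ : (fun t => f t * f t) = (fun t => f t ^+ 2)); last first.
  by apply/funext => t; rewrite expr2.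
by congr (is_derive _ _ _ _); ring.
Qed.

Lemma is_derive_cvgx f x a : is_derive x 1 f a -> {for x, continuous f}.
Proof.
move=> [fa _]; exact/differentiable_continuous/derivable1_diffP.
Qed.

Lemma derive_bound f (df : R -> R) (u v K : R) : u <= v ->
  (forall x, u <= x <= v -> is_derive x 1 f (df x)) ->
  (forall x, u <= x <= v -> `|df x| <= K) -> `|f v - f u| <= K * (v - u).
Proof.
move=> uv fd dK.
have [x|x xuv|c cuv ->] := @MVT_segment R f df u v uv.
- by rewrite in_itv => /andP[ux xv]; apply: fd; rewrite !ltW.
- by move: x xuv; apply/subspace_continuousP => x; rewrite /= in_itv => /fd/is_derive_cvgx; apply: cvg_within_filter.
by rewrite normrM (ger0_norm (x := v - u)) ?subr_ge0 // ler_wpM2r ?subr_ge0 // dK.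
Qed.

Lemma derive_boundT f (df : R -> R) (K u v : R) :
  (forall x, is_derive x 1 f (df x)) -> (forall x, `|df x| <= K) ->
  `|f v - f u| <= K * `|v - u|.
Proof.
move=> fd dK; have [uv|/ltW vu] := leP u v.
  by rewrite (ger0_norm (x := v - u)) ?subr_ge0 //; apply: (derive_bound uv) => x _.
by rewrite distrC [`|v - u|]distrC (ger0_norm (x := u - v)) ?subr_ge0 //; apply: (derive_bound vu) => x _.
Qed.

Lemma taylor1_bound f (f1 f2 : R -> R) (K : R) :
  (forall x, is_derive x 1 f (f1 x)) -> (forall x, is_derive x 1 f1 (f2 x)) ->
  (forall x, `|f2 x| <= K) ->
  forall x y, `|f y - f x - f1 x * (y - x)| <= K * (y - x) ^+ 2.
Proof.
move=> d1 d2 bK x y.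
have K0 : 0 <= K := le_trans (normr_ge0 _) (bK 0).
pose g t := f t - f1 x * t.
have gd (t : R) : is_derive t 1 g (f1 t - f1 x).
  apply: is_derive_addf => //; apply: is_derive_oppf.
  have := is_derive_scalef (f1 x) (is_derive_idf t); by rewrite mulr1.
have -> : f y - f x - f1 x * (y - x) = g y - g x by rewrite /g; ring.
have main u v : u <= v -> (x = u \/ x = v) -> `|g v - g u| <= K * (v - u) ^+ 2.
  move=> uv xuv; rewrite expr2 mulrA; apply: (derive_bound uv (fun t _ => gd t)) => t /andP[ut tv].
  apply: (le_trans (derive_boundT x t d2 bK)); rewrite ler_wpM2l //.
  by case: xuv => ->; rewrite ler_norml; apply/andP; split; lra.
have [xy|/ltW yx] := leP x y; first by apply: main => //; left.
have := main _ _ yx (or_intror erefl); rewrite distrC.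
by have -> : (x - y) ^+ 2 = (y - x) ^+ 2 by ring.
Qed.

End PointwiseDerivatives.

Section NormalCdf.
Variable R : realType.
Local Notation phi := (@normal_pdf R 0 1).
Local Notation Phi := (@std_normal_cdf R).
Local Notation mu := (@lebesgue_measure R).

Lemma normal_pdf01E (x : R) : phi x = normal_peak 1 * expR (- x ^+ 2 / 2).
Proof. by rewrite normal_pdfE ?oner_eq0 // /normal_fun subr0 expr1n. Qed.

Lemma normal_peak_le1 : (normal_peak 1 : R) <= 1.
Proof.
have p1 : 1 <= pi *+ 2 :> R by have := @pi_ge2 R; rewrite mulr2n; lra.
rewrite /normal_peak expr1n mul1r invf_le1 ?sqrtr_gt0 ?(lt_le_trans _ p1) //.
by rewrite -[X in X <= _]sqrtr1 ler_wsqrtr.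
Qed.

Lemma normal_pdf01_ge0 (x : R) : 0 <= phi x. Proof. exact: normal_pdf_ge0. Qed.

(** The common source of the bounds on the density times a polynomial: the peak is at most 1, and
    [expR] dominates the polynomial. *)
Lemma normal_pdf01_moment_le (x c : R) : c <= expR (x ^+ 2 / 2) -> c * phi x <= 1.
Proof.
move=> ce; have [c0|c0] := leP c 0.
  by apply: le_trans ler01; rewrite mulr_le0_ge0 ?normal_pdf01_ge0.
rewrite normal_pdf01E mulrCA -[X in _ <= X]mulr1 ler_pM //.
- by rewrite normal_peak_ge0.
- by rewrite mulr_ge0 ?expR_ge0 // ltW.
- exact: normal_peak_le1.
- by rewrite mulNr expRN ler_pdivrMr ?expR_gt0 // mul1r.
Qed.

Lemma normal_pdf01_le1 (x : R) : phi x <= 1.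
Proof.
rewrite -[X in X <= _]mul1r; apply: normal_pdf01_moment_le.
by rewrite -[X in X <= _]expR0 ler_expR divr_ge0 ?sqr_ge0.
Qed.

Lemma normal_pdf01_abs_le1 (x : R) : `|x * phi x| <= 1.
Proof.
rewrite normrM (ger0_norm (normal_pdf01_ge0 x)); apply: normal_pdf01_moment_le.
apply: (le_trans _ (expR_ge1Dx _)); rewrite -(real_normK (num_real x)).
have := sqr_ge0 (`|x| - 1); nra.
Qed.

Lemma normal_pdf01_sqr_le2 (x : R) : `|(1 - x ^+ 2) * phi x| <= 2.
Proof.
have p0 := normal_pdf01_ge0 x; have p1 := normal_pdf01_le1 x.
have : x ^+ 2 / 2 * phi x <= 1.
  apply: normal_pdf01_moment_le.
  by apply: (le_trans _ (expR_ge1Dx _)); rewrite lerDr.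
have := mulr_ge0 (sqr_ge0 x) p0.
rewrite mulrBl mul1r ler_norml => a b; apply/andP; split; lra.
Qed.

Lemma is_derive_normal_pdf01 (x : R) : is_derive x 1 phi (- x * phi x).
Proof.
have -> : phi = (fun t => normal_peak 1 * expR (- t ^+ 2 / 2)).
  by apply/funext => t; rewrite normal_pdf01E.
have d2 : is_derive x 1 (fun t : R => - t ^+ 2 / 2) (- x).
  rewrite (_ : (fun t : R => _) = fun t => - 2^-1 * t ^+ 2); last by apply/funext => t; field.
  have := is_derive_scalef (- 2^-1) (is_derive_sqrf (is_derive_idf x)).
  by congr (is_derive _ _ _ _); field.
have := is_derive_scalef (normal_peak 1) (is_derive_compf (is_derive_expR _) d2).
by congr (is_derive _ _ _ _); ring.
Qed.

Lemma is_derive_std_normal_cdf (x : R) : is_derive x 1 Phi (phi x).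
Proof.
have xu : x < x + 1 by rewrite ltrDl.
have intp : mu.-integrable `]-oo, (x + 1)] (EFin \o phi).
  by apply: integrableS (integrable_normal_pdf 0 1).
have cp : {for x, continuous phi} by apply: continuous_normal_pdf; rewrite oner_eq0.
have [d e] := continuous_FTC1 xu intp (ltNyr _) cp.
by apply: DeriveDef; [exact: d|rewrite -derive1E; exact: e].
Qed.

Lemma std_normal_cdfE (x : R) : Phi x = fine (normal_prob 0 1 `]-oo, x]).
Proof. by []. Qed.

Lemma std_normal_cdf_ge0 x : 0 <= Phi x.
Proof. by rewrite std_normal_cdfE fine_ge0. Qed.

Lemma std_normal_cdf_le1 x : Phi x <= 1.
Proof.
rewrite std_normal_cdfE -lee_fin fineK; first exact: probability_le1.
exact: fin_num_measure.
Qed.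

Lemma std_normal_cdf_le x y : x <= y -> Phi x <= Phi y.
Proof.
move=> xy; rewrite !std_normal_cdfE fine_le ?fin_num_measure //.
by apply: le_measure; rewrite ?inE //; apply: subset_itvl; rewrite bnd_simp.
Qed.

Lemma std_normal_cdf_continuous : continuous (Phi : R -> R).
Proof. by move=> x; apply: is_derive_cvgx (is_derive_std_normal_cdf x). Qed.

Let idTR : measurableTypeR R -> R := idfun.
#[local] HB.instance Definition _ :=
  @isMeasurableFun.Build _ _ _ _ idTR (@measurable_id _ _ setT).

Let cdf_idE (x : R) :
  cdf (idTR : {RV (normal_prob 0 1 : probability (measurableTypeR R) R) >-> R}) x = (Phi x)%:E.
Proof. by rewrite std_normal_cdfE fineK // fin_num_measure. Qed.

Lemma std_normal_cdf_cvgy : Phi x @[x --> +oo%R] --> (1 : R).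
Proof.
have := @cvg_cdfy1 _ _ _ (normal_prob 0 1)
  (idTR : {RV (normal_prob 0 1 : probability (measurableTypeR R) R) >-> R}).
rewrite (_ : cdf _ = EFin \o Phi); first exact: fine_cvg.
by apply/funext => x; rewrite cdf_idE.
Qed.

Lemma std_normal_cdf_cvgNy : Phi x @[x --> -oo%R] --> (0 : R).
Proof.
have := @cvg_cdfNy0 _ _ _ (normal_prob 0 1)
  (idTR : {RV (normal_prob 0 1 : probability (measurableTypeR R) R) >-> R}).
rewrite (_ : cdf _ = EFin \o Phi); first exact: fine_cvg.
by apply/funext => x; rewrite cdf_idE.
Qed.

Lemma std_normal_cdf_near1 (eps : R) : 0 < eps -> exists2 t, 0 < t & 1 - eps < Phi t.
Proof.
move=> e0; have /cvgrPdist_lt/(_ _ e0)[M [_ MP]] := std_normal_cdf_cvgy.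
exists (`|M| + 1); first by rewrite ltr_pwDr.
have /MP /= : M < `|M| + 1 by rewrite (le_lt_trans (ler_norm _)) // ltrDl.
by rewrite ltr_norml => /andP[]; lra.
Qed.

Lemma std_normal_cdf_near0 (eps : R) : 0 < eps -> exists t, Phi t < eps.
Proof.
move=> e0; have /cvgrPdist_lt/(_ _ e0)[M [_ MP]] := std_normal_cdf_cvgNy.
exists (M - 1); have /MP /= : M - 1 < M by rewrite gtrBl.
by rewrite sub0r ltr_norml => /andP[]; lra.
Qed.

(** The test function for Stein's identity: times [- rho], it is the derivative in [s] of
    [Phi ((x - rho s) / sig)]. The next two functions are its first and second derivatives in
    [s]. *)
Definition std_normal_f (sig rho x s : R) : R := phi ((x - rho * s) / sig) / sig.
Definition std_normal_f1 (sig rho x s : R) : R :=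
  rho / sig ^+ 2 * ((x - rho * s) / sig * phi ((x - rho * s) / sig)).
Definition std_normal_f2 (sig rho x s : R) : R :=
  - (rho ^+ 2 / sig ^+ 3) * ((1 - ((x - rho * s) / sig) ^+ 2) * phi ((x - rho * s) / sig)).

Section InterpolationDerivatives.
Variables (sig rho x : R).
Hypothesis sig0 : 0 < sig.
Let sn0 : sig != 0. Proof. by rewrite gt_eqF. Qed.

Let affine_derive (s : R) : is_derive s 1 (fun t => (x - rho * t) / sig) (- rho / sig).
Proof.
rewrite (_ : (fun t : R => _) = fun t => x / sig + - (rho / sig) * t); last first.
  by apply/funext => t; field.
have := is_derive_addf (is_derive_cstf (x / sig) s) (is_derive_scalef (- (rho / sig)) (is_derive_idf s)).
by congr (is_derive _ _ _ _); ring.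
Qed.

Lemma is_derive_std_normal_f (s : R) :
  is_derive s 1 (std_normal_f sig rho x) (std_normal_f1 sig rho x s).
Proof.
have := is_derive_scalef sig^-1 (is_derive_compf (is_derive_normal_pdf01 _) (affine_derive s)).
rewrite (_ : (fun t => sig^-1 * _) = std_normal_f sig rho x); last first.
  by apply/funext => t; rewrite mulrC.
by congr (is_derive _ _ _ _); rewrite /std_normal_f1; field.
Qed.

Lemma is_derive_std_normal_f1 (s : R) :
  is_derive s 1 (std_normal_f1 sig rho x) (std_normal_f2 sig rho x s).
Proof.
have P (y : R) : is_derive y 1 (fun t => t * phi t) (phi y + y * (- y * phi y)).
  have := is_derive_mulf (is_derive_idf y) (is_derive_normal_pdf01 y).
  by rewrite mul1r.
have := is_derive_scalef (rho / sig ^+ 2) (is_derive_compf (P _) (affine_derive s)).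
congr (is_derive _ _ _ _); rewrite /std_normal_f2; field => //.
Qed.

Variable sig1 : R.
Hypothesis sig1_gt0 : 0 < sig1.
Hypothesis sig1_le : sig1 <= sig.
Hypothesis rho01 : 0 <= rho <= 1.

Let inv_le n : (sig ^+ n)^-1 <= (sig1 ^+ n)^-1.
Proof.
rewrite lef_pV2 ?posrE ?exprn_gt0 //.
by apply: lerXn2r => //; rewrite nnegrE ltW.
Qed.

Lemma std_normal_f_bound s : `|std_normal_f sig rho x s| <= sig1^-1.
Proof.
rewrite /std_normal_f normrM (ger0_norm (normal_pdf01_ge0 _)) ger0_norm ?invr_ge0 ?(ltW sig0) //.
rewrite -[X in _ <= X]mul1r; apply: ler_pM.
- exact: normal_pdf01_ge0.
- by rewrite invr_ge0 ltW.
- exact: normal_pdf01_le1.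
- exact: (inv_le 1).
Qed.

Lemma std_normal_f1_bound s : `|std_normal_f1 sig rho x s| <= (sig1 ^+ 2)^-1.
Proof.
have /andP[r0 r1] := rho01.
rewrite /std_normal_f1 normrM -[X in _ <= X]mulr1; apply: ler_pM => //; last exact: normal_pdf01_abs_le1.
rewrite normrM !ger0_norm ?invr_ge0 ?sqr_ge0 // -[X in _ <= X]mul1r.
by apply: ler_pM => //; rewrite invr_ge0 sqr_ge0.
Qed.

Lemma std_normal_f2_bound s : `|std_normal_f2 sig rho x s| <= 2 * (sig1 ^+ 3)^-1.
Proof.
have /andP[r0 r1] := rho01.
rewrite /std_normal_f2 normrM normrN [2 * _]mulrC; apply: ler_pM => //; last exact: normal_pdf01_sqr_le2.
have s3 : 0 <= (sig ^+ 3)^-1 by rewrite invr_ge0 exprn_ge0 // ltW.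
rewrite normrM !ger0_norm ?sqr_ge0 // -[X in _ <= X]mul1r.
by apply: ler_pM => //; rewrite ?sqr_ge0 // expr_le1.
Qed.

Lemma std_normal_f_taylor s t :
  `|std_normal_f sig rho x t - std_normal_f sig rho x s - std_normal_f1 sig rho x s * (t - s)| <=
  2 * (sig1 ^+ 3)^-1 * (t - s) ^+ 2.
Proof.
exact: taylor1_bound is_derive_std_normal_f is_derive_std_normal_f1 std_normal_f2_bound _ _.
Qed.

End InterpolationDerivatives.

(* The Ornstein-Uhlenbeck interpolation between [s] and a Gaussian, smoothed by variance [tau]. *)
Definition ou_sig (tau rho : R) : R := Num.sqrt (1 + tau - rho ^+ 2).

Lemma ou_sig_gt0 tau rho : 0 < tau -> 0 <= rho <= 1 -> Num.sqrt tau <= ou_sig tau rho /\ 0 < ou_sig tau rho.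
Proof.
move=> t0 /andP[r0 r1]; have r2 : rho ^+ 2 <= 1 by rewrite expr_le1.
have L : Num.sqrt tau <= ou_sig tau rho by rewrite ler_wsqrtr //; lra.
by split=> //; apply: lt_le_trans L; rewrite sqrtr_gt0.
Qed.

(** Because [ou_sig] has derivative [- rho / ou_sig], the derivative along the path is exactly
    Stein's expression [f1 - s f]. The extra variance [tau] keeps [ou_sig] away from 0 at
    [rho = 1]. *)
Lemma is_derive_ou (tau x s rho : R) : 0 < tau -> 0 <= rho <= 1 ->
  is_derive rho 1 (fun p => Phi ((x - p * s) / ou_sig tau p))
    (std_normal_f1 (ou_sig tau rho) rho x s - s * std_normal_f (ou_sig tau rho) rho x s).
Proof.
move=> t0 r01; have [_ sp] := ou_sig_gt0 t0 r01; have sn0 : ou_sig tau rho != 0 by rewrite gt_eqF.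
have /andP[r0 r1] := r01; have r2 : rho ^+ 2 <= 1 by rewrite expr_le1.
have v0 : 0 < 1 + tau - rho ^+ 2 by lra.
have dv : is_derive rho 1 (fun p => 1 + tau - p ^+ 2) (- (2 * rho)).
  have := is_derive_addf (is_derive_cstf (1 + tau) rho) (is_derive_oppf (is_derive_sqrf (is_derive_idf rho))).
  by congr (is_derive _ _ _ _); ring.
have ds : is_derive rho 1 (ou_sig tau) (- rho / ou_sig tau rho).
  have := is_derive_compf (f := Num.sqrt) (g := fun p => 1 + tau - p ^+ 2) (is_derive1_sqrt v0) dv.
  by congr (is_derive _ _ _ _); rewrite -/(ou_sig tau rho); field.
have dn : is_derive rho 1 (fun p => x - p * s) (- s).
  rewrite (_ : (fun p : R => _) = fun p => x + - s * p); last by apply/funext => p; ring.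
  have := is_derive_addf (is_derive_cstf x rho) (is_derive_scalef (- s) (is_derive_idf rho)).
  by congr (is_derive _ _ _ _); ring.
have := is_derive_compf (f := Phi) (g := fun p => (x - p * s) / ou_sig tau p)
  (is_derive_std_normal_cdf _) (is_derive_mulf dn (is_derive_invf sn0 ds)).
congr (is_derive _ _ _ _); rewrite /std_normal_f1 /std_normal_f.
by move: (phi _) => p; field.
Qed.

End NormalCdf.

(** * Normal and Laplace limits of quadratic forms *)

Section StandardizedArrays.
Variable R : realType.
Local Notation Phi := (@std_normal_cdf R).

(** [e] bounds the norm of an increment under a swap, and [kap] holds it to the scale
    [sqrt (H / N)]. Later bounds involve the array only through [kap], [H] and [N]. *)
Definition standardized_array (N Q H : nat) (Nq : 'I_Q -> nat)
    (a : 'I_N -> 'I_Q -> 'cV[R]_H) (e kap : R) : Prop :=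
  [/\ [/\ (\sum_q Nq q)%N = N, (0 < N)%N & (0 < H)%N],
      forall q, \sum_i a i q = 0,
      0 <= e /\ forall i q, 16 * sqnorm (a i q) <= e ^+ 2,
      forall h k, expect Nq (fun z => assignment_sum a z h 0 * assignment_sum a z k 0) = (h == k)%:R &
      1 <= kap /\ N%:R * e ^+ 2 <= kap * H%:R].

Lemma is_derive_expect (N Q : nat) (Nq : 'I_Q -> nat)
    (f df : {ffun 'I_N -> 'I_Q} -> R -> R) (x : R) :
  (forall z, is_derive x 1 (f z) (df z x)) ->
  is_derive x 1 (fun t => expect Nq (fun z => f z t)) (expect Nq (fun z => df z x)).
Proof.
move=> fd; rewrite /expect.
have S (r : seq {ffun 'I_N -> 'I_Q}) (P : pred {ffun 'I_N -> 'I_Q}) :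
    is_derive x 1 (fun t => \sum_(z <- r | P z) f z t) (\sum_(z <- r | P z) df z x).
  elim: r => [|z r IH].
    rewrite big_nil (_ : (fun t => _) = fun=> 0); first exact: is_derive_cstf.
    by apply/funext => t; rewrite big_nil.
  rewrite big_cons (_ : (fun t => _) = fun t =>
     if P z then f z t + \sum_(z <- r | P z) f z t else \sum_(z <- r | P z) f z t); last first.
    by apply/funext => t; rewrite big_cons.
  by case: ifP => _ //; apply: is_derive_addf.
have := is_derive_scalef (#|assignments N Nq|%:R^-1) (S (index_enum _) (fun z => z \in assignments N Nq)).
rewrite (_ : (fun t => _ * _) = fun t => (\sum_(z in assignments N Nq) f z t) / #|assignments N Nq|%:R); last first.
  by apply/funext => t; rewrite mulrC.
by rewrite mulrC.
Qed.

Lemma expect_abs_sqrt (N Q : nat) (Nq : 'I_Q -> nat) (f : {ffun 'I_N -> 'I_Q} -> R) v :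
  (\sum_q Nq q)%N = N -> 0 <= v ->
  expect Nq (fun z => f z ^+ 2) <= v -> expect Nq (fun z => `|f z|) <= Num.sqrt v.
Proof.
by move=> NqN v0 fv; apply: (expect_abs_le NqN); rewrite ?sqrtr_ge0 // sqr_sqrtr.
Qed.

Section StandardizedQform.
Variables (N Q H : nat) (Nq : 'I_Q -> nat).
Variables (a : 'I_N -> 'I_Q -> 'cV[R]_H) (e kap : R).
Hypothesis arr : standardized_array Nq a e kap.
Variables (B : 'M[R]_H) (delta eta : R).
Hypothesis cB : psd_contraction B.
Hypothesis delta0 : 0 < delta <= 1.
Hypothesis trB : delta * H%:R <= \tr (B *m B).
Hypothesis etaH : H%:R ^-1 <= eta.
Hypothesis etaN : H%:R ^+ 4 * (Num.sqrt N%:R)^-1 <= eta.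

Local Notation E := (@expect R N Q Nq).
Local Notation U := (assignment_sum a).
Let s : R := Num.sqrt (2 * \tr (B *m B)).
Definition standardized_qform z : R := (qform B (U z) - \tr B) / s.
Local Notation S := standardized_qform.

Let h : R := H%:R.
Let h1 : 1 <= h. Proof. by have [[_ _ H0] _ _ _ _] := arr; rewrite ler1n. Qed.
Let tr_gt0 : 0 < \tr (B *m B).
Proof.
have /andP[d0 _] := delta0; apply: lt_le_trans trB; rewrite mulr_gt0 //.
exact: lt_le_trans ltr01 h1.
Qed.
Let s0 : 0 < s. Proof. by rewrite sqrtr_gt0 mulr_gt0. Qed.
Let s2 : s ^+ 2 = 2 * \tr (B *m B). Proof. by rewrite sqr_sqrtr // mulr_ge0 // ltW. Qed.
Let sd : delta <= s.
Proof.
have /andP[d0 d1] := delta0.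
rewrite -(@ler_pXn2r _ 2) ?nnegrE ?(ltW s0) ?(ltW d0) // s2.
have : delta * 1 <= delta * h by rewrite ler_wpM2l // ltW.
have : delta ^+ 2 <= delta by rewrite expr2 ler_piMr // ltW.
by have := trB; rewrite -/h; lra.
Qed.
Let eta0 : 0 <= eta.
Proof. by apply: le_trans etaH; rewrite invr_ge0. Qed.

(** Besides the remainder of [stein_qform] there is the error of replacing [2 U^T B^2 U / s^2] by 1.
    By [variance_qform] the form misses its trace by [O(h sqrt eta)] in mean, against a trace of
    order [h]; this is where [sqrt eta] comes from. *)
Lemma stein_standardized (sig sig1 rho x : R) :
  0 < sig1 <= 1 -> sig1 <= sig -> 0 <= rho <= 1 ->
  `|E (fun z => std_normal_f1 sig rho x (S z) - S z * std_normal_f sig rho x (S z))| <=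
  100 * kap ^+ 4 * ((sig1 * delta) ^+ 3)^-1 * (eta + Num.sqrt eta).
Proof.
move=> /andP[sg0 sg1] sgl r01.
have [[NqN N0 H0] ac [e0 ea] iso [k1 Ne]] := arr.
have /andP[d0 d1] := delta0.
have sgp : 0 < sig := lt_le_trans sg0 sgl.
pose f t := std_normal_f sig rho x ((t - \tr B) / s).
pose f1 t := std_normal_f1 sig rho x ((t - \tr B) / s) / s.
have fb t : `|f t| <= sig1^-1 by apply: std_normal_f_bound.
have f1b t : `|f1 t| <= (sig1 ^+ 2)^-1 / s.
  rewrite normrM (ger0_norm (x := s^-1)) ?invr_ge0 ?(ltW s0) //.
  by rewrite ler_wpM2r ?invr_ge0 ?(ltW s0) // std_normal_f1_bound.
have f2b t u : `|f u - f t - f1 t * (u - t)| <= (2 * (sig1 ^+ 3)^-1 / s ^+ 2) * (u - t) ^+ 2.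
  have := @std_normal_f_taylor R sig rho x sgp sig1 sg0 sgl r01 ((t - \tr B) / s) ((u - \tr B) / s).
  have -> : (u - \tr B) / s - (t - \tr B) / s = (u - t) / s by field; rewrite gt_eqF.
  have -> : 2 * (sig1 ^+ 3)^-1 * ((u - t) / s) ^+ 2 =
    2 * (sig1 ^+ 3)^-1 / s ^+ 2 * (u - t) ^+ 2 by field; rewrite !gt_eqF.
  by rewrite /f /f1 mulrA mulrAC.
have st := stein_qform NqN N0 ac e0 ea iso k1 H0 Ne cB (fun t _ => fb t) (fun t _ => f1b t) (fun t u _ _ => f2b t u).
have cBB := contraction_mul cB.
have var := variance_qform NqN N0 ac e0 ea iso k1 H0 Ne cBB.
have := etaN; move: st var; rewrite -/h; set r := (Num.sqrt N%:R)^-1 => st var etr.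
have r0 : 0 <= r by rewrite invr_ge0.
have v0 : 0 <= 4 * h + 40 * kap ^+ 2 * h ^+ 4 * r.
  by rewrite addr_ge0 ?mulr_ge0 ?exprn_ge0 // (le_trans ler01).
have {}var := expect_abs_sqrt NqN v0 var.
pose T2 z := qform (B *m B) (U z).
have -> : E (fun z => std_normal_f1 sig rho x (S z) - S z * std_normal_f sig rho x (S z)) =
  - s^-1 * E (fun z => (qform B (U z) - \tr B) * f (qform B (U z)) -
        2 * qform (B *m B) (U z) * f1 (qform B (U z))) +
   - (\tr (B *m B))^-1 * E (fun z => std_normal_f1 sig rho x (S z) * (T2 z - \tr (B *m B))).
  rewrite -!expectZ -expectD; apply: eq_expect => z _.
  rewrite /S /f /f1 /T2; set F1 := std_normal_f1 _ _ _ _; set F := std_normal_f _ _ _ _.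
  have s20 : s ^+ 2 != 0 by rewrite expf_neq0 // gt_eqF.
  have -> : - s^-1 * ((qform B (U z) - \tr B) * F - 2 * qform (B *m B) (U z) * (F1 / s)) =
    - ((qform B (U z) - \tr B) / s * F) + 2 * qform (B *m B) (U z) * F1 / s ^+ 2.
    by field; rewrite gt_eqF.
  rewrite s2; field; rewrite (gt_eqF tr_gt0) (gt_eqF s0) //=.
pose p := sig1^-1; pose D := delta^-1; pose q := s^-1.
have p1 : 1 <= p by rewrite invf_ge1.
have D1 : 1 <= D by rewrite invf_ge1.
have q0 : 0 <= q by rewrite invr_ge0 ltW.
have qD : q <= D by rewrite /q /D lef_pV2 ?posrE ?d0 ?s0 ?sd.
have p0 : 0 <= p := le_trans ler01 p1.
have D0 : 0 <= D := le_trans ler01 D1.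
have h0 : 0 <= h := le_trans ler01 h1.
have k0 : 0 <= kap := le_trans ler01 k1.
have -> : ((sig1 * delta) ^+ 3)^-1 = p ^+ 3 * D ^+ 3.
  by rewrite exprMn invfM !exprVn.
have C0 : 0 <= kap ^+ 4 * (p ^+ 3 * D ^+ 3) by rewrite !mulr_ge0 ?exprn_ge0.
have first_le : `|- q * E (fun z => (qform B (U z) - \tr B) * f (qform B (U z)) -
        2 * qform (B *m B) (U z) * f1 (qform B (U z)))| <=
   100 * (kap ^+ 4 * (p ^+ 3 * D ^+ 3) * eta).
  rewrite normrM normrN (ger0_norm q0).
  apply: (le_trans (ler_wpM2l q0 st)).
  have -> : q * (25 * kap ^+ 4 * r * (sig1^-1 * h ^+ 3 + (sig1 ^+ 2)^-1 / s * h ^+ 3 +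
     2 * (sig1 ^+ 3)^-1 / s ^+ 2 * h ^+ 4)) =
     25 * (kap ^+ 4 * (q * (p * (h ^+ 3 * r)) + q ^+ 2 * (p ^+ 2 * (h ^+ 3 * r)) +
       2 * (q ^+ 3 * (p ^+ 3 * (h ^+ 4 * r))))).
    by rewrite /p /q; field; rewrite !gt_eqF.
  have h34 : h ^+ 3 * r <= eta.
    by apply: le_trans etr; rewrite ler_wpM2r // ler_weXn2l.
  have hr0 : 0 <= h ^+ 3 * r by rewrite mulr_ge0 ?exprn_ge0.
  have gen n : (n <= 3)%N -> q ^+ n * p ^+ n <= p ^+ 3 * D ^+ 3.
    move=> n3; rewrite mulrC; apply: ler_pM; rewrite ?exprn_ge0 //.
      by rewrite ler_weXn2l.
    apply: (@le_trans _ _ (D ^+ n)); first by apply: lerXn2r.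
    by rewrite ler_weXn2l.
  have A1 : q * (p * (h ^+ 3 * r)) <= p ^+ 3 * D ^+ 3 * eta.
    by rewrite mulrA; apply: ler_pM => //; [rewrite mulr_ge0|exact: (gen 1%N)].
  have A2 : q ^+ 2 * (p ^+ 2 * (h ^+ 3 * r)) <= p ^+ 3 * D ^+ 3 * eta.
    by rewrite mulrA; apply: ler_pM => //; [rewrite mulr_ge0 ?exprn_ge0|exact: (gen 2%N)].
  have A3 : q ^+ 3 * (p ^+ 3 * (h ^+ 4 * r)) <= p ^+ 3 * D ^+ 3 * eta.
    rewrite mulrA; apply: ler_pM => //; rewrite ?mulr_ge0 ?exprn_ge0 //; exact: (gen 3%N).
  have -> : 100 * (kap ^+ 4 * (p ^+ 3 * D ^+ 3) * eta) = 25 * (kap ^+ 4 * (4 * (p ^+ 3 * D ^+ 3 * eta))) by ring.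
  by rewrite ler_wpM2l // ler_wpM2l ?exprn_ge0 //; lra.
(* From [1 / h <= eta] follows [h <= h^2 eta], and [h^4 r <= eta <= h^2 eta]; the coefficients
   satisfy [4 + 40 <= 49]. *)
have vle : Num.sqrt (4 * h + 40 * kap ^+ 2 * h ^+ 4 * r) <= 7 * kap * h * Num.sqrt eta.
  have -> : 7 * kap * h * Num.sqrt eta = Num.sqrt (49 * (kap ^+ 2 * (h ^+ 2 * eta))).
    have -> : 49 * (kap ^+ 2 * (h ^+ 2 * eta)) = (7 * kap * h) ^+ 2 * eta by ring.
    by rewrite sqrtrM ?sqr_ge0 // sqrtr_sqr ger0_norm // !mulr_ge0.
  apply: ler_wsqrtr.
  have he : h <= h ^+ 2 * eta.
    rewrite expr2 -mulrA -{1}[h]mulr1 ler_wpM2l //.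
    have hp : 0 < h by apply: lt_le_trans h1.
    by rewrite -(@mulfV _ h) ?gt_eqF // ler_wpM2l.
  have k2 : 1 <= kap ^+ 2 by rewrite exprn_ege1.
  have h2 : 1 <= h ^+ 2 by rewrite exprn_ege1.
  have B1 : h ^+ 2 * eta <= kap ^+ 2 * (h ^+ 2 * eta) by rewrite ler_peMl // mulr_ge0 ?sqr_ge0.
  have B2 : kap ^+ 2 * (h ^+ 4 * r) <= kap ^+ 2 * (h ^+ 2 * eta).
    by rewrite ler_wpM2l ?sqr_ge0 // (le_trans etr) // ler_peMl.
  have -> : 40 * kap ^+ 2 * h ^+ 4 * r = 40 * (kap ^+ 2 * (h ^+ 4 * r)) by ring.
  have : 0 <= kap ^+ 2 * (h ^+ 2 * eta) by rewrite !mulr_ge0 ?sqr_ge0.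
  lra.
have second_le : `|- (\tr (B *m B))^-1 * E (fun z => std_normal_f1 sig rho x (S z) * (T2 z - \tr (B *m B)))|
   <= 7 * (kap ^+ 4 * (p ^+ 3 * D ^+ 3) * Num.sqrt eta).
  rewrite normrM normrN (ger0_norm (x := (\tr _)^-1)) ?invr_ge0 ?(ltW tr_gt0) //.
  have tr_le : (\tr (B *m B))^-1 <= D * h^-1.
    rewrite -invfM lef_pV2 ?posrE // mulr_gt0 //.
    exact: lt_le_trans ltr01 h1.
  apply: (@le_trans _ _ ((D * h^-1) * (p ^+ 2 * (7 * kap * h * Num.sqrt eta)))).
    apply: ler_pM => //; first by rewrite invr_ge0 ltW.
    apply: (le_trans (normr_expect _ _)).
    apply: (@le_trans _ _ (E (fun z => p ^+ 2 * `|T2 z - \tr (B *m B)|))).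
      apply: le_expect => z _; rewrite normrM ler_wpM2r //.
      by rewrite exprVn; apply: std_normal_f1_bound.
    by rewrite expectZ ler_wpM2l ?exprn_ge0 // (le_trans var).
  have -> : D * h^-1 * (p ^+ 2 * (7 * kap * h * Num.sqrt eta)) = 7 * (kap * (p ^+ 2 * D) * Num.sqrt eta).
    field; rewrite gt_eqF //; exact: lt_le_trans ltr01 h1.
  rewrite ler_wpM2l // ler_wpM2r ?sqrtr_ge0 //; apply: ler_pM; rewrite ?mulr_ge0 ?exprn_ge0 //.
    by rewrite -{1}[kap]expr1 ler_weXn2l.
  by apply: ler_pM; rewrite ?exprn_ge0 //; [rewrite ler_weXn2l|rewrite -{1}[D]expr1 ler_weXn2l].
apply: (le_trans (ler_normD _ _)); apply: (le_trans (lerD first_le second_le)).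
have : 0 <= kap ^+ 4 * (p ^+ 3 * D ^+ 3) * Num.sqrt eta by rewrite mulr_ge0 ?sqrtr_ge0.
have -> : 100 * kap ^+ 4 * (p ^+ 3 * D ^+ 3) * (eta + Num.sqrt eta) =
  100 * (kap ^+ 4 * (p ^+ 3 * D ^+ 3) * eta) + 100 * (kap ^+ 4 * (p ^+ 3 * D ^+ 3) * Num.sqrt eta) by ring.
lra.
Qed.

Lemma smooth_clt (tau x : R) : 0 < tau <= 1 ->
  `|E (fun z => Phi ((x - S z) / Num.sqrt tau)) - Phi (x / Num.sqrt (1 + tau))| <=
  100 * kap ^+ 4 * ((Num.sqrt tau * delta) ^+ 3)^-1 * (eta + Num.sqrt eta).
Proof.
move=> /andP[t0 t1]; have [[NqN N0 H0] _ _ _ _] := arr.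
have st0 : 0 < Num.sqrt tau <= 1.
  by rewrite sqrtr_gt0 t0 -[X in _ <= X]sqrtr1 ler_wsqrtr.
pose g p := E (fun z => Phi ((x - p * S z) / ou_sig tau p)).
have -> : E (fun z => Phi ((x - S z) / Num.sqrt tau)) = g 1.
  apply: eq_expect => z _; rewrite mul1r /ou_sig expr1n; congr (Phi (_ / Num.sqrt _)); ring.
have -> : Phi (x / Num.sqrt (1 + tau)) = g 0.
  rewrite -[LHS](@expect_cst R N Q Nq NqN); apply: eq_expect => z _.
  by rewrite mul0r subr0 /ou_sig expr0n subr0.
rewrite -[X in _ <= X]mulr1 -[X in _ <= _ * X](subr0 1).
pose dg p := E (fun z => std_normal_f1 (ou_sig tau p) p x (S z) - S z * std_normal_f (ou_sig tau p) p x (S z)).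
apply: (@derive_bound R g dg 0 1) => // p p01.
  apply: (@is_derive_expect N Q Nq (fun z p => Phi ((x - p * S z) / ou_sig tau p))
    (fun z p => std_normal_f1 (ou_sig tau p) p x (S z) - S z * std_normal_f (ou_sig tau p) p x (S z))).
  by move=> z; apply: is_derive_ou.
have [sl sp] := ou_sig_gt0 t0 p01.
exact: stein_standardized.
Qed.

End StandardizedQform.

Lemma prob_expect (N Q : nat) (Nq : 'I_Q -> nat) (A : {ffun 'I_N -> 'I_Q} -> bool) :
  prob R Nq A = expect Nq (fun z => (A z)%:R).
Proof.
rewrite /prob /expect; congr (_ / _).
rewrite -sum1_card natr_sum big_mkcond [RHS]big_mkcond /=; apply: eq_bigr => z _.
by rewrite inE; case: (z \in assignments N Nq); case: (A z).
Qed.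

Lemma std_normal_cdf_lip (x y : R) : `|Phi x - Phi y| <= `|x - y|.
Proof.
rewrite -[X in _ <= X]mul1r; apply: (derive_boundT (df := normal_pdf 0 1)).
  exact: is_derive_std_normal_cdf.
by move=> t; rewrite ger0_norm ?normal_pdf01_ge0 // normal_pdf01_le1.
Qed.

Lemma std_normal_tail (eps : R) : 0 < eps -> exists t, [/\ 0 < t, 1 - eps <= Phi t & Phi (- t) <= eps].
Proof.
move=> e0; have [t t0 tP] := std_normal_cdf_near1 e0; have [u uP] := std_normal_cdf_near0 e0.
exists (t + `|u|); split.
- by rewrite ltr_wpDr.
- by apply: (le_trans (ltW tP)); apply: std_normal_cdf_le; rewrite lerDl.
- apply: le_trans (ltW uP); apply: std_normal_cdf_le.
  rewrite opprD -[X in _ <= X]opprK; have := ler_norm (- u); rewrite normrN => ?; lra.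
Qed.

Lemma smoothing (x eps : R) : 0 < eps -> exists d tau : R, [/\ 0 < tau <= 1,
  forall s : R, ((s <= x)%R)%:R <= Phi ((x + d - s) / Num.sqrt tau) + eps,
  forall s : R, Phi ((x - d - s) / Num.sqrt tau) - eps <= ((s <= x)%R)%:R,
  Phi ((x + d) / Num.sqrt (1 + tau)) <= Phi x + eps
  & Phi x - eps <= Phi ((x - d) / Num.sqrt (1 + tau))].
Proof.
move=> e0; have [t [t0 t1 t2]] := std_normal_tail e0.
pose d := eps / 2; have d0 : 0 < d by rewrite divr_gt0.
pose b := `|x| + d; have b0 : 0 < b by rewrite ltr_wpDl.
(* [tau b <= d] controls the division by [sqrt (1 + tau)] at the points [x + d] and [x - d].
   [sqrt tau t <= d] pushes the argument of [Phi] beyond [t] or below [- t] once [s] is on the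
   proper side of [x]. Shift and division together move a point by [2 d = eps]. *)
pose tau := Num.min 1 (Num.min (d / b) ((d / t) ^+ 2)).
have tau0 : 0 < tau by rewrite !lt_min ltr01 divr_gt0 // exprn_gt0 // divr_gt0.
have tau1 : tau <= 1 by rewrite ge_min lexx.
have taub : tau * b <= d.
  by rewrite -ler_pdivlMr // !ge_min lexx orbT.
have taut : Num.sqrt tau * t <= d.
  have -> : d = Num.sqrt ((d / t) ^+ 2) * t.
    by rewrite sqrtr_sqr gtr0_norm ?divr_gt0 // divfK // gt_eqF.
  rewrite ler_wpM2r ?(ltW t0) //.
  by rewrite ler_wsqrtr // !ge_min lexx !orbT.
have st0 : 0 < Num.sqrt tau by rewrite sqrtr_gt0.
have shrink u : `|u| <= b -> `|u / Num.sqrt (1 + tau) - u| <= d.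
  move=> ub; set v := Num.sqrt (1 + tau).
  have v1 : 1 <= v by rewrite -[X in X <= _]sqrtr1 ler_wsqrtr // lerDl ltW.
  have v2 : v <= 1 + tau.
    have v2' : v ^+ 2 = 1 + tau by rewrite sqr_sqrtr // addr_ge0 // ltW.
    by nra.
  have vn : v != 0 by rewrite gt_eqF // (lt_le_trans ltr01).
  have -> : u / v - u = u * ((1 - v) / v) by field.
  rewrite normrM; apply: le_trans taub; rewrite mulrC; apply: ler_pM => //.
  rewrite normrM normfV distrC (ger0_norm (x := v)) ?(le_trans ler01) //.
  rewrite ger0_norm ?subr_ge0 // ler_pdivrMr ?(lt_le_trans ltr01) //.
  by have := tau0; nra.
exists d, tau; split; first by rewrite tau0.
- move=> s; have [sx|_] := leP s x; last by rewrite addr_ge0 ?std_normal_cdf_ge0 // ltW.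
  rewrite -lerBlDr; apply: (le_trans t1); apply: std_normal_cdf_le.
  by rewrite ler_pdivlMr // mulrC; lra.
- move=> s; have [_|xs] := leP s x; first by rewrite lerBlDr (le_trans (std_normal_cdf_le1 _)) // lerDl ltW.
  rewrite lerBlDr add0r; apply: le_trans t2; apply: std_normal_cdf_le.
  by rewrite ler_pdivrMr // mulNr mulrC; lra.
- have xb : `|x + d| <= b by apply: (le_trans (ler_normD _ _)); rewrite (gtr0_norm d0).
  have lip := std_normal_cdf_lip ((x + d) / Num.sqrt (1 + tau)) x.
  have ux : `|(x + d) / Num.sqrt (1 + tau) - x| <= eps.
    have := shrink _ xb; rewrite !ler_norml /d => /andP[? ?]; apply/andP; split; lra.
  by have := le_trans (le_trans (ler_norm _) lip) ux; lra.
- have xb : `|x - d| <= b by apply: (le_trans (ler_normB _ _)); rewrite (gtr0_norm d0).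
  have lip := std_normal_cdf_lip x ((x - d) / Num.sqrt (1 + tau)).
  have ux : `|x - (x - d) / Num.sqrt (1 + tau)| <= eps.
    have := shrink _ xb; rewrite !ler_norml /d => /andP[? ?]; apply/andP; split; lra.
  by have := le_trans (le_trans (ler_norm _) lip) ux; lra.
Qed.

Theorem standardized_clt (kap delta x eps : R) : 1 <= kap -> 0 < delta <= 1 -> 0 < eps ->
  exists2 eta : R, 0 < eta &
  forall (N Q H : nat) (Nq : 'I_Q -> nat) (a : 'I_N -> 'I_Q -> 'cV[R]_H) (e : R) (B : 'M[R]_H),
  standardized_array Nq a e kap -> psd_contraction B ->
  delta * H%:R <= \tr (B *m B) ->
  H%:R^-1 <= eta -> H%:R ^+ 4 * (Num.sqrt N%:R)^-1 <= eta ->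
  `|prob R Nq (fun z => standardized_qform a B z <= x) - Phi x| <= eps.
Proof.
move=> k1 d01 e0.
have e3 : 0 < eps / 3 by rewrite divr_gt0.
have [d [tau [tau01 up dn upx dnx]]] := smoothing x e3.
have /andP[tau0 tau1] := tau01; have /andP[dl0 dl1] := d01.
pose C := 100 * kap ^+ 4 * ((Num.sqrt tau * delta) ^+ 3)^-1.
have C0 : 0 < C.
  have k0 : 0 < kap := lt_le_trans ltr01 k1.
  by rewrite !mulr_gt0 ?exprn_gt0 // invr_gt0 exprn_gt0 // mulr_gt0 // sqrtr_gt0.
(* The rate is [eta + sqrt eta], which for [eta = w^2] with [w <= 1] is at most [2 w]. *)
pose w := Num.min 1 (eps / (6 * C)).
have w0 : 0 < w by rewrite lt_min ltr01 divr_gt0 // mulr_gt0.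
have w1 : w <= 1 by rewrite ge_min lexx.
have wC : C * (w ^+ 2 + Num.sqrt (w ^+ 2)) <= eps / 3.
  rewrite sqrtr_sqr gtr0_norm //.
  have C6 : 0 < 6 * C by rewrite mulr_gt0.
  have : w * (6 * C) <= eps by rewrite -(ler_pdivlMr _ _ C6) /w ge_min lexx orbT.
  have : w ^+ 2 <= w by rewrite expr2 ler_piMl // ltW.
  have := ltW C0; nra.
exists (w ^+ 2); first by rewrite exprn_gt0.
move=> N Q H Nq a e B arr cB trB hH hN.
have [[NqN N0 H0] _ _ _ _] := arr.
have clt y := smooth_clt arr cB d01 trB hH hN (tau := tau) y tau01.
rewrite prob_expect.
have U := le_expect (Nq := Nq) (fun z _ => up (standardized_qform a B z)).
have L := le_expect (Nq := Nq) (fun z _ => dn (standardized_qform a B z)).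
move: U L; rewrite expectD expectB !expect_cst // => U L.
have := le_trans (clt (x + d)) wC; have := le_trans (clt (x - d)) wC.
rewrite !ler_norml => /andP[A1 A2] /andP[B1 B2].
clear -A1 A2 B1 B2 U L upx dnx.
by apply/andP; split; lra.
Qed.

End StandardizedArrays.

(** * Laplace transforms of quadratic forms in array sums *)

Section Laplace.
Variable R : realType.

(** For [u = c (y - x) >= 0] this is [exp(-u) - 1 + u <= u^2]. For [u < 0] the growth of [exp(-u)]
    is absorbed by [exp(- c x)], because [y >= 0] forces [c x >= - u]. This use of the half line
    explains the sign conditions on the arguments in [stein_qform]. *)
Lemma expR_neg_le (c x y : R) : 0 <= c -> 0 <= x -> 0 <= y ->
  `|expR (- c * y) - expR (- c * x) - (- c * expR (- c * x)) * (y - x)| <= c ^+ 2 * (y - x) ^+ 2.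
Proof.
move=> c0 x0 y0; pose u := c * (y - x).
have -> : expR (- c * y) = expR (- c * x) * expR (- u) by rewrite -expRD; congr expR; rewrite /u; ring.
have -> : expR (- c * x) * expR (- u) - expR (- c * x) - - c * expR (- c * x) * (y - x) =
   expR (- c * x) * (expR (- u) - 1 + u) by rewrite /u; ring.
have -> : c ^+ 2 * (y - x) ^+ 2 = u ^+ 2 by rewrite /u; ring.
have p0 : 0 <= expR (- u) - 1 + u by have := expR_ge1Dx (- u); lra.
rewrite ger0_norm ?mulr_ge0 ?expR_ge0 //.
have [u0|u0] := leP 0 u.
  have e1 : expR (- c * x) <= 1.
    by rewrite -[X in _ <= X]expR0 ler_expR mulNr oppr_le0 mulr_ge0.
  have e2 : expR (- u) <= (1 + u)^-1.
    rewrite expRN lef_pV2 ?posrE ?expR_gt0 ?expR_ge1Dx //; lra.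
  have e3 : (1 + u)^-1 <= 1 - u + u ^+ 2.
    have u1 : 0 < 1 + u by lra.
    rewrite -[X in X <= _]mul1r ler_pdivrMr //.
    have -> : (1 - u + u ^+ 2) * (1 + u) = 1 + u ^+ 3 by ring.
    by rewrite lerDl exprn_ge0.
  by apply: (le_trans (ler_piMl p0 e1)); lra.
set w := - u in p0 *; have w0 : 0 < w by rewrite /w; lra.
have wcx : - c * x <= - w.
  have := mulr_ge0 c0 y0; rewrite /w /u; nra.
apply: (@le_trans _ _ (expR (- w) * (expR w - 1 + u))).
  by rewrite ler_wpM2r // ler_expR.
have -> : expR (- w) * (expR w - 1 + u) = 1 - (1 + w) * expR (- w).
  have ww : expR (- w) * expR w = 1 by rewrite -expRD addNr expR0.
  by rewrite mulrDr mulrBr ww /w; ring.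
have := expR_ge1Dx (- w) => e.
have : (1 + w) * (1 - w) <= (1 + w) * expR (- w) by rewrite ler_wpM2l //; lra.
have -> : u ^+ 2 = w ^+ 2 by rewrite /w; ring.
nra.
Qed.

Section Diagonal.
Variables (N Q H : nat) (Nq : 'I_Q -> nat).
Variables (a : 'I_N -> 'I_Q -> 'cV[R]_H) (e kap : R).
Hypothesis arr : standardized_array Nq a e kap.
Variable al : 'rV[R]_H.
Hypothesis al0 : forall h, 0 <= al 0 h.
Local Notation E := (@expect R N Q Nq).
Local Notation U := (assignment_sum a).
Let m : R := 1 + \sum_h al 0 h.

Let den (t : R) h := 1 + (1 - t) * al 0 h.
Let b (t : R) : 'rV[R]_H := \row_h (al 0 h / den t h).
(** At [t = 1] the exponent is the quadratic form, at [t = 0] the logarithm of its Gaussian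
    transform. For Gaussian [U] the mean of [expR (expo z t)] would not depend on [t], since
    [den t h + t al h = 1 + al h]. *)
Let expo z (t : R) := - 2^-1 * (\sum_h (ln (den t h) + t * (al 0 h / den t h) * U z h 0 ^+ 2)).

Let den_ge1 t h : 0 <= t <= 1 -> 1 <= den t h.
Proof. by move=> /andP[t0 t1]; rewrite lerDl mulr_ge0 // subr_ge0. Qed.

Let m1 : 1 <= m. Proof. by rewrite lerDl sumr_ge0. Qed.
Let m0 : 0 < m. Proof. exact: lt_le_trans ltr01 m1. Qed.

Lemma is_derive_sumf (I : Type) (r : seq I) (f : I -> R -> R) (df : I -> R) (x : R) :
  (forall i, is_derive x 1 (f i) (df i)) ->
  is_derive x 1 (fun t => \sum_(i <- r) f i t) (\sum_(i <- r) df i).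
Proof.
move=> fd; elim: r => [|i r IH].
  rewrite big_nil (_ : (fun t => _) = fun=> 0); first exact: is_derive_cstf.
  by apply/funext => t; rewrite big_nil.
rewrite big_cons (_ : (fun t => _) = fun t => f i t + \sum_(i <- r) f i t); last first.
  by apply/funext => t; rewrite big_cons.
exact: is_derive_addf.
Qed.

Let qb (t : R) z := qform (diag_mx (b t)) (U z).
Let qb2 (t : R) z := qform (diag_mx (b t) *m diag_mx (b t)) (U z).
Let trb (t : R) := \tr (diag_mx (b t)).

Let expo_derive z (t : R) : 0 <= t <= 1 ->
  is_derive t 1 (expo z) (- 2^-1 * (qb t z - trb t + t * qb2 t z)).
Proof.
move=> t01.
have dd h : is_derive t 1 (fun t => den t h) (- al 0 h).
  rewrite (_ : (fun t => _) = fun t => (1 + al 0 h) + - al 0 h * t); last first.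
    by apply/funext => u; rewrite /den; ring.
  have := is_derive_addf (is_derive_cstf (1 + al 0 h) t) (is_derive_scalef (- al 0 h) (is_derive_idf t)).
  by congr (is_derive _ _ _ _); ring.
have -> : qb t z - trb t + t * qb2 t z =
   \sum_h (- (al 0 h / den t h) + (al 0 h / den t h + t * (al 0 h / den t h) ^+ 2) * U z h 0 ^+ 2).
  rewrite /qb /qb2 /trb mulmx_diag !qform_diag mxtrace_diag mulr_sumr -sumrB -big_split.
  by apply: eq_bigr => h _ /=; rewrite !mxE; ring.
apply: is_derive_scalef; apply: is_derive_sumf => h.
have d1 := den_ge1 h t01; have dp : 0 < den t h := lt_le_trans ltr01 d1.
have dn : den t h != 0 by rewrite gt_eqF.
have L := is_derive_compf (f := @ln R) (g := fun t => den t h) (is_derive1_ln dp) (dd h).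
have V := is_derive_mulf (is_derive_mulf (is_derive_idf t)
    (is_derive_scalef (al 0 h) (is_derive_invf (f := fun t => den t h) dn (dd h))))
  (is_derive_cstf (U z h 0 ^+ 2) t).
have := is_derive_addf L V; congr (is_derive _ _ _ _).
by field.
Qed.

Let contr t : 0 <= t <= 1 -> psd_contraction (m^-1 *: diag_mx (b t)).
Proof.
move=> t01; have b0 h : 0 <= b t 0 h.
  by rewrite mxE divr_ge0 // (le_trans ler01) // den_ge1.
have bm h : b t 0 h <= m.
  rewrite mxE ler_pdivrMr ?(lt_le_trans ltr01) ?den_ge1 //.
  apply: (@le_trans _ _ m); last by rewrite ler_peMr ?den_ge1 // ltW.
  by rewrite /m (bigD1 h) //= addrCA lerDl addr_ge0 // sumr_ge0.
have QE v : qform (m^-1 *: diag_mx (b t)) v = m^-1 * \sum_h b t 0 h * v h 0 ^+ 2.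
  by rewrite -qform_diag /qform -scalemxAr -scalemxAl mxE.
split; first split.
- by rewrite linearZ /= tr_diag_mx.
- move=> v; rewrite QE mulr_ge0 ?invr_ge0 ?(ltW m0) //.
  by apply: sumr_ge0 => h _; rewrite mulr_ge0 ?sqr_ge0.
- move=> v; rewrite QE ler_pdivrMl // /sqnorm mulr_sumr; apply: ler_sum => h _.
  by rewrite ler_wpM2r ?sqr_ge0.
Qed.

Lemma laplace_diag :
  `|E (fun z => expR (- 2^-1 * qform (diag_mx al) (U z))) - expR (- 2^-1 * \sum_h ln (1 + al 0 h))| <=
  50 * m ^+ 3 * kap ^+ 4 * (H%:R ^+ 4 * (Num.sqrt N%:R)^-1).
Proof.
have [[NqN N0 H0] ac [e0 ea] iso [k1 Ne]] := arr.
pose g t := E (fun z => expR (expo z t)).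
have -> : E (fun z => expR (- 2^-1 * qform (diag_mx al) (U z))) = g 1.
  apply: eq_expect => z _; rewrite qform_diag /expo; congr (expR (_ * _)).
  by apply: eq_bigr => h _; rewrite /den subrr mul0r addr0 ln1 add0r mul1r divr1.
have -> : expR (- 2^-1 * \sum_h ln (1 + al 0 h)) = g 0.
  rewrite -[LHS](@expect_cst R N Q Nq NqN); apply: eq_expect => z _.
  rewrite /expo; congr (expR (_ * _)); apply: eq_bigr => h _.
  by rewrite /den subr0 mul1r !mul0r addr0.
rewrite -[X in _ <= X]mulr1 -[X in _ <= _ * X](subr0 1).
pose dg t := E (fun z => expR (expo z t) * (- 2^-1 * (qb t z - trb t + t * qb2 t z))).
apply: (@derive_bound R g dg 0 1) => // t t01.
  apply: (@is_derive_expect R N Q Nq (fun z t => expR (expo z t))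
    (fun z t => expR (expo z t) * (- 2^-1 * (qb t z - trb t + t * qb2 t z)))) => z.
  exact: (is_derive_compf (f := expR) (g := expo z) (is_derive_expR _) (expo_derive z t01)).
have /andP[t0 t1] := t01.
pose B := m^-1 *: diag_mx (b t); have cB := contr t01.
(* With this rate, [f' = - c f] turns Stein's expression [(T - tr B) f - 2 U^T B^2 U f'] into a
   multiple of the derivative of the path: [2 c / m^2 = t / m]. Division by [m] has made the
   diagonal matrix a contraction. *)
pose c := t * m / 2.
have c0 : 0 <= c by rewrite divr_ge0 // mulr_ge0 // ltW.
have cm : c <= m by rewrite /c ler_pdivrMr // mulrC ler_wpM2l ?(ltW m0) //; lra.
pose f (x : R) := expR (- c * x); pose f1 x := - c * f x.
have f01 x : 0 <= x -> 0 <= f x <= 1.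
  by move=> x0; rewrite expR_ge0 /= -[X in _ <= X]expR0 ler_expR mulNr oppr_le0 mulr_ge0.
have fb x : 0 <= x -> `|f x| <= 1 by move=> /f01/andP[? ?]; rewrite ger0_norm.
have f1b x : 0 <= x -> `|f1 x| <= m.
  move=> /f01/andP[? ?]; rewrite normrM normrN !ger0_norm //.
  by rewrite -[X in _ <= X]mulr1 ler_pM.
have f2b x y : 0 <= x -> 0 <= y -> `|f y - f x - f1 x * (y - x)| <= m ^+ 2 * (y - x) ^+ 2.
  move=> x0 y0; apply: (le_trans (expR_neg_le c0 x0 y0)).
  rewrite ler_wpM2r ?sqr_ge0 //; apply: lerXn2r => //; rewrite nnegrE //; exact: ltW.
have st := stein_qform NqN N0 ac e0 ea iso k1 H0 Ne cB fb f1b f2b.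
pose c1 := expR (- 2^-1 * \sum_h ln (den t h)).
have c1le : 0 <= c1 <= 1.
  rewrite expR_ge0 /= -[X in _ <= X]expR0 ler_expR mulNr oppr_le0 mulr_ge0 //.
  by apply: sumr_ge0 => h _; rewrite ln_ge0 // den_ge1.
have QB z : qform B (U z) = qb t z / m.
  by rewrite /qb /qform /B -scalemxAr -scalemxAl mxE mulrC.
have QBB z : qform (B *m B) (U z) = qb2 t z / m ^+ 2.
  rewrite /qb2 /qform /B -!scalemxAl -!scalemxAr -!scalemxAl mxE [X in _ * X]mxE mulrA.
  by rewrite -invfM -expr2 mulrC.
have TB : \tr B = trb t / m by rewrite /B mxtraceZ mulrC.
have -> : dg t = - (2^-1 * m * c1) * E (fun z => (qform B (U z) - \tr B) * f (qform B (U z)) -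
        2 * qform (B *m B) (U z) * f1 (qform B (U z))).
  rewrite -expectZ; apply: eq_expect => z _.
  have -> : expR (expo z t) = c1 * f (qform B (U z)).
    rewrite /c1 /f -expRD; congr expR; rewrite QB /expo big_split /= mulrDr; congr (_ + _).
    rewrite /c /qb qform_diag mulr_suml !mulr_sumr; apply: eq_bigr => h _.
    by rewrite mxE; field; rewrite (gt_eqF m0) gt_eqF // (lt_le_trans ltr01) // den_ge1.
  rewrite /f1 QB QBB TB /c; field; by rewrite gt_eqF.
have /andP[c10 c11] := c1le.
have mc0 : 0 <= 2^-1 * m * c1 by apply: mulr_ge0 => //; apply: mulr_ge0 => //; exact: ltW.
rewrite normrM normrN (ger0_norm mc0).
set r := (Num.sqrt N%:R)^-1; have r0 : 0 <= r by rewrite invr_ge0 sqrtr_ge0.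
have kp : 0 <= kap := le_trans ler01 k1.
have h1 : 1 <= H%:R :> R by rewrite ler1n.
have X0 : 0 <= kap ^+ 4 * (H%:R ^+ 4 * r) by rewrite !mulr_ge0 ?exprn_ge0.
have h34 : H%:R ^+ 3 <= H%:R ^+ 4 :> R by rewrite ler_weXn2l.
have Sb : 25 * kap ^+ 4 * r * (1 * H%:R ^+ 3 + m * H%:R ^+ 3 + m ^+ 2 * H%:R ^+ 4) <=
   75 * (m ^+ 2 * (kap ^+ 4 * (H%:R ^+ 4 * r))).
  have -> : 75 * (m ^+ 2 * (kap ^+ 4 * (H%:R ^+ 4 * r))) =
    25 * kap ^+ 4 * r * (3 * (m ^+ 2 * H%:R ^+ 4)) by ring.
  have mm : m <= m ^+ 2 by rewrite expr2 ler_peMl // ltW.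
  rewrite ler_wpM2l //; first by rewrite !mulr_ge0 ?exprn_ge0.
  have A1 : 1 * H%:R ^+ 3 <= m ^+ 2 * H%:R ^+ 4 :> R.
    by apply: ler_pM => //; rewrite ?exprn_ge0 // exprn_ege1.
  have A2 : m * H%:R ^+ 3 <= m ^+ 2 * H%:R ^+ 4 :> R.
    by apply: ler_pM => //; rewrite ?exprn_ge0 // ltW.
  lra.
apply: (le_trans (ler_wpM2l mc0 (le_trans st Sb))).
have -> : 2^-1 * m * c1 * (75 * (m ^+ 2 * (kap ^+ 4 * (H%:R ^+ 4 * r)))) =
   c1 * (75 / 2 * (m ^+ 3 * (kap ^+ 4 * (H%:R ^+ 4 * r)))) by field.
have -> : 50 * m ^+ 3 * kap ^+ 4 * (H%:R ^+ 4 * r) = 50 * (m ^+ 3 * (kap ^+ 4 * (H%:R ^+ 4 * r))) by ring.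
have Y0 : 0 <= m ^+ 3 * (kap ^+ 4 * (H%:R ^+ 4 * r)).
  by apply: mulr_ge0 => //; apply: exprn_ge0; exact: ltW.
by apply: (@le_trans _ _ (1 * (75 / 2 * (m ^+ 3 * (kap ^+ 4 * (H%:R ^+ 4 * r)))))); [rewrite ler_wpM2r // mulr_ge0|lra].
Qed.

End Diagonal.

Lemma standardized_array_rot (N Q H : nat) (Nq : 'I_Q -> nat)
    (a : 'I_N -> 'I_Q -> 'cV[R]_H) (e kap : R) (P : 'M[R]_H) :
  P *m P^T = 1%:M -> standardized_array Nq a e kap ->
  standardized_array Nq (fun i q => P *m a i q) e kap.
Proof.
move=> PP [h1 ac [e0 ea] iso h5]; split=> //.
- by move=> q; rewrite -mulmx_sumr ac mulmx0.
- by split=> // i q; rewrite ortho_sqnorm.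
have UE z : assignment_sum (fun i q => P *m a i q) z = P *m assignment_sum a z.
  by rewrite /assignment_sum mulmx_sumr.
move=> h k.
transitivity (expect Nq (fun z => \sum_i \sum_j P h i * P k j * (assignment_sum a z i 0 * assignment_sum a z j 0))).
  apply: eq_expect => z _; rewrite !UE !mxE mulr_suml; apply: eq_bigr => i _.
  by rewrite mulr_sumr; apply: eq_bigr => j _; ring.
rewrite expect_sum; transitivity ((P *m P^T) h k); last by rewrite PP mxE.
rewrite mxE; apply: eq_bigr => i _; rewrite expect_sum (bigD1 i) //= big1 ?addr0.
  by rewrite expectZ iso eqxx mulr1 mxE.
by move=> j ji; rewrite expectZ iso eq_sym (negbTE ji) mulr0.
Qed.

Lemma det_1Dpsd_spectral (H : nat) (A P : 'M[R]_H) (d : 'rV[R]_H) :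
  P *m P^T = 1%:M -> A = P^T *m diag_mx d *m P -> \det (1%:M + A) = \prod_h (1 + d 0 h).
Proof.
move=> PP ->; have PP' : P^T *m P = 1%:M by apply: mulmx1C.
have -> : 1%:M + P^T *m diag_mx d *m P = P^T *m diag_mx (const_mx 1 + d) *m P.
  rewrite [diag_mx (_ + _)]linearD /= mulmxDr mulmxDl; congr (_ + _).
  by rewrite diag_const_mx mulmx1 PP'.
rewrite !det_mulmx mulrAC -det_mulmx PP' det1 mul1r det_diag.
by apply: eq_bigr => h _; rewrite !mxE.
Qed.

(** Standardized arrays are stable under orthogonal changes of coordinates, so [A] may be taken
    diagonal. *)
Theorem laplace_psd (N Q H : nat) (Nq : 'I_Q -> nat)
    (a : 'I_N -> 'I_Q -> 'cV[R]_H) (e kap : R) (A : 'M[R]_H) :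
  standardized_array Nq a e kap -> is_psd A ->
  `|expect Nq (fun z => expR (- 2^-1 * qform A (assignment_sum a z))) - (Num.sqrt (\det (1%:M + A)))^-1| <=
  50 * (1 + \tr A) ^+ 3 * kap ^+ 4 * (H%:R ^+ 4 * (Num.sqrt N%:R)^-1).
Proof.
move=> arr pA; have [P [d [PP AE]]] := real_spectral pA.1.
have d0 h : 0 <= d 0 h by apply: (@spectral_psd R H P) => //; rewrite -AE.
have := laplace_diag (standardized_array_rot PP arr) d0.
have -> : \sum_h d 0 h = \tr A.
  rewrite AE mxtrace_mulC mulmxA PP mul1mx mxtrace_diag //.
have -> : expR (- 2^-1 * \sum_h ln (1 + d 0 h)) = (Num.sqrt (\det (1%:M + A)))^-1.
  rewrite (det_1Dpsd_spectral PP AE) mulNr expRN; congr (_^-1).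
  have -> : \prod_h (1 + d 0 h) = expR (\sum_h ln (1 + d 0 h)).
    rewrite expR_sum; apply: eq_bigr => h _; rewrite lnK // posrE.
    by rewrite ltr_pwDl.
  set L := \sum_h _; have -> : expR L = expR (2^-1 * L) ^+ 2.
    by rewrite -expRM_natl; congr expR; rewrite -mulr_natl; field.
  by rewrite sqrtr_sqr ger0_norm // expR_ge0.
congr (_ <= _); congr (`|_ - _|); apply: eq_expect => z _; congr (expR (_ * _)).
rewrite AE qform_conj; congr (qform _ _).
by rewrite /assignment_sum mulmx_sumr.
Qed.

End Laplace.

(** * Moments and concentration in the design *)

Section DesignMoments.
Variables (R : realType) (N Q H : nat) (Nq : 'I_Q -> nat).
Variables (Y : 'M[R]_(N, Q)) (F : 'M[R]_(Q, H)).
Hypothesis NqN : (\sum_q Nq q)%N = N.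
Hypothesis Nq2 : forall q, (2 <= Nq q)%N.
Hypothesis N_gt1 : (1 < N)%N.
Local Notation E := (@expect R N Q Nq).
Local Notation Z := (assignments N Nq).

Let N_gt0 : (0 < N)%N. Proof. exact: ltnW. Qed.
Let N0 : N%:R != 0 :> R. Proof. by rewrite pnatr_eq0 -lt0n. Qed.
Let N1 : N%:R - 1 != 0 :> R. Proof. by rewrite subr_eq0 pnatr_eq1 gtn_eqF. Qed.
Let Nq0 q : (Nq q)%:R != 0 :> R. Proof. by rewrite pnatr_eq0 -lt0n ltnW. Qed.
Let Nq1 q : (Nq q)%:R - 1 != 0 :> R. Proof. by rewrite subr_eq0 pnatr_eq1 gtn_eqF. Qed.

Definition centered_outcome i q : R := Y i q - Ybar Y q 0.
Local Notation y := centered_outcome.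

Lemma sum_centered_outcome q : \sum_i y i q = 0.
Proof.
rewrite sumrB sumr_const card_ord -[X in _ - X]mulr_natl /Ybar mxE mulrA mulfV //.
by rewrite mul1r subrr.
Qed.

Lemma SmatE q q' : \sum_i y i q * y i q' = (N%:R - 1) * Smat Y q q'.
Proof. by rewrite mxE mulrA mulfV // mul1r. Qed.

Definition contribution i q : 'cV[R]_H := \col_h (F q h / (Nq q)%:R * y i q).
Local Notation a0 := contribution.

Lemma sum_contribution q : \sum_i a0 i q = 0.
Proof.
apply/matrixP => h k; rewrite summxE mxE.
under eq_bigr => i _ do rewrite mxE.
by rewrite -mulr_sumr sum_centered_outcome mulr0.
Qed.

Lemma Yhat_centered z q : z \in Z ->
  Yhat Nq Y z q 0 - Ybar Y q 0 = (Nq q)%:R^-1 * \sum_(i | z i == q) y i q.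
Proof.
move=> zZ; rewrite mxE sumrB sumr_const -cardsE (assignments_card q zZ).
by rewrite mulrBr -[Ybar Y q 0 *+ _]mulr_natl [X in _ = _ - X]mulrA mulVf // mul1r.
Qed.

Lemma gammahatE z : z \in Z -> gammahat Nq Y F z - gamma Y F = assignment_sum a0 z.
Proof.
move=> zZ; rewrite /gammahat /gamma -mulmxBr; apply/matrixP => h k; rewrite ord1.
rewrite mxE summxE.
transitivity (\sum_q \sum_(i | z i == q) F q h / (Nq q)%:R * y i q).
  apply: eq_bigr => q _; rewrite !mxE -mulr_sumr -mulrA; congr (_ * _).
  by have := Yhat_centered q zZ; rewrite !mxE.
rewrite (exchange_big_dep xpredT) //=; apply: eq_bigr => i _.
by rewrite (big_pred1 (z i)) ?mxE // => q; rewrite eq_sym.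
Qed.

Lemma V_YhatE q q' :
  V_Yhat Nq Y q q' = (q == q')%:R * (Smat Y q q / (Nq q)%:R) - N%:R^-1 * Smat Y q q'.
Proof. by rewrite /V_Yhat !mxE mulr_natl. Qed.

(** In [expect_mul_centered] the terms with [q != q'] give [- S(q,q') / N], and those with [q = q']
    combine to [S(q,q) / N_q - S(q,q) / N]. *)
Lemma expect_contribution h k :
  E (fun z => assignment_sum a0 z h 0 * assignment_sum a0 z k 0) = V_gammahat Nq Y F h k.
Proof.
have SE z l : assignment_sum a0 z l 0 = \sum_i a0 i (z i) l 0 by rewrite summxE.
under eq_expect do rewrite !SE.
rewrite (expect_mul_centered NqN N_gt0 (phi := fun i q => a0 i q h 0) (fun i q => a0 i q k 0)); last first.
  by move=> q; rewrite -summxE sum_contribution mxE.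
have PE q q' : \sum_i a0 i q h 0 * a0 i q' k 0 =
   F q h / (Nq q)%:R * (F q' k / (Nq q')%:R) * ((N%:R - 1) * Smat Y q q').
  rewrite -SmatE mulr_sumr; apply: eq_bigr => i _; rewrite !mxE; ring.
transitivity (\sum_q \sum_q' F q h * V_Yhat Nq Y q q' * F q' k); last first.
  rewrite /V_gammahat mxE exchange_big; apply: eq_bigr => q' _ /=.
  by rewrite mxE mulr_suml; apply: eq_bigr => q _; rewrite [F^T _ _]mxE.
rewrite -sumrB; apply: eq_bigr => q _.
rewrite PE (bigD1 q) //= [in RHS](bigD1 q) //= opprD addrA; congr (_ + _).
  rewrite PE V_YhatE eqxx /=; move: (Smat Y q q) => s.
  by field; rewrite N0 N1 Nq0.
rewrite -sumrN; apply: eq_bigr => q' q'q; rewrite PE V_YhatE eq_sym (negbTE q'q) /=.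
by move: (Smat Y q q') => s; field; rewrite N0 N1 !Nq0.
Qed.

(** Written with indicators, both sums run over all units: the first is linear in them, and
    expectations and swaps can be evaluated term by term. *)
Lemma ShatE z q : z \in Z -> Shat Nq Y z q =
  ((Nq q)%:R - 1)^-1 * (\sum_i (z i == q)%:R * y i q ^+ 2 -
    (\sum_i (z i == q)%:R * y i q) ^+ 2 / (Nq q)%:R).
Proof.
move=> zZ; rewrite /Shat; congr (_ * _).
set B := \sum_i (z i == q)%:R * y i q.
have BE : \sum_(i | z i == q) y i q = B.
  by rewrite big_mkcond; apply: eq_bigr => i _; case: (z i == q); rewrite ?mul1r ?mul0r.
have YE := Yhat_centered q zZ; rewrite BE in YE.
transitivity (\sum_(i | z i == q) (y i q ^+ 2 - 2 * ((Nq q)%:R^-1 * B) * y i q + ((Nq q)%:R^-1 * B) ^+ 2)).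
  by apply: eq_bigr => i _; rewrite -YE /y; ring.
rewrite big_split sumrB /= -mulr_sumr BE sumr_const -cardsE (assignments_card q zZ).
rewrite -[_ *+ Nq q]mulr_natl.
have -> : \sum_(i | z i == q) y i q ^+ 2 = \sum_i (z i == q)%:R * y i q ^+ 2.
  by rewrite big_mkcond; apply: eq_bigr => i _; case: (z i == q); rewrite ?mul1r ?mul0r.
by field.
Qed.

(** The sample variance is unbiased under sampling without replacement, given the factor
    [1 / (N - 1)] in [Smat]. Hence [limit_Vhat] below is the exact mean of [Vhat]. *)
Lemma expect_Shat q : E (fun z => Shat Nq Y z q) = Smat Y q q.
Proof.
rewrite (eq_expect (fun z zZ => ShatE q zZ)) expectZ expectB.
have -> : E (fun z => \sum_i (z i == q)%:R * y i q ^+ 2) = (Nq q)%:R / N%:R * ((N%:R - 1) * Smat Y q q).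
  rewrite expect_sum -SmatE mulr_sumr; apply: eq_bigr => i _.
  rewrite (expect1 NqN N_gt0 (fun q' => (q' == q)%:R * y i q ^+ 2)).
  rewrite (bigD1 q) //= eqxx big1 => [|q' /negbTE->]; last by rewrite mul0r mulr0.
  by rewrite /=; ring.
have -> : E (fun z => (\sum_i (z i == q)%:R * y i q) ^+ 2 / (Nq q)%:R) =
   (Nq q)%:R^-1 * ((Nq q)%:R / N%:R * ((N%:R - 1) * Smat Y q q) -
     (Nq q)%:R * ((Nq q)%:R - 1) / (N%:R * (N%:R - 1)) * ((N%:R - 1) * Smat Y q q)).
  pose phi (i : 'I_N) (q' : 'I_Q) : R := (q' == q)%:R * y i q.
  have phiE q1 q2 : \sum_i phi i q1 * phi i q2 = (q1 == q)%:R * (q2 == q)%:R * ((N%:R - 1) * Smat Y q q).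
    by rewrite -SmatE mulr_sumr; apply: eq_bigr => i _; rewrite /phi; ring.
  rewrite (eq_expect (g := fun z => (Nq q)%:R^-1 * ((\sum_i phi i (z i)) * (\sum_i phi i (z i))))); last first.
    by move=> z _; rewrite expr2 mulrC.
  rewrite expectZ (expect_mul_centered NqN N_gt0) => [|q']; last first.
    by rewrite -mulr_sumr sum_centered_outcome mulr0.
  congr (_ * (_ - _)).
    rewrite (bigD1 q) //= phiE eqxx big1 => [|q' /negbTE q'q]; last by rewrite phiE q'q /=; ring.
    by rewrite /=; ring.
  rewrite (bigD1 q) //= (bigD1 q) //= phiE !eqxx big1 => [|q' /negbTE q'q]; last by rewrite phiE q'q /=; ring.
  rewrite big1 => [|q' /negbTE q'q]; last first.
    by apply: big1 => q'' _; rewrite phiE q'q /=; ring.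
  by rewrite /=; ring.
by field; rewrite Nq0 Nq1 N0 N1.
Qed.

Definition limit_Vhat : 'M[R]_H := F^T *m diag_mx (\row_q (Smat Y q q / (Nq q)%:R)) *m F.

Lemma sandwich_diag_entry (d : 'rV[R]_Q) h k :
  (F^T *m diag_mx d *m F) h k = \sum_q F q h * F q k * d 0 q.
Proof.
rewrite mxE; apply: eq_bigr => q _; rewrite mul_mx_diag !mxE; ring.
Qed.

Lemma EVhatE : EVhat Nq Y F = limit_Vhat.
Proof.
apply/matrixP => h k; rewrite mxE /limit_Vhat sandwich_diag_entry.
under eq_expect do rewrite /Vhat sandwich_diag_entry.
rewrite expect_sum; apply: eq_bigr => q _.
have rowE (g : 'I_Q -> R) : (\row_q g q) 0 q = g q by rewrite mxE.
rewrite (eq_expect (g := fun z => F q h * F q k / (Nq q)%:R * Shat Nq Y z q)) => [|z _].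
  by rewrite expectZ expect_Shat rowE; ring.
by rewrite rowE; ring.
Qed.

Lemma qform_sandwich_diag (d : 'rV[R]_Q) v :
  qform (F^T *m diag_mx d *m F) v = \sum_q d 0 q * (F *m v) q 0 ^+ 2.
Proof. by rewrite qform_conj qform_diag. Qed.

Lemma qform_Smat_ge0 v : 0 <= qform (Smat Y) v.
Proof.
have -> : qform (Smat Y) v = (N%:R - 1)^-1 * \sum_i (\sum_q y i q * v q 0) ^+ 2.
  rewrite qformE bformE.
  transitivity (\sum_q \sum_q' \sum_i (N%:R - 1)^-1 * ((y i q * v q 0) * (y i q' * v q' 0))).
    apply: eq_bigr => q _; apply: eq_bigr => q' _.
    rewrite -mulr_sumr mxE mulrCA -!mulrA; congr (_ * _).
    by rewrite [_ * v q' 0]mulrC mulrA mulr_sumr; apply: eq_bigr => i _; rewrite /y; ring.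
  rewrite mulr_sumr; under eq_bigr => q _ do rewrite exchange_big /=.
  rewrite exchange_big /=; apply: eq_bigr => i _.
  rewrite expr2 mulr_suml mulr_sumr; apply: eq_bigr => q _.
  by rewrite !mulr_sumr.
apply: mulr_ge0; last by apply: sumr_ge0 => i _; apply: sqr_ge0.
by rewrite invr_ge0 subr_ge0 ler1n.
Qed.

Lemma qform_V_gammahat v :
  qform (V_gammahat Nq Y F) v = qform limit_Vhat v - N%:R^-1 * qform (Smat Y) (F *m v).
Proof.
rewrite /V_gammahat qform_conj /V_Yhat /limit_Vhat qform_conj.
by rewrite /qform mulmxBr mulmxBl -scalemxAr -scalemxAl !mxE.
Qed.

Lemma Smat_sym : (Smat Y)^T = Smat Y.
Proof.
apply/matrixP => q q'; rewrite !mxE; congr (_ * _).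
by apply: eq_bigr => i _; rewrite mulrC.
Qed.

Lemma V_gammahat_sym : (V_gammahat Nq Y F)^T = V_gammahat Nq Y F.
Proof.
rewrite /V_gammahat !trmx_mul trmxK mulmxA /V_Yhat linearB /= linearZ /=.
by rewrite tr_diag_mx Smat_sym.
Qed.

Lemma sandwich_diag_sym (d : 'rV[R]_Q) : (F^T *m diag_mx d *m F)^T = F^T *m diag_mx d *m F.
Proof. by rewrite !trmx_mul trmxK tr_diag_mx mulmxA. Qed.

End DesignMoments.

(** * One design: standardization, bounds on [W_N], concentration of [Vhat] *)

Section DesignBounds.
Variables (R : realType) (clo chi sigF c c' Delta nu Slo : R).
Hypotheses (clo_gt0 : 0 < clo) (clo_chi : clo <= chi) (sigF_ge1 : 1 <= sigF).
Hypotheses (c_gt0 : 0 < c) (c'_gt0 : 0 < c') (Slo_gt0 : 0 < Slo).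
Variables (N Q H : nat) (Nq : 'I_Q -> nat) (Y : 'M[R]_(N, Q)) (F : 'M[R]_(Q, H)).
Hypothesis DC : design_conditions clo chi sigF c c' Delta nu Slo Nq Y F.
Hypothesis N_gt1 : (1 < N)%N.
Hypothesis H_gt0 : (0 < H)%N.
Local Notation E := (@expect R N Q Nq).
Local Notation Z := (assignments N Nq).
Local Notation y := (centered_outcome Y).
Local Notation a0 := (contribution Nq Y F).
Local Notation V := (V_gammahat Nq Y F).
Local Notation L := (limit_Vhat Nq Y F).

Let NqN : (\sum_q Nq q)%N = N. Proof. by have [] := DC. Qed.
Let Nq2 q : (2 <= Nq q)%N. Proof. by have [_ []] := DC. Qed.
Let N_gt0 : (0 < N)%N. Proof. exact: ltnW. Qed.
Let Np : 0 < N%:R :> R. Proof. by rewrite ltr0n. Qed.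
Let Nqp q : 0 < (Nq q)%:R :> R. Proof. by rewrite ltr0n ltnW. Qed.
Let chi_gt0 : 0 < chi. Proof. exact: lt_le_trans clo_chi. Qed.
Let sig0 : 0 < sigF. Proof. exact: lt_le_trans ltr01 sigF_ge1. Qed.

Lemma Q_gt0 : (0 < Q)%N.
Proof.
rewrite lt0n; apply: contraTneq N_gt0 => Q0; rewrite -leqNgt -NqN big1 // => q _.
by move: (ltn_ord q); rewrite [X in (_ < X)%N]Q0.
Qed.
Let Qp : 0 < Q%:R :> R. Proof. by rewrite ltr0n Q_gt0. Qed.

(** [N_q] and [N / Q] agree up to the factor [chi / clo]. Together with [|F q h| <= c / Q] this
    makes each weight [|F q h| / N_q] of order at most [1 / N], free of [Q]. *)
Lemma group_size_bounds q :
  clo * N%:R <= chi * (Q%:R * (Nq q)%:R) /\ clo * (Q%:R * (Nq q)%:R) <= chi * N%:R.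
Proof.
have [_ [_ [[n0 [cq [n0p Hq]]] _]]] := DC.
have NE : N%:R = \sum_q (Nq q)%:R :> R by rewrite -NqN natr_sum.
have QS (x : R) : Q%:R * x = \sum_(q < Q) x by rewrite sumr_const card_ord mulr_natl.
have up : N%:R <= Q%:R * (chi * n0%:R).
  rewrite NE QS; apply: ler_sum => i _.
  by have [-> /andP[_ ?]] := Hq i; rewrite ler_wpM2r.
have lo : Q%:R * (clo * n0%:R) <= N%:R.
  rewrite NE QS; apply: ler_sum => i _.
  by have [-> /andP[? _]] := Hq i; rewrite ler_wpM2r.
have [e /andP[a b]] := Hq q.
have l1 : clo * n0%:R <= (Nq q)%:R by rewrite e ler_wpM2r.
have l2 : (Nq q)%:R <= chi * n0%:R by rewrite e ler_wpM2r.
split.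
- apply: (le_trans (ler_wpM2l (ltW clo_gt0) up)).
  have -> : clo * (Q%:R * (chi * n0%:R)) = chi * (Q%:R * (clo * n0%:R)) by ring.
  by rewrite ler_wpM2l ?(ltW chi_gt0) // ler_wpM2l ?(ltW Qp).
- apply: (le_trans _ (ler_wpM2l (ltW chi_gt0) lo)).
  have -> : chi * (Q%:R * (clo * n0%:R)) = clo * (Q%:R * (chi * n0%:R)) by ring.
  by rewrite ler_wpM2l ?(ltW clo_gt0) // ler_wpM2l ?(ltW Qp).
Qed.

Lemma weight_bound q h : `|F q h| / (Nq q)%:R <= c * chi / clo / N%:R.
Proof.
have [_ [_ [_ [_ [_ [[Fb _] _]]]]]] := DC.
have [l _] := group_size_bounds q.
apply: (@le_trans _ _ (c / Q%:R / (Nq q)%:R)); first by rewrite ler_wpM2r ?invr_ge0.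
rewrite -!mulrA ler_wpM2l ?(ltW c_gt0) //.
rewrite -invfM -[X in _ <= _ * X]invfM -[X in X <= _]mul1r ler_pdivrMr ?mulr_gt0 //.
by rewrite mulrAC ler_pdivlMr ?mulr_gt0 // mul1r.
Qed.

Let A1 : R := c * chi / clo.
Let A1p : 0 < A1. Proof. by rewrite divr_gt0 // mulr_gt0. Qed.
Lemma outcome_bound i q : `|y i q| <= nu.
Proof. by have [_ [_ [_ [_ [_ [_ [_ + _]]]]]]] := DC; apply. Qed.

Lemma nu_ge0 : 0 <= nu.
Proof. exact: le_trans (normr_ge0 _) (outcome_bound (Ordinal N_gt0) (Ordinal Q_gt0)). Qed.

Lemma contribution_bound i q : sqnorm (a0 i q) <= H%:R * (A1 * nu / N%:R) ^+ 2.
Proof.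
have HS (x : R) : H%:R * x = \sum_(h < H) x by rewrite sumr_const card_ord mulr_natl.
rewrite /sqnorm HS; apply: ler_sum => h _.
rewrite mxE -real_normK ?num_real //; apply: lerXn2r; rewrite ?nnegrE ?normr_ge0 //.
  by apply: divr_ge0 => //; apply: mulr_ge0; [exact: ltW|exact: nu_ge0].
rewrite !normrM normfV (ger0_norm (ltW (Nqp q))) mulrAC.
have -> : A1 * nu / N%:R = (A1 / N%:R) * nu by rewrite mulrAC.
rewrite mulrAC; apply: ler_pM => //; rewrite ?divr_ge0 ?(ltW (Nqp q)) //.
- exact: weight_bound.
- exact: outcome_bound.
Qed.

Let lam : R := Slo * clo * c' / chi.
Let lamp : 0 < lam. Proof. by rewrite divr_gt0 ?mulr_gt0. Qed.

(** The powers of [Q] cancel: [F^T F] is at least [c' / Q], and the diagonal entries [S(q,q) / N_q]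
    are at least of order [Q / N]. *)
Lemma limit_Vhat_lower v : lam / N%:R * sqnorm v <= qform L v.
Proof.
have [_ [_ [_ [_ [_ [[_ eig] [_ _ Sl]]]]]]] := DC.
have Fv : c' / Q%:R * sqnorm v <= sqnorm (F *m v).
  have -> : sqnorm (F *m v) = qform (F^T *m F) v by rewrite -qform1 -qform_conj mulmx1.
  by apply: qform_ge_eigenvalue eig; rewrite trmx_mul trmxK.
rewrite qform_sandwich_diag.
have -> : lam / N%:R * sqnorm v = (Slo * clo * Q%:R / (chi * N%:R)) * (c' / Q%:R * sqnorm v).
  by rewrite /lam; field; rewrite !gt_eqF.
have w0 : 0 <= Slo * clo * Q%:R / (chi * N%:R).
  by rewrite divr_ge0 // ?mulr_ge0 // ltW.
apply: (le_trans (ler_wpM2l w0 Fv)); rewrite /sqnorm mulr_sumr; apply: ler_sum => q _.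
rewrite ler_wpM2r ?sqr_ge0 //.
have -> : (\row_q0 (Smat Y q0 q0 / (Nq q0)%:R)) 0 q = Smat Y q q / (Nq q)%:R.
  by rewrite [LHS]mxE.
have [_ l] := group_size_bounds q.
apply: (@le_trans _ _ (Slo / (Nq q)%:R)); last by rewrite ler_wpM2r ?invr_ge0.
rewrite -!mulrA ler_wpM2l ?(ltW Slo_gt0) // mulrA ler_pdivrMr ?mulr_gt0 //.
by rewrite [X in _ <= X]mulrC ler_pdivlMr // -mulrA.
Qed.

Lemma V_le_limit v : qform V v <= qform L v.
Proof.
rewrite qform_V_gammahat gerBl mulr_ge0 ?invr_ge0 //; exact: qform_Smat_ge0.
Qed.

Lemma limit_le_V v : qform L v <= sigF ^+ 2 * qform V v.
Proof.
have [_ [_ [_ [_ [+ _]]]]] := DC; move/(_ v) => le.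
apply: (le_trans le); rewrite /qform -scalemxAr -scalemxAl mxE //.
Qed.

Let lamN (v : 'cV[R]_H) : 0 <= lam / N%:R * sqnorm v.
Proof. by rewrite mulr_ge0 ?sqnorm_ge0 // divr_ge0 // ltW. Qed.

Lemma limit_psd : is_psd L.
Proof.
split=> [|v]; first exact: sandwich_diag_sym.
exact: le_trans (lamN v) (limit_Vhat_lower v).
Qed.

Lemma V_psd : is_psd V.
Proof.
split=> [|v]; first exact: V_gammahat_sym.
have s2 : 0 < sigF ^+ 2 by rewrite exprn_gt0.
rewrite -(pmulr_rge0 _ s2); apply: le_trans (limit_le_V v).
exact: limit_psd.2.
Qed.

Lemma V_unit : V \in unitmx. Proof. by have [_ [_ [_ []]]] := DC. Qed.

Lemma limit_unit : L \in unitmx.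
Proof.
apply: (@psd_unitmx _ _ _ (lam / N%:R)) => [|v]; first by rewrite divr_gt0.
exact: limit_Vhat_lower.
Qed.

Let Rm := sqrtmx V.
Let Rm_psd : is_psd Rm. Proof. by have [] := sqrtmxP V_psd. Qed.
Let Rm2 : Rm *m Rm = V. Proof. by have [] := sqrtmxP V_psd. Qed.
Let Rm_unit : Rm \in unitmx.
Proof. by have := V_unit; rewrite -Rm2 unitmx_mul => /andP[]. Qed.

Definition std_contribution i q : 'cV[R]_H := invmx (sqrtmx V) *m a0 i q.
Local Notation a := std_contribution.
Local Notation U := (assignment_sum a).

(** Read off from [16 |a|^2 <= 16 sigF^2 (A1 nu)^2 H / (lam N)]; the following [design_e] then
    satisfies [N e^2 = kappa H]. *)
Definition design_kappa : R := 1 + 16 * (A1 * nu) ^+ 2 * sigF ^+ 2 / lam.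
Definition design_e : R := Num.sqrt (design_kappa * H%:R / N%:R).

Let kap0 : 0 <= 16 * (A1 * nu) ^+ 2 * sigF ^+ 2 / lam.
Proof. by rewrite divr_ge0 ?(ltW lamp) // mulr_ge0 ?sqr_ge0 // mulr_ge0 ?sqr_ge0. Qed.

Lemma design_kappa_ge1 : 1 <= design_kappa. Proof. by rewrite lerDl. Qed.

Lemma assignment_sumE z : assignment_sum a0 z = Rm *m U z.
Proof.
rewrite /assignment_sum mulmx_sumr; apply: eq_bigr => i _.
by rewrite mulmxA mulmxV // mul1mx.
Qed.

Lemma UE z : U z = invmx Rm *m assignment_sum a0 z.
Proof. by rewrite assignment_sumE mulmxA mulVmx // mul1mx. Qed.

Theorem design_standardized : standardized_array Nq a design_e design_kappa.
Proof.
have khN : 0 <= design_kappa * H%:R / N%:R.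
  by rewrite divr_ge0 // mulr_ge0 // (le_trans ler01) // design_kappa_ge1.
split.
- by split.
- move=> q; rewrite -mulmx_sumr sum_contribution ?mulmx0 //.
- split=> [|i q]; first exact: sqrtr_ge0.
  rewrite sqr_sqrtr //.
  (* [|a0|^2 = a^T V a], and [lam / N <= L <= sigF^2 V] converts the bound on [a0] into one on
     [a]. *)
  have Va : sqnorm (a0 i q) = qform V (a i q).
    have -> : a0 i q = Rm *m a i q by rewrite mulmxA mulmxV // mul1mx.
    by rewrite -bform1 bform_mulmxl bform_mulmxr mulmx1 Rm_psd.1 Rm2.
  have le1 : lam / N%:R * sqnorm (a i q) <= sigF ^+ 2 * (H%:R * (A1 * nu / N%:R) ^+ 2).
    apply: (le_trans (limit_Vhat_lower _)); apply: (le_trans (limit_le_V _)).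
    by rewrite -Va ler_wpM2l ?sqr_ge0 // contribution_bound.
  have -> : 16 * sqnorm (a i q) = (16 * N%:R / lam) * (lam / N%:R * sqnorm (a i q)).
    by field; rewrite !gt_eqF.
  have w0 : 0 <= 16 * N%:R / lam by apply: divr_ge0; [exact: mulr_ge0|exact: ltW].
  apply: (le_trans (ler_wpM2l w0 le1)).
  have -> : 16 * N%:R / lam * (sigF ^+ 2 * (H%:R * (A1 * nu / N%:R) ^+ 2)) =
     (16 * (A1 * nu) ^+ 2 * sigF ^+ 2 / lam) * H%:R / N%:R by field; rewrite !gt_eqF.
  by rewrite ler_wpM2r ?invr_ge0 // ler_wpM2r // lerDr.
- move=> h k.
  have inv_sym : (invmx Rm)^T = invmx Rm by apply: invmx_sym; exact: Rm_psd.1.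
  transitivity ((invmx Rm *m V *m invmx Rm) h k); last first.
    by rewrite -Rm2 !mulmxA mulVmx // mul1mx mulmxV // mxE.
  transitivity (\sum_j \sum_i invmx Rm h i * V i j * invmx Rm j k).
    rewrite exchange_big /= (eq_expect (g := fun z => \sum_i \sum_j invmx Rm h i * invmx Rm j k *
       (assignment_sum a0 z i 0 * assignment_sum a0 z j 0))); last first.
      move=> z _; rewrite UE !mxE mulr_suml; apply: eq_bigr => i _.
      by rewrite mulr_sumr; apply: eq_bigr => j _; rewrite -[in invmx Rm k j]inv_sym [(_^T) k j]mxE; ring.
    rewrite expect_sum; apply: eq_bigr => i _; rewrite expect_sum; apply: eq_bigr => j _.
    by rewrite expectZ expect_contribution //; ring.
  by rewrite mxE; apply: eq_bigr => j _; rewrite mxE mulr_suml.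
- split; first exact: design_kappa_ge1.
  by rewrite sqr_sqrtr // mulrC divfK // gt_eqF.
Qed.

Local Notation W := (W_N Nq Y F).

Lemma W_NE : W = Rm *m invmx L *m Rm.
Proof. by rewrite /W_N EVhatE. Qed.

Lemma qform_W v : qform W v = qform (invmx L) (Rm *m v).
Proof. by rewrite W_NE -{1}Rm_psd.1 qform_conj. Qed.

Lemma qform_inv_V v : qform (invmx V) (Rm *m v) = sqnorm v.
Proof.
rewrite -{1}Rm_psd.1 -[Rm^T]mul1mx.
have -> : invmx V = invmx Rm *m invmx Rm.
  by rewrite -(mulKmx V_unit (invmx Rm *m invmx Rm)) -Rm2 -mulmxA (mulKVmx Rm_unit) mulmxV // mulmx1.
rewrite mul1mx Rm_psd.1 -bform1 qformE -bform_mulmxr bform_mulmxl.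
have -> : invmx Rm *m (Rm *m v) = v by rewrite mulmxA mulVmx // mul1mx.
by rewrite Rm_psd.1 mulmxV.
Qed.

Lemma W_contraction : psd_contraction W.
Proof.
split; first split.
- by rewrite W_NE !trmx_mul Rm_psd.1 (invmx_sym limit_psd.1) mulmxA.
- by move=> v; rewrite qform_W; apply: (psd_inv limit_psd).2.
move=> v; rewrite qform_W -qform_inv_V -[X in _ <= X]mul1r.
apply: psd_inv_le; rewrite ?V_unit ?limit_unit //; [exact: V_psd|exact: limit_psd|].
by move=> w; rewrite mul1r V_le_limit.
Qed.

Lemma W_lower v : (sigF ^+ 2)^-1 * sqnorm v <= qform W v.
Proof.
rewrite ler_pdivrMl ?exprn_gt0 // qform_W -qform_inv_V.
apply: psd_inv_le; rewrite ?V_unit ?limit_unit ?sqr_ge0 //; [exact: limit_psd|exact: V_psd|].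
exact: limit_le_V.
Qed.

(** A diagonal entry of [W^2] is the squared norm of a column of [W], hence at least the square of
    the diagonal entry of [W], which [W_lower] bounds below. *)
Lemma W_trace_sqr : (sigF ^+ 4)^-1 * H%:R <= \tr (W *m W).
Proof.
rewrite mulrC mulr_natl -[X in _ *+ X]card_ord -sumr_const; apply: ler_sum => h _.
have cW := W_contraction.
have -> : (W *m W) h h = sqnorm (W *m delta_mx h 0).
  rewrite -qform_delta -bform1 bform_mulmxl bform_mulmxr mulmx1.
  by rewrite cW.1.1.
have W1 : (sigF ^+ 2)^-1 <= W h h.
  by have := W_lower (delta_mx h 0); rewrite sqnorm_delta mulr1 qform_delta.
have -> : (sigF ^+ 4)^-1 = ((sigF ^+ 2)^-1) ^+ 2 by rewrite exprVn -exprM.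
apply: (@le_trans _ _ (W h h ^+ 2)).
  by apply: lerXn2r => //; rewrite nnegrE ?invr_ge0 ?sqr_ge0 // (le_trans _ W1) // invr_ge0 sqr_ge0.
have -> : W h h = (W *m (delta_mx h 0 : 'cV[R]_H)) h 0 by rewrite -colE [RHS]mxE.
exact: sqr_entry_le.
Qed.

Lemma swap_indicator_sum (z : {ffun 'I_N -> 'I_Q}) b d q (g : 'I_N -> R) :
  \sum_i (swap z b d i == q)%:R * g i - \sum_i (z i == q)%:R * g i =
  ((z d == q)%:R - (z b == q)%:R) * (g b - g d).
Proof.
have [->|bd] := eqVneq b d; first by rewrite swap_id !subrr mulr0.
rewrite (bigD1 b) //= [X in _ - X](bigD1 b) //= (bigD1 d) 1?eq_sym //=.
rewrite [X in _ - (_ + X)](bigD1 d) 1?eq_sym //= !ffunE tpermL tpermR.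
rewrite (eq_bigr (fun i => (z i == q)%:R * g i)) => [|i /andP[ib id]]; last first.
  by rewrite ffunE tpermD // eq_sym.
ring.
Qed.

(** For each swapped unit in group [q] the first term of the bracket in [ShatE] moves by at most
    [nu^2] and the second by at most [4 nu^2]; [1 / (N_q - 1) <= 2 / N_q], valid from [N_q = 2] on,
    doubles 5 to 10. *)
Lemma Shat_swap z b d q : z \in Z ->
  `|Shat Nq Y (swap z b d) q - Shat Nq Y z q| <=
  10 * nu ^+ 2 / (Nq q)%:R * ((z b == q)%:R + (z d == q)%:R).
Proof.
move=> zZ; have z'Z : swap z b d \in Z by rewrite swap_assignments.
rewrite !ShatE // -mulrBr.
have SA := swap_indicator_sum z b d q (fun i => y i q ^+ 2).
have SB := swap_indicator_sum z b d q (fun i => y i q).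
have Bb z1 : z1 \in Z -> `|\sum_i (z1 i == q)%:R * y i q| <= (Nq q)%:R * nu.
  move=> z1Z; rewrite -(assignments_sum R q z1Z) mulr_suml.
  apply: (le_trans (ler_norm_sum _ _ _)); apply: ler_sum => i _.
  by rewrite normrM normr_nat ler_wpM2l // outcome_bound.
have B1 := Bb z zZ; have B2 := Bb _ z'Z.
move: SA SB B1 B2; set A' := \sum_i (swap z b d i == q)%:R * y i q ^+ 2.
set A := \sum_i (z i == q)%:R * y i q ^+ 2; set B' := \sum_i (swap z b d i == q)%:R * y i q.
set B := \sum_i (z i == q)%:R * y i q => SA SB B1 B2.
set Ib : R := (z b == q)%:R; set Id : R := (z d == q)%:R.
have Ib0 : 0 <= Ib by []. have Id0 : 0 <= Id by [].
have dI : `|Id - Ib| <= Ib + Id.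
  by rewrite ler_norml; apply/andP; split; lra.
have n2 : 2 <= (Nq q)%:R :> R by rewrite ler_nat.
set n : R := (Nq q)%:R in B1 B2 n2 *.
have n0 : 0 < n by lra.
have nu0 := nu_ge0.
have yb i : `|y i q| <= nu := outcome_bound i q.
have y2 i : 0 <= y i q ^+ 2 <= nu ^+ 2.
  by rewrite sqr_ge0 -real_normK ?num_real // lerXn2r // nnegrE.
have dA : `|A' - A| <= (Ib + Id) * nu ^+ 2.
  rewrite SA normrM; apply: ler_pM => //.
  have := (y2 b, y2 d) => -[/andP[? ?] /andP[? ?]].
  by rewrite ler_norml; apply/andP; split; lra.
have dB : `|B' ^+ 2 - B ^+ 2| <= (Ib + Id) * (4 * nu ^+ 2) * n.
  have -> : B' ^+ 2 - B ^+ 2 = (B' - B) * (B' + B) by ring.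
  have -> : (Ib + Id) * (4 * nu ^+ 2) * n = ((Ib + Id) * (2 * nu)) * (2 * (n * nu)) by ring.
  rewrite normrM; apply: ler_pM => //.
    rewrite SB normrM; apply: ler_pM => //.
    by apply: (le_trans (ler_normB _ _)); have := (yb b, yb d) => -[]; lra.
  by apply: (le_trans (ler_normD _ _)); lra.
rewrite normrM (ger0_norm (x := (n - 1)^-1)); last by rewrite invr_ge0; lra.
have inv2 : (n - 1)^-1 <= 2 / n.
  by rewrite ler_pdivlMr // mulrC ler_pdivrMr; lra.
have -> : A' - B' ^+ 2 / n - (A - B ^+ 2 / n) = (A' - A) - (B' ^+ 2 - B ^+ 2) / n by ring.
have core : `|(A' - A) - (B' ^+ 2 - B ^+ 2) / n| <= 5 * nu ^+ 2 * (Ib + Id).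
  apply: (le_trans (ler_normB _ _)); rewrite normrM normfV (gtr0_norm n0).
  have : `|B' ^+ 2 - B ^+ 2| / n <= (Ib + Id) * (4 * nu ^+ 2) by rewrite ler_pdivrMr.
  move: dA; set x := `|A' - A|; lra.
have -> : 10 * nu ^+ 2 / n * (Ib + Id) = (2 / n) * (5 * nu ^+ 2 * (Ib + Id)) by field; rewrite gt_eqF.
by apply: ler_pM => //; rewrite invr_ge0; lra.
Qed.

Let C2 : R := 20 * nu ^+ 2 * A1 ^+ 2.

Lemma Vhat_entry z h k : Vhat Nq Y F z h k = \sum_q F q h * F q k * (Shat Nq Y z q / (Nq q)%:R).
Proof.
by rewrite /Vhat sandwich_diag_entry; apply: eq_bigr => q _; rewrite mxE.
Qed.

(** Each of the two units belongs to a single group, so the sum over [q] contributes the factor 2 in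
    [C2 = 2 * 10 nu^2 A1^2] and no factor [Q]. *)
Lemma Vhat_influence h k : influence_le Nq ((C2 / N%:R ^+ 2) ^+ 2) (fun z => Vhat Nq Y F z h k).
Proof.
move=> b d; rewrite -[X in _ <= X](expect_cst NqN); apply: le_expect => z zZ.
have c20 : 0 <= C2 / N%:R ^+ 2.
  by apply: divr_ge0; rewrite ?sqr_ge0 //; apply: mulr_ge0; rewrite ?sqr_ge0 // mulr_ge0 ?sqr_ge0.
rewrite -real_normK ?num_real //; apply: lerXn2r; rewrite ?nnegrE //.
rewrite !Vhat_entry -sumrB; apply: (le_trans (ler_norm_sum _ _ _)).
apply: (@le_trans _ _ (\sum_q (10 * nu ^+ 2 * A1 ^+ 2 / N%:R ^+ 2) * ((z b == q)%:R + (z d == q)%:R))).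
  apply: ler_sum => q _.
  have -> : F q h * F q k * (Shat Nq Y (swap z b d) q / (Nq q)%:R) - F q h * F q k * (Shat Nq Y z q / (Nq q)%:R)
    = F q h * F q k / (Nq q)%:R * (Shat Nq Y (swap z b d) q - Shat Nq Y z q) by ring.
  rewrite normrM; apply: (le_trans (ler_wpM2l (normr_ge0 _) (Shat_swap b d q zZ))).
  have w1 := weight_bound q h; have w2 := weight_bound q k.
  rewrite !normrM normfV (gtr0_norm (Nqp q)) mulrA ler_wpM2r ?addr_ge0 //.
  have -> : `|F q h| * `|F q k| / (Nq q)%:R * (10 * nu ^+ 2 / (Nq q)%:R) =
    10 * nu ^+ 2 * ((`|F q h| / (Nq q)%:R) * (`|F q k| / (Nq q)%:R)) by ring.
  have -> : 10 * nu ^+ 2 * A1 ^+ 2 / N%:R ^+ 2 = 10 * nu ^+ 2 * ((A1 / N%:R) * (A1 / N%:R)) by field; rewrite gt_eqF.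
  rewrite ler_wpM2l //; first by rewrite mulr_ge0 ?sqr_ge0.
  by apply: ler_pM => //; rewrite divr_ge0 // ltW.
have one i : \sum_q (z i == q)%:R = 1 :> R.
  rewrite (bigD1 (z i)) //= eqxx big1 ?addr0 // => q /negbTE.
  by rewrite eq_sym => ->.
rewrite -mulr_sumr big_split /= !one /C2; have -> : (1 + 1 : R) = 2 by [].
by rewrite le_eqVlt; apply/orP; left; apply/eqP; field; rewrite gt_eqF.
Qed.

Definition Vhat_dev z : R := \sum_h \sum_k (Vhat Nq Y F z h k - L h k) ^+ 2.

Lemma Vhat_dev_ge0 z : 0 <= Vhat_dev z.
Proof. by apply: sumr_ge0 => h _; apply: sumr_ge0 => k _; apply: sqr_ge0. Qed.

Lemma expect_Vhat_dev : E Vhat_dev <= H%:R ^+ 2 * (C2 ^+ 2 / N%:R ^+ 3).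
Proof.
rewrite /Vhat_dev expect_sum.
under eq_bigr => h _ do rewrite expect_sum.
apply: (@le_trans _ _ (\sum_(h < H) \sum_(k < H) C2 ^+ 2 / N%:R ^+ 3)); last first.
  by rewrite !sumr_const card_ord -mulrnA -[_ *+ (H * H)]mulr_natl natrM expr2.
apply: ler_sum => h _; apply: ler_sum => k _.
have := variance_le_influence NqN (sqr_ge0 _) (@Vhat_influence h k).
have -> : E (fun z => Vhat Nq Y F z h k) = L h k.
  by rewrite -EVhatE // [RHS]mxE.
have -> : N%:R * (C2 / N%:R ^+ 2) ^+ 2 = C2 ^+ 2 / N%:R ^+ 3 by field; rewrite gt_eqF.
by [].
Qed.

Lemma qform_frobenius n (B : 'M[R]_n) v :
  qform B v ^+ 2 <= sqnorm v ^+ 2 * \sum_i \sum_j B i j ^+ 2.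
Proof.
rewrite qformE bformE.
have -> : \sum_i \sum_j v i 0 * B i j * v j 0 = \sum_(p : 'I_n * 'I_n) (v p.1 0 * v p.2 0) * B p.1 p.2.
  by rewrite pair_bigA; apply: eq_bigr => p _ /=; ring.
apply: (le_trans (sum_cauchy_schwarz _ _)); rewrite pair_bigA /=.
have -> : \sum_(p : 'I_n * 'I_n) (v p.1 0 * v p.2 0) ^+ 2 = sqnorm v ^+ 2.
  rewrite -(pair_bigA _ (fun i j => (v i 0 * v j 0) ^+ 2)) /= /sqnorm [RHS]expr2 mulr_suml.
  apply: eq_bigr => i _; rewrite mulr_sumr; apply: eq_bigr => j _; ring.
by [].
Qed.

(** The Frobenius distance of [Vhat] from its mean, measured against the lower bound [lam / N] of
    that mean; its mean square is [O(H^2 / N)]. *)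
Definition rel_dev z : R := Num.sqrt (Vhat_dev z) * N%:R / lam.

Lemma rel_dev_ge0 z : 0 <= rel_dev z.
Proof. by apply: divr_ge0; [apply: mulr_ge0 => //; exact: sqrtr_ge0|exact: ltW]. Qed.

Lemma expect_rel_dev_sqr : E (fun z => rel_dev z ^+ 2) <= H%:R ^+ 2 * (C2 / lam) ^+ 2 / N%:R.
Proof.
rewrite (eq_expect (g := fun z => (N%:R / lam) ^+ 2 * Vhat_dev z)) => [|z _]; last first.
  by rewrite /rel_dev !exprMn sqr_sqrtr ?Vhat_dev_ge0 //; ring.
rewrite expectZ; apply: (le_trans (ler_wpM2l (sqr_ge0 _) expect_Vhat_dev)).
by rewrite le_eqVlt; apply/orP; left; apply/eqP; field; rewrite !gt_eqF.
Qed.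

Lemma Vhat_relative z v :
  `|qform (Vhat Nq Y F z) v - qform L v| <= rel_dev z * qform L v.
Proof.
have -> : qform (Vhat Nq Y F z) v - qform L v = qform (Vhat Nq Y F z - L) v.
  by rewrite /qform mulmxBr mulmxBl !mxE.
apply: (@le_trans _ _ (sqnorm v * Num.sqrt (Vhat_dev z))).
  apply: normr_le_sqr; first by rewrite mulr_ge0 ?sqnorm_ge0 ?sqrtr_ge0.
  rewrite exprMn sqr_sqrtr ?Vhat_dev_ge0 //; apply: (le_trans (qform_frobenius _ _)).
  rewrite ler_wpM2l ?sqr_ge0 // le_eqVlt; apply/orP; left; apply/eqP.
  have subE (A B : 'M[R]_H) h k : (A - B) h k = A h k - B h k by rewrite !mxE.
  by apply: eq_bigr => h _; apply: eq_bigr => k _; rewrite subE.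
have -> : sqnorm v * Num.sqrt (Vhat_dev z) = rel_dev z * (lam / N%:R * sqnorm v).
  by rewrite /rel_dev; field; rewrite !gt_eqF.
by rewrite ler_wpM2l ?rel_dev_ge0 // limit_Vhat_lower.
Qed.

(** The sandwich [(1 - eps) L <= Vhat <= (1 + eps) L] passes to the inverses by [psd_inv_le]. The
    bound [eps <= 1/2] makes [Vhat] invertible and gives [1 / (1 - eps) <= 1 + 2 eps]. *)
Lemma That_relative z : z \in Z -> rel_dev z <= 2^-1 ->
  `|That Nq Y F z - qform W (U z)| <= 2 * rel_dev z * qform W (U z).
Proof.
move=> zZ e2; set eps := rel_dev z in e2 *; have e0 : 0 <= eps := rel_dev_ge0 z.
rewrite /That gammahatE // assignment_sumE qform_W.
set b := Rm *m U z; set Vh := Vhat Nq Y F z.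
have up v : qform Vh v <= (1 + eps) * qform L v.
  by have := Vhat_relative z v; rewrite ler_norml -/eps -/Vh => /andP[_]; lra.
have lo v : (1 - eps) * qform L v <= qform Vh v.
  by have := Vhat_relative z v; rewrite ler_norml -/eps -/Vh => /andP[+ _]; lra.
have e1 : 0 < 1 - eps by lra.
have pVh : is_psd Vh.
  split=> [|v]; first exact: sandwich_diag_sym.
  by apply: le_trans (lo v); rewrite mulr_ge0 ?(ltW e1) // limit_psd.2.
have uVh : Vh \in unitmx.
  apply: (@psd_unitmx _ _ _ ((1 - eps) * (lam / N%:R))) => [|v].
    by rewrite mulr_gt0 // divr_gt0.
  by apply: le_trans (lo v); rewrite -mulrA ler_wpM2l ?(ltW e1) // limit_Vhat_lower.
have pL := limit_psd; have uL := limit_unit.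
have T0 : 0 <= qform (invmx L) b := (psd_inv pL).2 b.
have U1 : qform (invmx Vh) b <= (1 - eps)^-1 * qform (invmx L) b.
  apply: psd_inv_le => // [|v]; first by rewrite invr_ge0 ltW.
  by rewrite ler_pdivlMl.
have U2 : qform (invmx L) b <= (1 + eps) * qform (invmx Vh) b.
  by apply: psd_inv_le => //; lra.
have i1 : (1 - eps)^-1 <= 1 + 2 * eps.
  rewrite -[X in X <= _]mul1r ler_pdivrMr //; nra.
have U1' := le_trans U1 (ler_wpM2r T0 i1).
have U2' : (1 - 2 * eps) * qform (invmx L) b <= qform (invmx Vh) b.
  have V0 : 0 <= qform (invmx Vh) b := (psd_inv pVh).2 b.
  by have := mulr_ge0 e0 V0; have := mulr_ge0 e0 T0; nra.
by rewrite ler_norml; apply/andP; split; lra.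
Qed.

Lemma That_ge0 z : 0 <= That Nq Y F z.
Proof.
apply: (psd_inv _).2; split=> [|v]; first exact: sandwich_diag_sym.
rewrite qform_sandwich_diag; apply: sumr_ge0 => q _; rewrite mulr_ge0 ?sqr_ge0 //.
rewrite mxE divr_ge0 // mulr_ge0 //.
  by rewrite invr_ge0 subr_ge0 ler1n ltnW.
by apply: sumr_ge0 => i _; apply: sqr_ge0.
Qed.

Definition design_C : R := 4 * (C2 / lam) ^+ 2 + 8 * (C2 / lam) * design_kappa.

Theorem That_approx t : 0 < t ->
  E (fun z => (t < `|That Nq Y F z - qform W (U z)|)%R%:R) <=
  design_C * (1 + t^-1) * (H%:R ^+ 2 * (Num.sqrt N%:R)^-1).
Proof.
move=> t0.
have [_ ac [e0 ea] iso [k1 Ne]] := design_standardized.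
set D := C2 / lam; set r := (Num.sqrt N%:R)^-1; set k := design_kappa.
have D0 : 0 <= D.
  by apply: divr_ge0; rewrite ?(ltW lamp) //; apply: mulr_ge0; rewrite ?sqr_ge0 // mulr_ge0 ?sqr_ge0.
have r0 : 0 < r by rewrite invr_gt0 sqrtr_gt0.
have r2 : r ^+ 2 = N%:R^-1 by rewrite exprVn sqr_sqrtr // ltW.
have r1 : r <= 1.
  have : r ^+ 2 <= 1 ^+ 2 by rewrite r2 expr1n invf_le1 // ler1n.
  by rewrite ler_pXn2r // nnegrE ?ltW.
have h1 : 1 <= H%:R :> R by rewrite ler1n.
have k0 : 0 <= k := le_trans ler01 k1.
(* Either [rel_dev > 1/2], paid for by [4 rel_dev^2 >= 1], or [That_relative] applies and the second
   term dominates the indicator as in Markov's inequality. *)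
apply: (@le_trans _ _ (E (fun z => 4 * rel_dev z ^+ 2 + 2 / t * (rel_dev z * sqnorm (U z))))).
  apply: le_expect => z zZ.
  have d0 := rel_dev_ge0 z; have s0 := sqnorm_ge0 (U z).
  have R0 : 0 <= 2 / t * (rel_dev z * sqnorm (U z)) by rewrite mulr_ge0 ?mulr_ge0 // invr_ge0 ltW.
  have [e2|e2] := leP (rel_dev z) 2^-1; last first.
    apply: (@le_trans _ _ 1); first by case: (_ < _)%R.
    have : (2^-1) ^+ 2 <= rel_dev z ^+ 2 :> R by apply: lerXn2r; rewrite ?nnegrE // ltW.
    by lra.
  case: ltP => [tl|_]; last by rewrite addr_ge0 // mulr_ge0 ?sqr_ge0.
  have := lt_le_trans tl (That_relative zZ e2).
  have TW : qform W (U z) <= sqnorm (U z) by apply: W_contraction.2.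
  have := ler_wpM2l d0 TW; set x := rel_dev z * _; set w := rel_dev z * sqnorm _ in R0 *.
  rewrite -mulrA -/x => xw tx.
  have : 1 <= 2 / t * w.
    rewrite mulrAC ler_pdivlMr // mul1r; apply: ltW; apply: (lt_le_trans tx).
    by rewrite ler_wpM2l.
  by move=> w1; rewrite /= -[X in X <= _]add0r lerD // mulr_ge0 ?sqr_ge0.
rewrite expectD !expectZ.
have ed := expect_rel_dev_sqr; rewrite -/D -r2 in ed.
have es : E (fun z => sqnorm (U z) ^+ 2) <= 11 * k ^+ 2 * H%:R ^+ 2.
  exact: (expect_sqnorm_sqr_le NqN N_gt0 e0 ea iso k1 Ne).
have hr0 : 0 <= H%:R ^+ 2 * r by rewrite mulr_ge0 ?sqr_ge0 // ltW.
have Dk0 n : 0 <= n%:R * D * k by apply: mulr_ge0 => //; apply: mulr_ge0.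
have ex : E (fun z => rel_dev z * sqnorm (U z)) <= 4 * D * k * (H%:R ^+ 2 * r).
  apply: le_trans (ler_norm _) _; apply: normr_le_sqr.
    exact: (mulr_ge0 (Dk0 4%N)).
  apply: (le_trans (expect_cauchy_schwarz _ _ _)).
  apply: (@le_trans _ _ ((H%:R ^+ 2 * D ^+ 2 * r ^+ 2) * (11 * k ^+ 2 * H%:R ^+ 2))).
    by apply: ler_pM => //; apply: expect_ge0 => z _; apply: sqr_ge0.
  have -> : (H%:R ^+ 2 * D ^+ 2 * r ^+ 2) * (11 * k ^+ 2 * H%:R ^+ 2) =
     11 * (D * k * (H%:R ^+ 2 * r)) ^+ 2 by ring.
  have -> : (4 * D * k * (H%:R ^+ 2 * r)) ^+ 2 = 16 * (D * k * (H%:R ^+ 2 * r)) ^+ 2 by ring.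
  by rewrite ler_wpM2r ?sqr_ge0 // ler_nat.
have ed2 : 4 * E (fun z => rel_dev z ^+ 2) <= 4 * D ^+ 2 * (H%:R ^+ 2 * r).
  have -> : 4 * D ^+ 2 * (H%:R ^+ 2 * r) = 4 * (H%:R ^+ 2 * D ^+ 2 * r) by ring.
  rewrite ler_wpM2l //; apply: (le_trans ed).
  by apply: ler_wpM2l; [apply: mulr_ge0; exact: sqr_ge0|rewrite expr2 ler_piMl // ltW].
have ex2 : 2 / t * E (fun z => rel_dev z * sqnorm (U z)) <= 8 * D * k * t^-1 * (H%:R ^+ 2 * r).
  have -> : 8 * D * k * t^-1 * (H%:R ^+ 2 * r) = 2 / t * (4 * D * k * (H%:R ^+ 2 * r)) by ring.
  by rewrite ler_wpM2l // divr_ge0 // ltW.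
apply: (le_trans (lerD ed2 ex2)).
rewrite -mulrDl ler_wpM2r //.
have -> : design_C * (1 + t^-1) = 4 * D ^+ 2 + 8 * D * k + (4 * D ^+ 2 * t^-1 + 8 * D * k * t^-1).
  by rewrite /design_C -/D -/k; ring.
have ti : 0 <= t^-1 by rewrite invr_ge0 ltW.
have := mulr_ge0 (mulr_ge0 (ler0n R 4) (sqr_ge0 D)) ti.
have := Dk0 8%N.
by lra.
Qed.

End DesignBounds.

(** * Gaussian expectations *)

Section GaussianIntegral.
Variable R : realType.
Local Notation phi := (@normal_pdf R 0 1).
Local Notation mu := (@lebesgue_measure R).
Implicit Types (k : R -> R) (c K : R).

Definition gint (k : R -> R) : R := Rintegral mu setT (fun t : R => phi t * k t).
Definition gintegrable (k : R -> R) := mu.-integrable setT (EFin \o (fun t => phi t * k t)).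

Lemma measurable_phi : measurable_fun setT phi.
Proof. exact: measurable_normal_pdf. Qed.

Lemma gintegrable_bounded k K : measurable_fun setT k -> (forall t, `|k t| <= K) -> gintegrable k.
Proof.
move=> mk kK.
apply: (@le_integrable _ _ _ mu setT measurableT _ (fun t => (K * phi t)%:E)).
- by apply/measurable_EFinP; apply: measurable_funM => //; exact: measurable_phi.
- move=> t _ /=; rewrite lee_fin !normrM mulrC; apply: ler_pM => //.
  exact: le_trans (kK t) (ler_norm _).
- have := integrableZl measurableT K (integrable_normal_pdf 0 1).
  by under eq_fun do rewrite -EFinM.
Qed.

Lemma gintegrable_cst c : gintegrable (fun=> c).
Proof. exact: (@gintegrable_bounded _ `|c|). Qed.

Lemma gintegrableD (k k' : R -> R) : gintegrable k -> gintegrable k' -> gintegrable (fun t => k t + k' t).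
Proof.
move=> ik ik'; have := integrableD measurableT ik ik'.
by congr (mu.-integrable _ _); apply/funext => t; rewrite /= -EFinD mulrDr.
Qed.

Lemma gintD (k k' : R -> R) : gintegrable k -> gintegrable k' ->
  gint (fun t => k t + k' t) = gint k + gint k'.
Proof.
move=> ik ik'; rewrite /gint -RintegralD //; apply: eq_Rintegral => t _.
by rewrite mulrDr.
Qed.

Lemma gintZ c k : gintegrable k -> gint (fun t => c * k t) = c * gint k.
Proof.
move=> ik; rewrite /gint -RintegralZl //; apply: eq_Rintegral => t _.
by rewrite mulrCA.
Qed.

Lemma gint_cst c : gint (fun=> c) = c.
Proof.
have -> : gint (fun=> c) = c * gint (fun=> 1).
  by rewrite -gintZ ?mulr1 //; exact: gintegrable_cst.
rewrite /gint /Rintegral; under eq_integral do rewrite mulr1.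
by rewrite integral_normal_pdf mulr1.
Qed.

Lemma le_gint (k k' : R -> R) : gintegrable k -> gintegrable k' -> (forall t, k t <= k' t) -> gint k <= gint k'.
Proof.
move=> ik ik' kk'; apply: le_Rintegral => // t _.
by rewrite ler_wpM2l ?normal_pdf_ge0.
Qed.

Lemma gint_ge0 k : (forall t, 0 <= k t) -> 0 <= gint k.
Proof. by move=> k0; apply: Rintegral_ge0 => t _; rewrite mulr_ge0 ?normal_pdf_ge0. Qed.

Lemma gint_abs_le k K : gintegrable k -> (forall t, `|k t| <= K) -> `|gint k| <= K.
Proof.
move=> ik kK; rewrite ler_norml -[X in X <= _](gint_cst (- K)) -[X in _ && (_ <= X)](gint_cst K).
by apply/andP; split; apply: le_gint => //; try exact: gintegrable_cst;
  move=> t; have := kK t; rewrite ler_norml => /andP[].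
Qed.

(** Adding [K] makes the integrand nonnegative, as Tonelli's theorem requires for measurability of a
    partial integral; the shift integrates to [K] and is subtracted again. *)
Lemma measurable_gint_param d (T : measurableType d) (h : T * measurableTypeR R -> R) K :
  measurable_fun setT h -> (forall p, `|h p| <= K) ->
  measurable_fun setT (fun x => gint (fun t => h (x, t))).
Proof.
move=> mh hK.
have mhx x : measurable_fun setT (fun t => h (x, t)).
  by apply: measurableT_comp => //; exact: pair1_measurable.
have -> : (fun x => gint (fun t => h (x, t))) =
   (fun x => fine (\int[mu]_t (phi t * (h (x, t) + K))%:E)%E - K).
  apply/funext => x.
  have -> : fine (\int[mu]_t (phi t * (h (x, t) + K))%:E)%E = gint (fun t => h (x, t) + K) by [].
  rewrite gintD; [|exact: gintegrable_bounded (mhx x) (fun t => hK (x, t))|exact: gintegrable_cst].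
  by rewrite gint_cst addrK.
apply: measurable_funB => //; apply: measurableT_comp => //=.
apply: (@measurable_fun_fubini_tonelli_F _ _ T (measurableTypeR R) R mu
   (fun p : T * measurableTypeR R => (phi p.2 * (h p + K))%:E)).
- apply/measurable_EFinP; apply: measurable_funM => //.
    by apply: measurableT_comp => //; exact: measurable_phi.
  exact: measurable_funD.
- move=> p; rewrite lee_fin mulr_ge0 ?normal_pdf_ge0 //.
  by have := hK p; rewrite ler_norml => /andP[]; lra.
Qed.

(* Measurability of [g t : 'rV_n -> R] jointly in the parameter [t] and in the coordinates,
   peeled off in the order in which [gaussE] integrates them. *)
Fixpoint gmeas (n : nat) : forall d (T : measurableType d), (T -> 'rV[R]_n -> R) -> Prop :=
  match n with
  | 0 => fun d T g => measurable_fun setT (fun t : T => g t 0)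
  | n'.+1 => fun d T g => @gmeas n' _ (T * measurableTypeR R)%type
      (fun p v => g p.1 (row_mx (p.2%:M : 'rV[R]_1) v))
  end.

Lemma gmeas_param n d (T : measurableType d) (f : T -> R) :
  measurable_fun setT f -> @gmeas n d T (fun t _ => f t).
Proof.
elim: n d T f => [|n IH] d T f mf //=.
by apply: (IH _ _ (fun p => f p.1)); apply: measurableT_comp.
Qed.

Lemma gmeas_comp n d (T : measurableType d) g (psi : R -> R) :
  measurable_fun setT psi -> @gmeas n d T g -> @gmeas n d T (fun t v => psi (g t v)).
Proof.
move=> mp; elim: n d T g => [|n IH] d T g mg /=; first exact: measurableT_comp mg.
exact: IH _ _ _ mg.
Qed.

Lemma gmeasD n d (T : measurableType d) g1 g2 :
  @gmeas n d T g1 -> @gmeas n d T g2 -> @gmeas n d T (fun t v => g1 t v + g2 t v).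
Proof.
elim: n d T g1 g2 => [|n IH] d T g1 g2 m1 m2 /=; first exact: measurable_funD.
exact: IH _ _ _ _ m1 m2.
Qed.

Lemma gmeasM n d (T : measurableType d) g1 g2 :
  @gmeas n d T g1 -> @gmeas n d T g2 -> @gmeas n d T (fun t v => g1 t v * g2 t v).
Proof.
elim: n d T g1 g2 => [|n IH] d T g1 g2 m1 m2 /=; first exact: measurable_funM.
exact: IH _ _ _ _ m1 m2.
Qed.

Lemma gmeas_coord n d (T : measurableType d) (i : 'I_n) : @gmeas n d T (fun _ v => v 0 i).
Proof.
elim: n d T i => [|n IH] d T i /=; first by case: i.
case: (split_ordP (i : 'I_(1 + n))) => j ->.
  have -> : (fun (p : T * measurableTypeR R) (v : 'rV[R]_n) =>
      row_mx (p.2%:M : 'rV[R]_1) v 0 (lshift n j)) = (fun p _ => p.2).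
    by apply/funext => p; apply/funext => v; rewrite row_mxEl ord1 mxE eqxx.
  exact: gmeas_param.
have -> : (fun (p : T * measurableTypeR R) (v : 'rV[R]_n) =>
    row_mx (p.2%:M : 'rV[R]_1) v 0 (rshift 1 j)) = (fun _ v => v 0 j).
  by apply/funext => p; apply/funext => v; rewrite row_mxEr.
exact: IH.
Qed.

Lemma gmeas_reparam n d (T : measurableType d) d' (T' : measurableType d') (p : T' -> T) g :
  measurable_fun setT p -> @gmeas n d T g -> @gmeas n d' T' (fun t v => g (p t) v).
Proof.
elim: n d T d' T' p g => [|n IH] d T d' T' p g mp mg /=; first exact: measurableT_comp mg mp.
apply: (IH _ _ _ _ (fun q : T' * measurableTypeR R => (p q.1, q.2)) _ _ mg).
by apply: measurable_fun_pair => //; apply: measurableT_comp.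
Qed.

(** Measurability and the bound are proved together, since the next integral needs both for its
    integrability. The parameter space gains one real coordinate per step. *)
Lemma gaussE_param n d (T : measurableType d) (g : T -> 'rV[R]_n -> R) K :
  gmeas g -> (forall t v, `|g t v| <= K) ->
  measurable_fun setT (fun t => gaussE (g t)) /\ forall t, `|gaussE (g t)| <= K.
Proof.
elim: n d T g => [|n IH] d T g mg gK //=.
have [mG GK] := IH _ _ _ mg (fun p v => gK p.1 _).
split; first exact: measurable_gint_param mG GK.
move=> t; apply: gint_abs_le => [|s]; last exact: (GK (t, s)).
apply: gintegrable_bounded (fun s => GK (t, s)).
by apply: measurableT_comp mG _; apply: pair1_measurable.
Qed.

Definition gmeasurable n (G : 'rV[R]_n -> R) := @gmeas n _ unit (fun=> G).

Lemma gmeasurable_slice n (G : 'rV[R]_n.+1 -> R) : gmeasurable G ->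
  @gmeas n _ (measurableTypeR R) (fun s v => G (row_mx (s%:M : 'rV[R]_1) v)).
Proof.
move=> mG; apply: (gmeas_reparam (p := fun s : measurableTypeR R => (tt, s)) _ mG).
exact: pair1_measurable.
Qed.

Lemma gmeasurable_at n d (T : measurableType d) (g : T -> 'rV[R]_n -> R) t :
  gmeas g -> gmeasurable (g t).
Proof. by move=> mg; apply: (gmeas_reparam (p := fun _ : unit => t) _ mg). Qed.

Lemma gmeasurable_row n (G : 'rV[R]_n.+1 -> R) (s : R) : gmeasurable G ->
  gmeasurable (fun v : 'rV[R]_n => G (row_mx (s%:M : 'rV[R]_1) v)).
Proof.
move=> mG; apply: (@gmeasurable_at n _ (measurableTypeR R)
  (fun t v => G (row_mx (t%:M : 'rV[R]_1) v)) s).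
exact: gmeasurable_slice mG.
Qed.

Lemma gintegrable_slice n (G : 'rV[R]_n.+1 -> R) K :
  gmeasurable G -> (forall v, `|G v| <= K) ->
  gintegrable (fun s => gaussE (fun v => G (row_mx (s%:M : 'rV[R]_1) v))).
Proof.
move=> mG GK; have [mE EK] := gaussE_param (gmeasurable_slice mG) (fun s v => GK _).
exact: gintegrable_bounded mE EK.
Qed.

Lemma gaussES n (G : 'rV[R]_n.+1 -> R) :
  gaussE G = gint (fun s => gaussE (fun v => G (row_mx (s%:M : 'rV[R]_1) v))).
Proof. by []. Qed.

Lemma le_gaussE n (G1 G2 : 'rV[R]_n -> R) K : gmeasurable G1 -> gmeasurable G2 ->
  (forall v, `|G1 v| <= K) -> (forall v, `|G2 v| <= K) ->
  (forall v, G1 v <= G2 v) -> gaussE G1 <= gaussE G2.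
Proof.
elim: n G1 G2 => [|n IH] G1 G2 m1 m2 b1 b2 le12; first exact: le12.
rewrite !gaussES; apply: le_gint => [||s]; [exact: gintegrable_slice b1|exact: gintegrable_slice b2|].
by apply: IH => //; exact: gmeasurable_row.
Qed.

Lemma eq_gaussE n (G1 G2 : 'rV[R]_n -> R) : (forall v, G1 v = G2 v) -> gaussE G1 = gaussE G2.
Proof. by move=> e; congr gaussE; apply/funext. Qed.

Lemma gaussED n (G1 G2 : 'rV[R]_n -> R) K : gmeasurable G1 -> gmeasurable G2 ->
  (forall v, `|G1 v| <= K) -> (forall v, `|G2 v| <= K) ->
  gaussE (fun v => G1 v + G2 v) = gaussE G1 + gaussE G2.
Proof.
elim: n G1 G2 => [|n IH] G1 G2 m1 m2 b1 b2 //.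
rewrite !gaussES -gintD; [|exact: gintegrable_slice b1|exact: gintegrable_slice b2].
by congr gint; apply/funext => s; apply: IH => //; exact: gmeasurable_row.
Qed.

Lemma gaussEZ n (G : 'rV[R]_n -> R) c K : gmeasurable G ->
  (forall v, `|G v| <= K) -> gaussE (fun v => c * G v) = c * gaussE G.
Proof.
elim: n G => [|n IH] G m b //.
rewrite !gaussES -gintZ; last exact: gintegrable_slice b.
by congr gint; apply/funext => s; apply: IH => //; exact: gmeasurable_row.
Qed.

Lemma gaussE_cst n c : gaussE (fun _ : 'rV[R]_n => c) = c.
Proof. by elim: n => [|n IH] //; rewrite gaussES IH gint_cst. Qed.

Lemma gaussE_ge0 n (G : 'rV[R]_n -> R) : (forall v, 0 <= G v) -> 0 <= gaussE G.
Proof.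
elim: n G => [|n IH] G G0; first exact: G0.
by rewrite gaussES; apply: gint_ge0 => s; apply: IH.
Qed.

Lemma gmeasurable_cst n c : gmeasurable (fun _ : 'rV[R]_n => c).
Proof. exact: gmeas_param. Qed.

Lemma gmeasurableD n (G1 G2 : 'rV[R]_n -> R) : gmeasurable G1 -> gmeasurable G2 ->
  gmeasurable (fun v => G1 v + G2 v).
Proof. by move=> m1 m2; apply: (gmeasD m1 m2). Qed.

Lemma gmeasurableM n (G1 G2 : 'rV[R]_n -> R) : gmeasurable G1 -> gmeasurable G2 ->
  gmeasurable (fun v => G1 v * G2 v).
Proof. by move=> m1 m2; apply: (gmeasM m1 m2). Qed.

Lemma gmeasurable_comp n (G : 'rV[R]_n -> R) (psi : R -> R) : measurable_fun setT psi ->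
  gmeasurable G -> gmeasurable (fun v => psi (G v)).
Proof. by move=> mp mG; apply: (gmeas_comp mp mG). Qed.

Lemma gmeasurable_coord n (i : 'I_n) : gmeasurable (fun v : 'rV[R]_n => v 0 i).
Proof. exact: gmeas_coord. Qed.

Lemma gmeasurable_sum n I (r : seq I) (G : I -> 'rV[R]_n -> R) :
  (forall i, gmeasurable (G i)) -> gmeasurable (fun v => \sum_(i <- r) G i v).
Proof.
move=> mG; elim: r => [|i r IH].
  rewrite (_ : (fun v => _) = fun=> 0); first exact: gmeasurable_cst.
  by apply/funext => v; rewrite big_nil.
rewrite (_ : (fun v => _) = fun v => G i v + \sum_(j <- r) G j v); first exact: gmeasurableD.
by apply/funext => v; rewrite big_cons.
Qed.

Definition gqform n (W : 'M[R]_n) (v : 'rV[R]_n) : R := (v *m W *m v^T) 0 0.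

Lemma gqformE n (W : 'M[R]_n) v : gqform W v = \sum_i \sum_j v 0 i * W i j * v 0 j.
Proof.
have -> : gqform W v = bform W v^T v^T by rewrite /bform trmxK.
rewrite bformE; apply: eq_bigr => i _; apply: eq_bigr => j _.
by rewrite [v^T i 0]mxE [v^T j 0]mxE.
Qed.

Lemma gmeasurable_gqform n (W : 'M[R]_n) : gmeasurable (gqform W).
Proof.
rewrite (_ : gqform W = fun v => \sum_i \sum_j v 0 i * W i j * v 0 j); last first.
  by apply/funext => v; rewrite gqformE.
apply: gmeasurable_sum => i; apply: gmeasurable_sum => j.
apply: gmeasurableM; last exact: gmeasurable_coord.
by apply: gmeasurableM; [exact: gmeasurable_coord|exact: gmeasurable_cst].
Qed.

End GaussianIntegral.

(** * Gaussian integrals of exponentials of quadratic polynomials *)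

Section GaussianQuadratic.
Variable R : realType.
Local Notation phi := (@normal_pdf R 0 1).
Local Notation mu := (@lebesgue_measure R).

(** Completing the square: the integrand is a constant times the normal density with mean
    [b / (1 + p)] and variance [1 / (1 + p)]. *)
Lemma gint_exp_quad (D p b c : R) : 0 < 1 + p ->
  gint (fun t => D * expR (- 2^-1 * p * t ^+ 2 + b * t + c)) =
  D * (Num.sqrt (1 + p))^-1 * expR (2^-1 * (b ^+ 2 / (1 + p)) + c).
Proof.
move=> p0; set s := (Num.sqrt (1 + p))^-1; set m := b / (1 + p).
have s0 : 0 < s by rewrite invr_gt0 sqrtr_gt0.
have s2 : s ^+ 2 = (1 + p)^-1 by rewrite exprVn sqr_sqrtr // ltW.
set K := D * s * _.
have E t : phi t * (D * expR (- 2^-1 * p * t ^+ 2 + b * t + c)) = K * normal_pdf m s t.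
  rewrite normal_pdf01E normal_pdfE ?gt_eqF // /normal_fun.
  have -> : normal_peak s = s^-1 * normal_peak 1.
    rewrite /normal_peak expr1n mul1r -mulrnAr sqrtrM ?sqr_ge0 // sqrtr_sqr (gtr0_norm s0).
    by rewrite invfM.
  have -> : normal_peak 1 * expR (- t ^+ 2 / 2) * (D * expR (- 2^-1 * p * t ^+ 2 + b * t + c)) =
    D * normal_peak 1 * (expR (- t ^+ 2 / 2) * expR (- 2^-1 * p * t ^+ 2 + b * t + c)) by ring.
  have -> : K * (s^-1 * normal_peak 1 * expR (- (t - m) ^+ 2 / (s ^+ 2 *+ 2))) =
    D * normal_peak 1 * (expR (2^-1 * (b ^+ 2 / (1 + p)) + c) * expR (- (t - m) ^+ 2 / (s ^+ 2 *+ 2))).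
    by rewrite /K; field; rewrite gt_eqF.
  rewrite -!expRD s2 /m; congr (_ * expR _).
  by field; rewrite gt_eqF.
transitivity (Rintegral mu setT (fun t => K * normal_pdf m s t)).
  by apply: eq_Rintegral => t _; exact: E.
rewrite RintegralZl //; last exact: integrable_normal_pdf.
by rewrite /Rintegral integral_normal_pdf mulr1.
Qed.

Lemma gqform_block n (W : 'M[R]_(1 + n)) (s : R) (v : 'rV[R]_n) : W^T = W ->
  gqform W (row_mx (s%:M : 'rV[R]_1) v) =
  W 0 0 * s ^+ 2 + 2 * s * (v *m (ursubmx W)^T) 0 0 + gqform (drsubmx W) v.
Proof.
move=> sW; rewrite /gqform -{1}[W]submxK tr_row_mx mul_row_block mul_row_col tr_scalar_mx.
have -> : dlsubmx W = (ursubmx W)^T by rewrite trmx_ursub sW.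
have addE (A B : 'M[R]_1) : (A + B) 0 0 = A 0 0 + B 0 0 by rewrite mxE.
have scE (c : R) (A : 'M[R]_1) : (c *: A) 0 0 = c * A 0 0 by rewrite mxE.
rewrite !mulmxDl !addE !mul_scalar_mx !mul_mx_scalar -!scalemxAl !scE.
have -> : ulsubmx W 0 0 = W 0 0 by rewrite !mxE lshift0.
have -> : (ursubmx W *m v^T) 0 0 = (v *m (ursubmx W)^T) 0 0.
  by rewrite -[ursubmx W *m v^T]trmxK trmx_mul trmxK [LHS]mxE.
ring.
Qed.

Lemma dot_block n (s : R) (v : 'rV[R]_n) (b : 'rV[R]_(1 + n)) :
  (row_mx (s%:M : 'rV[R]_1) v *m b^T) 0 0 = s * b 0 0 + (v *m (rsubmx b)^T) 0 0.
Proof.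
rewrite -{1}[b]hsubmxK tr_row_mx mul_row_col mul_scalar_mx !mxE lshift0 //.
Qed.

Section SchurComplement.
Variables (n : nat) (A : 'M[R]_(1 + n)).
Hypothesis pA : is_psd A.
Let A' := drsubmx A.
Let beta := ursubmx A.
Let P : 'M[R]_(1 + n) := 1%:M + A.
Let P' : 'M[R]_n := 1%:M + A'.
Let K := invmx P'.
Let bKb (u w : 'rV[R]_n) := (u *m K *m w^T) 0 0.

Lemma psd_drsubmx : is_psd A'.
Proof.
split; first by rewrite /A' trmx_drsub pA.1.
move=> v; have := pA.2 (col_mx (0 : 'cV[R]_1) v).
rewrite /qform -{1}[A]submxK tr_col_mx mul_row_block mul_row_col.
by rewrite !trmx0 !(mul0mx, mulmx0, add0r).
Qed.

Lemma unit_1Dpsd m (B : 'M[R]_m) : is_psd B -> 1%:M + B \in unitmx.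
Proof.
move=> pB; apply: (@psd_unitmx _ _ _ 1) => // v.
rewrite mul1r /qform mulmxDr mulmxDl mxE -[X in X + _]/(qform 1%:M v) qform1 lerDl.
exact: pB.2.
Qed.

Let uP' : P' \in unitmx. Proof. exact: unit_1Dpsd psd_drsubmx. Qed.
Let uP : P \in unitmx. Proof. exact: unit_1Dpsd pA. Qed.
Let sP' : P'^T = P'. Proof. by rewrite /P' linearD /= trmx1 psd_drsubmx.1. Qed.
Let sK : K^T = K. Proof. exact: invmx_sym. Qed.
Let sA : dlsubmx A = beta^T. Proof. by rewrite /beta trmx_ursub pA.1. Qed.

Lemma bKbC u w : bKb u w = bKb w u.
Proof.
have -> : bKb u w = (w *m K *m u^T)^T 0 0 by rewrite !trmx_mul trmxK sK mulmxA.
by rewrite mxE.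
Qed.

(** [1 + schur] is the Schur complement in [1 + A] of its lower right block [P']. *)
Definition schur : R := A 0 0 - bKb beta beta.

Let PE : P = block_mx (1 + A 0 0)%:M beta beta^T P'.
Proof.
rewrite /P -{1}[A]submxK sA -/beta -/A' scalar_mx_block add_block_mx !add0r.
by congr block_mx; apply/matrixP => i j; rewrite !ord1 !mxE !eqxx lshift0.
Qed.

(** [1 + schur] is the value of the form of [1 + A] at the vector [(1, - K beta^T)], whose squared
    norm is at least 1. *)
Lemma schur_gt0 : 0 < 1 + schur.
Proof.
pose w : 'cV[R]_(1 + n) := col_mx (1%:M : 'cV[R]_1) (- K *m beta^T).
have wP : qform P w = 1 + schur.
  have e1 : (- K *m beta^T)^T = - (beta *m K) by rewrite trmx_mul trmxK linearN /= sK mulmxN.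
  have e2 : 1%:M *m beta + - (beta *m K) *m P' = 0 :> 'rV[R]_n.
    by rewrite mul1mx mulNmx -mulmxA mulVmx // mulmx1 subrr.
  rewrite /qform PE /w tr_col_mx trmx1 e1 mul_row_block e2 mul_row_col mul0mx addr0.
  by rewrite mulmx1 mul1mx mulNmx mxE [X in _ + X]mxE mxE eqxx mulr1n /schur addrA.
rewrite -wP; apply: (@lt_le_trans _ _ (sqnorm w)).
  rewrite /sqnorm big_ord_recl; apply: ltr_pwDl.
    by rewrite -[ord0](lshift0 n 0) col_mxEu mxE expr1n.
  by apply: sumr_ge0 => i _; exact: sqr_ge0.
rewrite /P /qform mulmxDr mulmxDl mxE -[X in _ <= X + _]/(qform 1%:M w) qform1 lerDl.
exact: pA.2.
Qed.

Lemma det_schur : \det P = \det P' * (1 + schur).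
Proof.
have -> : P = block_mx 1%:M (beta *m K) 0 1%:M *m block_mx (1 + schur)%:M 0 0 P' *m
   block_mx 1%:M 0 (K *m beta^T) 1%:M.
  rewrite !mulmx_block !(mul1mx, mulmx1, mul0mx, mulmx0, add0r, addr0).
  rewrite -(mulmxA beta K P') mulVmx // mulmx1 (mulmxA P') mulmxV // mul1mx PE.
  congr block_mx; apply/matrixP => i j; rewrite !ord1 mulmxA !mxE eqxx !mulr1n.
  by rewrite /schur /bKb mxE; ring.
rewrite !det_mulmx det_ublock !det_lblock !det1 det_scalar expr1; ring.
Qed.

(** Block elimination: [y] is the explicit solution of [(1 + A) y = b^T]. *)
Lemma inv_schur (b : 'rV[R]_(1 + n)) (b' := rsubmx b) :
  (b *m invmx P *m b^T) 0 0 = bKb b' b' + (b 0 0 - bKb beta b') ^+ 2 / (1 + schur).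
Proof.
pose y0 : R := (b 0 0 - bKb beta b') / (1 + schur).
pose y' : 'cV[R]_n := K *m b'^T - y0 *: (K *m beta^T).
pose y : 'cV[R]_(1 + n) := col_mx (y0%:M : 'cV[R]_1) y'.
have s0 := schur_gt0; have sn0 : 1 + schur != 0 by rewrite gt_eqF.
have addE (B C : 'M[R]_1) : (B + C) 0 0 = B 0 0 + C 0 0 by rewrite mxE.
have subE (B C : 'M[R]_1) : (B - C) 0 0 = B 0 0 - C 0 0 by rewrite 2!mxE.
have scE (u : R) (B : 'M[R]_1) : (u *: B) 0 0 = u * B 0 0 by rewrite mxE.
have Py : P *m y = b^T.
  rewrite PE /y mul_block_col -[b in RHS]hsubmxK tr_row_mx -/b'; congr col_mx.
    apply/matrixP => i j; rewrite !ord1 /y' mulmxBr -scalemxAr !mulmxA mul_scalar_mx.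
    rewrite addE scE subE scE -/(bKb beta b') -/(bKb beta beta) mxE eqxx mulr1n !mxE lshift0.
    have -> : (1 + A 0 0) * y0 + (bKb beta b' - y0 * bKb beta beta) = (1 + schur) * y0 + bKb beta b'.
      by rewrite /schur; ring.
    by rewrite /y0 mulrC divfK // subrK.
  rewrite mul_mx_scalar /y' mulmxBr -scalemxAr !mulmxA mulmxV // !mul1mx.
  by rewrite addrC subrK.
have -> : b *m invmx P *m b^T = b *m y by rewrite -Py -mulmxA (mulmxA (invmx P)) mulVmx // mul1mx.
rewrite /y -{1}[b]hsubmxK mul_row_col /y' -/b' mulmxBr -scalemxAr !mulmxA mul_mx_scalar.
rewrite addE scE subE scE -/(bKb b' b') -/(bKb b' beta) (bKbC b' beta) [lsubmx b 0 0]mxE lshift0 /y0.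
by field.
Qed.

End SchurComplement.

Lemma det_1Dpsd_ge0 m (B : 'M[R]_m) : is_psd B -> 0 <= \det (1%:M + B).
Proof.
elim: m B => [|m IH] B pB; first by rewrite det_mx00.
rewrite (@det_schur m B pB) mulr_ge0 //; first exact: IH (@psd_drsubmx m B pB).
exact/ltW/(@schur_gt0 m B pB).
Qed.

Lemma quad_sub n (K : 'M[R]_n) (u w : 'rV[R]_n) (s : R) :
  ((u - s *: w) *m K *m (u - s *: w)^T) 0 0 =
  (u *m K *m u^T) 0 0 - s * (u *m K *m w^T) 0 0 - s * (w *m K *m u^T) 0 0 +
  s ^+ 2 * (w *m K *m w^T) 0 0.
Proof.
have subE (B C : 'M[R]_1) : (B - C) 0 0 = B 0 0 - C 0 0 by rewrite 2!mxE.
have scE (c : R) (B : 'M[R]_1) : (c *: B) 0 0 = c * B 0 0 by rewrite mxE.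
rewrite raddfB /= [(s *: w)^T]linearZ /= !mulmxBl !mulmxBr.
rewrite -!scalemxAl -!scalemxAr !subE !scE; ring.
Qed.

(** The linear term is part of the induction: fixing the first coordinate [s] turns [b'] into
    [b' - s beta]. After the inner integral the exponent is again quadratic in [s], now with
    coefficient [schur A]. *)
Theorem gaussE_exp_quad n (A : 'M[R]_n) (b : 'rV[R]_n) (c : R) : is_psd A ->
  gaussE (fun x => expR (- 2^-1 * gqform A x + (x *m b^T) 0 0 + c)) =
  (Num.sqrt (\det (1%:M + A)))^-1 * expR (2^-1 * (b *m invmx (1%:M + A) *m b^T) 0 0 + c).
Proof.
elim: n A b c => [|n IH] A b c pA.
  have e0 (u : 'rV[R]_0) (B : 'M[R]_0) : (u *m B *m b^T) 0 0 = 0 by rewrite mxE big_ord0.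
  have e1 : gqform A 0 = 0 by rewrite /gqform mxE big_ord0.
  by rewrite /= e1 e0 det_mx00 sqrtr1 invr1 mul1r [X in _ + X + _]mxE big_ord0 !mulr0 addr0.
rewrite gaussES.
have pA' := @psd_drsubmx n A pA.
pose K := invmx (1%:M + @drsubmx R 1 n 1 n A).
pose beta := @ursubmx R 1 n 1 n A; pose b' := @rsubmx R 1 1 n b.
pose bKb (u w : 'rV[R]_n) := (u *m K *m w^T) 0 0.
pose D := (Num.sqrt (\det (1%:M + @drsubmx R 1 n 1 n A)))^-1.
have IHs s : gaussE (fun v : 'rV[R]_n => expR (- 2^-1 * gqform A (row_mx (s%:M : 'rV[R]_1) v) +
     (row_mx (s%:M : 'rV[R]_1) v *m b^T) 0 0 + c)) =
   D * expR (- 2^-1 * schur A * s ^+ 2 + (b 0 0 - bKb beta b') * s + (2^-1 * bKb b' b' + c)).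
  rewrite (eq_gaussE (G2 := fun v => expR (- 2^-1 * gqform (@drsubmx R 1 n 1 n A) v +
     (v *m (b' - s *: beta)^T) 0 0 + (- 2^-1 * A 0 0 * s ^+ 2 + b 0 0 * s + c)))) => [|v]; last first.
    rewrite (@gqform_block n A s v pA.1) (@dot_block n s v b); congr expR.
    have -> : (v *m (b' - s *: beta)^T) 0 0 = (v *m b'^T) 0 0 - s * (v *m beta^T) 0 0.
      by rewrite linearB linearZ /= mulmxBr -scalemxAr !mxE.
    by rewrite -/b' -/beta; field.
  rewrite IH //; congr (_ * expR _).
  have -> : ((b' - s *: beta) *m K *m (b' - s *: beta)^T) 0 0 =
     bKb b' b' - 2 * s * bKb beta b' + s ^+ 2 * bKb beta beta.
    by rewrite quad_sub -!/(bKb _ _) (@bKbC n A pA b' beta : bKb b' beta = bKb beta b'); ring.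
  by rewrite /schur -/K -/beta -/(bKb _ _); field.
under [X in gint X]eq_fun do rewrite IHs.
rewrite gint_exp_quad; last exact: schur_gt0.
rewrite (@inv_schur n A pA b) (@det_schur n A pA) -/K -/beta -/b' -!/(bKb _ _).
rewrite sqrtrM; last exact: det_1Dpsd_ge0.
rewrite invfM; congr (_ * expR _); ring.
Qed.

End GaussianQuadratic.

(** * Anticoncentration and continuity for Gaussian quadratic forms *)

Section QuadraticCdf.
Variable R : realType.
Local Notation phi := (@normal_pdf R 0 1).
Local Notation mu := (@lebesgue_measure R).

Lemma ind_abs_le1 (p : bool) : `|p%:R : R| <= 1.
Proof. by case: p; rewrite ?normr1 ?normr0. Qed.

Lemma measurable_le_ind (x : R) : measurable_fun setT (fun t : R => ((t <= x)%R)%:R : R).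
Proof.
apply: nonincreasing_measurable => // s t st.
by rewrite ler_nat; case: (leP t x) => // tx; rewrite (le_trans st tx).
Qed.

Lemma gint_itv (a b : R) : a <= b -> gint (fun s => ((a <= s <= b)%R)%:R) <= b - a.
Proof.
move=> ab.
have E (s : R) : ((a <= s <= b)%R)%:R = \1_`[a, b]%classic s :> R.
  by rewrite indicE mem_setE in_itv.
have mI : measurable_fun setT (\1_`[a, b]%classic : R -> R) by apply: measurable_indic.
have iI : mu.-integrable setT (EFin \o (\1_`[a, b]%classic : R -> R)).
  exact: integrable_indic_itv a b true false.
apply: (@le_trans _ _ (Rintegral mu setT (\1_`[a, b]%classic : R -> R))).
  apply: le_Rintegral => //.
    apply: (@gintegrable_bounded _ _ 1); first by under eq_fun do rewrite E.
    by move=> t; rewrite E indicE; case: (_ \in _); rewrite ?normr1 ?normr0.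
  move=> t _; rewrite E -[X in _ <= X]mul1r ler_wpM2r ?normal_pdf01_le1 //.
rewrite /Rintegral integral_indic // setIT; have := lebesgue_measure_itv `[a, b]; rewrite /= lte_fin => ->.
by case: ltP => //= _; rewrite subr_ge0.
Qed.

Lemma abs_ind_measurable (d : R) : measurable_fun setT (fun t : R => ((`|t| <= d)%R)%:R : R).
Proof.
apply: (@measurableT_comp _ _ _ _ _ _ (fun t : R => ((t <= d)%R)%:R : R) _ (fun t : R => `|t|)).
  exact: measurable_le_ind.
exact: normr_measurable.
Qed.

(** The points in question lie in two intervals, mirror images about the vertex [m], each of length
    [B - A <= sqrt (2 d / lam)], and the density is at most 1. The square root of a negative number
    is 0, so for [k < d] the intervals meet at [m]. *)
Lemma gint_anticoncentration (lam b c d : R) : 0 < lam -> 0 <= d ->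
  gint (fun s => ((`|lam * s ^+ 2 + b * s + c| <= d)%R)%:R) <= 2 * Num.sqrt (2 * d / lam).
Proof.
move=> l0 d0; set L := Num.sqrt _.
pose m : R := - b / (2 * lam); pose k : R := b ^+ 2 / (4 * lam) - c.
pose B : R := Num.sqrt ((k + d) / lam); pose A : R := Num.sqrt ((k - d) / lam).
have AB : A <= B by apply: ler_wsqrtr; rewrite ler_wpM2r ?invr_ge0 ?(ltW l0) //; lra.
have A0 : 0 <= A := sqrtr_ge0 _.
have L2 : L ^+ 2 = 2 * d / lam by rewrite sqr_sqrtr // divr_ge0 ?mulr_ge0 ?(ltW l0).
have BL : B <= A + L.
  have AL0 : 0 <= A + L by rewrite addr_ge0 ?sqrtr_ge0.
  rewrite -(ger0_norm AL0) -sqrtr_sqr; apply: ler_wsqrtr.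
  have A2 : (k - d) / lam <= A ^+ 2.
    have [h|h] := leP 0 ((k - d) / lam); first by rewrite sqr_sqrtr.
    exact: le_trans (ltW h) (sqr_ge0 _).
  have -> : (k + d) / lam = (k - d) / lam + L ^+ 2 by rewrite L2; field; rewrite gt_eqF.
  rewrite sqrrD; have : 0 <= A * L by rewrite mulr_ge0 ?sqrtr_ge0.
  by lra.
pose I1 (s : R) : R := ((m + A <= s <= m + B)%R)%:R; pose I2 (s : R) : R := ((m - B <= s <= m - A)%R)%:R.
have mI (u v : R) : gintegrable (fun s => ((u <= s <= v)%R)%:R).
  apply: (@gintegrable_bounded _ _ 1) => [|s]; last exact: ind_abs_le1.
  have -> : (fun s => ((u <= s <= v)%R)%:R) = (\1_`[u, v]%classic : R -> R).
    by apply/funext => s; rewrite indicE mem_setE in_itv.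
  exact: measurable_indic.
apply: (@le_trans _ _ (gint (fun s => I1 s + I2 s))); last first.
  rewrite gintD; [|exact: mI|exact: mI]; have h1 := @gint_itv (m + A) (m + B); have h2 := @gint_itv (m - B) (m - A).
  apply: (@le_trans _ _ (m + B - (m + A) + (m - A - (m - B)))).
    by apply: lerD; [apply: h1|apply: h2]; lra.
  lra.
apply: le_gint.
- apply: (@gintegrable_bounded _ _ 1) => [|s]; last exact: ind_abs_le1.
  apply: (@measurableT_comp _ _ _ _ _ _ (fun t : R => ((`|t| <= d)%R)%:R : R) _
    (fun s : R => lam * s ^+ 2 + b * s + c)); first exact: abs_ind_measurable.
  by apply: measurable_funD => //; apply: measurable_funD; apply: measurable_funM => //;
    apply: measurable_funX.
- by apply: (@gintegrableD R I1 I2); exact: mI.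
move=> s; have [h|_] := leP `|lam * s ^+ 2 + b * s + c| d; last by apply: addr_ge0; exact: ler0n.
have sq : lam * s ^+ 2 + b * s + c = lam * (s - m) ^+ 2 - k.
  by rewrite /m /k; field; rewrite gt_eqF.
move: h; rewrite sq ler_norml => /andP[h1 h2].
have r2 : (s - m) ^+ 2 = `|s - m| ^+ 2 by rewrite -normrX ger0_norm ?sqr_ge0.
have rB : `|s - m| <= B.
  rewrite -sqrtr_sqr; apply: ler_wsqrtr; rewrite ler_pdivlMr //; lra.
have rA : A <= `|s - m|.
  rewrite -sqrtr_sqr; apply: ler_wsqrtr; rewrite ler_pdivrMr //; lra.
rewrite /I1 /I2; have [sm|sm] := leP 0 (s - m).
  move: rA rB; rewrite ger0_norm // => rA rB.
  have -> : (m + A <= s <= m + B)%R by apply/andP; split; rewrite addrC -?lerBrDr // -lerBlDr.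
  by rewrite lerDl ler0n.
move: rA rB; rewrite ltr0_norm // opprB => rA rB.
have -> : (m - B <= s <= m - A)%R.
  by apply/andP; split; [rewrite lerBlDr addrC -lerBlDr|rewrite lerBrDr addrC -lerBrDr].
by rewrite lerDr ler0n.
Qed.

Lemma gmeasurable_dot n (b : 'rV[R]_n) : gmeasurable (fun v => (v *m b^T) 0 0).
Proof.
have -> : (fun v : 'rV[R]_n => (v *m b^T) 0 0) = fun v => \sum_i v 0 i * b 0 i.
  by apply/funext => v; rewrite mxE; apply: eq_bigr => i _; rewrite [b^T i 0]mxE.
apply: gmeasurable_sum => i; apply: gmeasurableM; [exact: gmeasurable_coord|exact: gmeasurable_cst].
Qed.

(** Fixing the first coordinate leaves a polynomial of the same kind with other linear and constant
    terms, hence the arbitrary [b] and [c]. The bound then comes from the last coordinate alone,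
    through its diagonal entry. *)
Theorem gauss_anticoncentration n (W : 'M[R]_n.+1) (b : 'rV[R]_n.+1) (c w d : R) : W^T = W ->
  0 < w -> (forall i, w <= W i i) -> 0 <= d ->
  gaussE (fun v => ((`|gqform W v + (v *m b^T) 0 0 + c| <= d)%R)%:R) <= 2 * Num.sqrt (2 * d / w).
Proof.
move=> sW w0 Ww d0; elim: n W b c sW Ww => [|n IH] W b c sW Ww.
  rewrite gaussES; have l0 : 0 < W 0 0 := lt_le_trans w0 (Ww 0).
  have -> : (fun s : R => gaussE (fun v : 'rV[R]_0 => ((`|gqform W (row_mx (s%:M : 'rV[R]_1) v)
       + (row_mx (s%:M : 'rV[R]_1) v *m b^T) 0 0 + c| <= d)%R)%:R)) =
      (fun s => ((`|W 0 0 * s ^+ 2 + b 0 0 * s + c| <= d)%R)%:R : R).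
    apply/funext => s /=; rewrite (@gqform_block R 0 W s 0 sW) (@dot_block R 0 s 0 b).
    by rewrite /gqform !mul0mx !mxE !mulr0 !addr0 (mulrC s).
  apply: (le_trans (gint_anticoncentration _ _ l0 d0)).
  rewrite ler_wpM2l // ler_wsqrtr // ler_wpM2l ?mulr_ge0 //.
  by rewrite lef_pV2 ?posrE ?Ww ?l0.
have mG : gmeasurable (fun v : 'rV[R]_n.+2 => ((`|gqform W v + (v *m b^T) 0 0 + c| <= d)%R)%:R : R).
  apply: (gmeasurable_comp (@abs_ind_measurable d)).
  apply: gmeasurableD; last exact: gmeasurable_cst.
  by apply: gmeasurableD; [exact: gmeasurable_gqform|exact: gmeasurable_dot].
have bG (v : 'rV[R]_n.+2) : `|((`|gqform W v + (v *m b^T) 0 0 + c| <= d)%R)%:R : R| <= 1.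
  exact: ind_abs_le1.
rewrite gaussES -[X in _ <= X]gint_cst; apply: le_gint.
- exact: gintegrable_slice bG.
- exact: gintegrable_cst.
move=> s; pose W' := @drsubmx R 1 n.+1 1 n.+1 W.
pose b' := @rsubmx R 1 1 n.+1 b + (2 * s) *: @ursubmx R 1 n.+1 1 n.+1 W.
rewrite (eq_gaussE (G2 := fun v => ((`|gqform W' v + (v *m b'^T) 0 0 +
   (W 0 0 * s ^+ 2 + s * b 0 0 + c)| <= d)%R)%:R)) => [|v]; last first.
  rewrite (@gqform_block R n.+1 W s v sW) (@dot_block R n.+1 s v b).
  have -> : (v *m b'^T) 0 0 = (v *m (@rsubmx R 1 1 n.+1 b)^T) 0 0 +
     2 * s * (v *m (@ursubmx R 1 n.+1 1 n.+1 W)^T) 0 0.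
    by rewrite /b' raddfD /= [(_ *: _)^T]linearZ /= mulmxDr -scalemxAr [LHS]mxE [X in _ + X]mxE.
  by rewrite -/W'; congr ((`|_| <= d)%R%:R); ring.
apply: IH; first by rewrite /W' trmx_drsub sW.
by move=> i; rewrite /W' !mxE.
Qed.

Lemma gauss_qf_cdfE n (W : 'M[R]_n) x : gauss_qf_cdf W x = gaussE (fun v => ((gqform W v <= x)%R)%:R).
Proof. by apply: eq_gaussE => v; rewrite /gqform; case: (_ <= _)%R. Qed.

Lemma gmeasurable_qf_ind n (W : 'M[R]_n) x : gmeasurable (fun v => ((gqform W v <= x)%R)%:R : R).
Proof. by apply: (gmeasurable_comp (@measurable_le_ind x)); exact: gmeasurable_gqform. Qed.

Lemma gauss_qf_cdf_ge0 n (W : 'M[R]_n) x : 0 <= gauss_qf_cdf W x.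
Proof. by rewrite gauss_qf_cdfE; apply: gaussE_ge0 => v. Qed.

Lemma gauss_qf_cdf_le n (W W' : 'M[R]_n) x x' :
  (forall v, gqform W v <= x -> gqform W' v <= x') -> gauss_qf_cdf W x <= gauss_qf_cdf W' x'.
Proof.
move=> WW; rewrite !gauss_qf_cdfE; apply: (@le_gaussE _ _ _ _ 1); do ?exact: gmeasurable_qf_ind.
- by move=> v; exact: ind_abs_le1.
- by move=> v; exact: ind_abs_le1.
- by move=> v; rewrite ler_nat; case: (leP (gqform W v) x) => // /WW ->.
Qed.

Lemma gauss_qf_cdf_homo n (W : 'M[R]_n) x y : x <= y -> gauss_qf_cdf W x <= gauss_qf_cdf W y.
Proof. by move=> xy; apply: gauss_qf_cdf_le => v h; exact: le_trans xy. Qed.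

Lemma gauss_qf_cdf_lt0 n (W : 'M[R]_n) x : (forall v, 0 <= gqform W v) -> x < 0 -> gauss_qf_cdf W x = 0.
Proof.
move=> W0 x0; rewrite gauss_qf_cdfE -[RHS](@gaussE_cst R n 0); apply: eq_gaussE => v.
by rewrite leNgt (lt_le_trans x0 (W0 v)).
Qed.

Lemma gauss_qf_cdf_modulus n (W : 'M[R]_n.+1) (w x y : R) : W^T = W -> 0 < w -> (forall i, w <= W i i) ->
  x <= y -> gauss_qf_cdf W y - gauss_qf_cdf W x <= 2 * Num.sqrt (2 * (y - x) / w).
Proof.
move=> sW w0 Ww xy; rewrite lerBlDl !gauss_qf_cdfE.
have y0 : 0 <= y - x by rewrite subr_ge0.
have := gauss_anticoncentration 0 (- x) sW w0 Ww y0.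
rewrite (eq_gaussE (G2 := fun v => ((`|gqform W v - x| <= y - x)%R)%:R)) => [h|v]; last first.
  by rewrite trmx0 mulmx0 [X in _ + X - x]mxE addr0.
have mG : gmeasurable (fun v : 'rV[R]_n.+1 => ((`|gqform W v - x| <= y - x)%R)%:R : R).
  apply: (gmeasurable_comp (@abs_ind_measurable (y - x))).
  by apply: gmeasurableD; [exact: gmeasurable_gqform|exact: gmeasurable_cst].
have bG (v : 'rV[R]_n.+1) : `|((`|gqform W v - x| <= y - x)%R)%:R : R| <= 1 by exact: ind_abs_le1.
apply: le_trans (lerD (lexx _) h).
rewrite -(gaussED (@gmeasurable_qf_ind _ W x) mG (fun v => ind_abs_le1 _) bG).
apply: (@le_gaussE _ _ _ _ 2).
- exact: gmeasurable_qf_ind.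
- by apply: gmeasurableD => //; exact: gmeasurable_qf_ind.
- by move=> v; apply: (le_trans (ind_abs_le1 _)); rewrite ler1n.
- by move=> v; apply: (le_trans (ler_normD _ _)); rewrite -[2]/(1 + 1) lerD // ind_abs_le1.
move=> v; rewrite -natrD ler_nat.
have [vy|//] := leP (gqform W v) y; have [vx|vx] := leP (gqform W v) x => //.
by rewrite ger0_norm ?subr_ge0 ?(ltW vx) // lerD2r vy.
Qed.

Lemma gauss_qf_cdf_continuous n (W : 'M[R]_n.+1) (w x eps : R) : W^T = W -> 0 < w ->
  (forall i, w <= W i i) -> 0 < eps -> exists2 d, 0 < d &
  forall y, `|y - x| <= d -> `|gauss_qf_cdf W y - gauss_qf_cdf W x| <= eps.
Proof.
move=> sW w0 Ww e0; exists (w * eps ^+ 2 / 8); first by rewrite !mulr_gt0 ?exprn_gt0.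
have key u v : u <= v -> v - u <= w * eps ^+ 2 / 8 ->
    0 <= gauss_qf_cdf W v - gauss_qf_cdf W u <= eps.
  move=> uv vu; rewrite subr_ge0 gauss_qf_cdf_homo //=.
  apply: (le_trans (gauss_qf_cdf_modulus sW w0 Ww uv)).
  have -> : eps = 2 * Num.sqrt ((eps / 2) ^+ 2).
    by rewrite sqrtr_sqr gtr0_norm ?divr_gt0 //; field.
  rewrite ler_wpM2l // ler_wsqrtr // ler_pdivrMr //; lra.
move=> y; have [xy|yx] := leP x y => h.
  by have /andP[k0 k1] := key _ _ xy (le_trans (ler_norm _) h); rewrite ger0_norm.
rewrite distrC in h; have /andP[k0 k1] := key _ _ (ltW yx) (le_trans (ler_norm _) h).
by rewrite distrC ger0_norm.
Qed.

End QuadraticCdf.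

(** * From Laplace transforms to distribution functions *)

Section LaplaceCdf.
Variable R : realType.

Lemma bernoulli_le (y : R) n : 0 <= y <= 1 -> 1 - n%:R * y <= (1 - y) ^+ n.
Proof.
move=> /andP[y0 y1]; elim: n => [|n IH]; first by rewrite mul0r subr0 expr0.
have h : 0 <= 1 - y by rewrite subr_ge0.
rewrite exprS; apply: (@le_trans _ _ ((1 - y) * (1 - n%:R * y))); last by rewrite ler_wpM2l.
have : 0 <= n%:R * y * y by rewrite !mulr_ge0.
by rewrite -natr1; nra.
Qed.

Lemma bernoulli_ge (y : R) n : 0 <= y <= 1 -> n%:R * y * (1 - y) ^+ n <= 1.
Proof.
move=> /andP[y0 y1]; have h : 0 <= 1 - y by rewrite subr_ge0.
suff : (1 + n%:R * y) * (1 - y) ^+ n <= 1.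
  have : 0 <= (1 - y) ^+ n by rewrite exprn_ge0.
  lra.
elim: n => [|n IH]; first by rewrite mul0r addr0 mulr1.
apply: le_trans IH; rewrite exprS mulrA ler_wpM2r ?exprn_ge0 //.
have : 0 <= n%:R * y * y by rewrite !mulr_ge0.
by rewrite -natr1; nra.
Qed.

(* The polynomial [1 - (1 - 'X^n) ^+ (2 ^ n)] approximates the indicator of [1/2 < y <= 1]. *)
Lemma half_line_poly (a b eps : R) : 0 <= a -> a < b -> 0 < eps ->
  exists lam (p : {poly R}), 0 < lam /\ forall t, 0 <= t ->
    [/\ 0 <= p.[expR (- lam * t)] <= 1, t <= a -> 1 - eps <= p.[expR (- lam * t)]
      & b <= t -> p.[expR (- lam * t)] <= eps].
Proof.
move=> a0 ab e0; pose m := (a + b) / 2; have m0 : 0 < m by rewrite /m; lra.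
(* Chosen to have [expR (- lam m) = 1/2]. Then [2^n y^n = expR (n lam (m - t))] is large for
   [t <= a] and small for [t >= b], and Bernoulli's inequalities carry this over to
   [(1 - y^n)^(2^n)]. *)
pose lam := ln 2 / m; have l2 : 0 < ln 2 :> R by rewrite ln_gt0 // ltr1n.
have lam0 : 0 < lam by rewrite divr_gt0.
pose D := lam * ((b - a) / 2); have D0 : 0 < D by rewrite mulr_gt0 // divr_gt0 // subr_gt0.
pose n := Num.Def.archi_bound (eps^-1 / D).
have nD : eps^-1 <= n%:R * D.
  by rewrite -ler_pdivrMr //; apply/ltW/archi_boundP; rewrite divr_ge0 ?invr_ge0 ?(ltW e0) ?(ltW D0).
have [r rE] : exists r : nat, r = (2 ^ n)%N by exists (2 ^ n)%N.
exists lam, (1 - (1 - 'X^n) ^+ r); split=> // t t0.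
set y := expR _; rewrite !hornerE.
have y0 : 0 < y by exact: expR_gt0.
have y1 : y <= 1 by rewrite -expR0 ler_expR mulNr oppr_le0 mulr_ge0 // ltW.
set u := y ^+ n; have u01 : 0 <= u <= 1 by rewrite exprn_ge0 ?exprn_ile1 // ltW.
have /andP[u0 u1] := u01; have h : 0 <= 1 - u <= 1 by apply/andP; split; lra.
have /andP[h0 h1] := h.
have p0 : 0 <= (1 - u) ^+ r by rewrite exprn_ge0.
have p1 : (1 - u) ^+ r <= 1 by rewrite exprn_ile1.
have E2 : r%:R * u = expR (n%:R * (lam * (m - t))).
  have -> : lam * (m - t) = ln 2 + - lam * t by rewrite /lam; field; rewrite gt_eqF.
  by rewrite mulrDr expRD !expRM_natl lnK ?posrE // rE natrX.
clear rE y1; have big (s : R) : D <= s -> eps^-1 <= expR (n%:R * s).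
  move=> Ds; apply: (le_trans nD); apply: (@le_trans _ _ (n%:R * s)); first by rewrite ler_wpM2l.
  by apply: le_trans (expR_ge1Dx _); rewrite lerDr.
move: ((1 - u) ^+ r) (bernoulli_ge r u01) (bernoulli_le r u01) p0 p1 => v; rewrite E2 => k1 k2 p0 p1.
split; first by apply/andP; split; lra.
- move=> ta; have k := k1.
  have Ds : D <= lam * (m - t) by rewrite /D ler_wpM2l ?(ltW lam0) // /m; lra.
  have {}k : eps^-1 * v <= 1.
    by apply: le_trans k; rewrite ler_wpM2r // big.
  by move: k; rewrite mulrC ler_pdivrMr // mul1r; lra.
- move=> bt; have k := k2.
  suff : expR (n%:R * (lam * (m - t))) <= eps by lra.
  have Ds : D <= - (lam * (m - t)) by rewrite -mulrN /D ler_wpM2l ?(ltW lam0) // /m; lra.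
  rewrite -[X in expR X]opprK -mulrN expRN -[X in _ <= X]invrK lef_pV2 ?posrE ?expR_gt0 ?invr_gt0 //.
  exact: big.
Qed.

Lemma measurable_expRM (th : R) : measurable_fun setT (fun t : R => expR (- th * t)).
Proof. by apply: measurableT_comp => //; apply: measurable_funM. Qed.

Lemma gmeasurable_exp_gqform n (W : 'M[R]_n) (th : R) :
  gmeasurable (fun v => expR (- th * gqform W v)).
Proof. by apply: (gmeasurable_comp (measurable_expRM th)); exact: gmeasurable_gqform. Qed.

Lemma exp_gqform_le1 n (W : 'M[R]_n) (th : R) v : (forall v, 0 <= gqform W v) -> 0 <= th ->
  `|expR (- th * gqform W v)| <= 1.
Proof.
by move=> W0 t0; rewrite ger0_norm ?expR_ge0 // -expR0 ler_expR mulNr oppr_le0 mulr_ge0.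
Qed.

Lemma gaussE_sum n m (c : 'I_m -> R) (G : 'I_m -> 'rV[R]_n -> R) :
  (forall i, gmeasurable (G i)) -> (forall i v, `|G i v| <= 1) ->
  gaussE (fun v => \sum_i c i * G i v) = \sum_i c i * gaussE (G i).
Proof.
elim: m c G => [|m IH] c G mG bG.
  by rewrite big_ord0 -[RHS](@gaussE_cst R n 0); apply: eq_gaussE => v; rewrite big_ord0.
rewrite big_ord_recl -IH // -(@gaussEZ _ _ _ _ 1) //.
pose K := `|c ord0| + \sum_(i < m) `|c (lift ord0 i)|.
have S0 : 0 <= \sum_(i < m) `|c (lift ord0 i)| by apply: sumr_ge0.
rewrite -(@gaussED _ _ _ _ K).
- by apply: eq_gaussE => v; rewrite big_ord_recl.
- by apply: gmeasurableM => //; exact: gmeasurable_cst.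
- by apply: gmeasurable_sum => i; apply: gmeasurableM => //; exact: gmeasurable_cst.
- move=> v; rewrite normrM; apply: (@le_trans _ _ `|c ord0|); last by rewrite lerDl.
  by rewrite ler_piMr.
- move=> v; apply: (le_trans (ler_norm_sum _ _ _)); rewrite /K.
  apply: (@le_trans _ _ (\sum_(i < m) `|c (lift ord0 i)|)); last by rewrite lerDr.
  by apply: ler_sum => i _; rewrite normrM ler_piMr.
Qed.

Section OneMatrix.
Variables (n : nat) (W : 'M[R]_n).
Hypothesis W0 : forall v, 0 <= gqform W v.

Lemma gaussE_poly_exp (p : {poly R}) lam : 0 <= lam ->
  gaussE (fun v => p.[expR (- lam * gqform W v)]) =
  \sum_(i < size p) p`_i * gaussE (fun v => expR (- (i%:R * lam) * gqform W v)).
Proof.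
move=> l0; rewrite -gaussE_sum.
- apply: eq_gaussE => v; rewrite horner_coef; apply: eq_bigr => i _.
  by rewrite -expRM_natl; congr (_ * expR _); ring.
- by move=> i; exact: gmeasurable_exp_gqform.
- by move=> i v; apply: exp_gqform_le1 => //; rewrite mulr_ge0.
Qed.

Lemma laplace_poly (p : {poly R}) lam d N Q (Nq : 'I_Q -> nat) (T : {ffun 'I_N -> 'I_Q} -> R) :
  0 <= lam ->
  (forall th, 0 <= th <= (size p)%:R * lam ->
     `|expect Nq (fun z => expR (- th * T z)) - gaussE (fun v => expR (- th * gqform W v))| <= d) ->
  `|expect Nq (fun z => p.[expR (- lam * T z)]) - gaussE (fun v => p.[expR (- lam * gqform W v)])|
    <= (\sum_(i < size p) `|p`_i|) * d.
Proof.
move=> l0 close; rewrite gaussE_poly_exp //.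
have -> : expect Nq (fun z => p.[expR (- lam * T z)]) =
    \sum_(i < size p) p`_i * expect Nq (fun z => expR (- (i%:R * lam) * T z)).
  transitivity (expect Nq (fun z => \sum_(i < size p) p`_i * expR (- (i%:R * lam) * T z))).
    apply: eq_expect => z _; rewrite horner_coef; apply: eq_bigr => i _.
    by rewrite -expRM_natl; congr (_ * expR _); ring.
  by rewrite expect_sum; apply: eq_bigr => i _; rewrite expectZ.
rewrite -sumrB mulr_suml; apply: (le_trans (ler_norm_sum _ _ _)); apply: ler_sum => i _.
rewrite -mulrBr normrM ler_wpM2l // close // mulr_ge0 //=.
by rewrite ler_wpM2r // ler_nat ltnW.
Qed.

Lemma gmeasurable_poly_exp (p : {poly R}) lam : gmeasurable (fun v => p.[expR (- lam * gqform W v)]).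
Proof.
have -> : (fun v => p.[expR (- lam * gqform W v)]) =
    fun v => \sum_(i < size p) p`_i * expR (- (i%:R * lam) * gqform W v).
  apply/funext => v; rewrite horner_coef; apply: eq_bigr => i _.
  by rewrite -expRM_natl; congr (_ * expR _); ring.
apply: gmeasurable_sum => i; apply: gmeasurableM; first exact: gmeasurable_cst.
exact: gmeasurable_exp_gqform.
Qed.

(** Only the transforms at [i lam] with [i < size p] enter, so closeness on a bounded range decides.
    [Th] and [d] are fixed before the design, which makes the conclusion uniform. *)
Lemma laplace_bracket (a b eps : R) : 0 <= a -> a < b -> 0 < eps -> exists Th d, [/\ 0 < d,
  0 <= Th & forall N Q (Nq : 'I_Q -> nat) (T : {ffun 'I_N -> 'I_Q} -> R),
  (\sum_q Nq q)%N = N -> (forall z, 0 <= T z) ->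
  (forall th, 0 <= th <= Th ->
     `|expect Nq (fun z => expR (- th * T z)) - gaussE (fun v => expR (- th * gqform W v))| <= d) ->
  prob R Nq (fun z => T z <= a) <= gauss_qf_cdf W b + eps /\
  gauss_qf_cdf W a <= prob R Nq (fun z => T z <= b) + eps].
Proof.
move=> a0 ab e0; have e3 : 0 < eps / 3 by rewrite divr_gt0.
have [lam [p [l0 pP]]] := half_line_poly a0 ab e3.
pose A := 1 + \sum_(i < size p) `|p`_i|.
have A0 : 0 < A by rewrite ltr_wpDr // sumr_ge0.
exists ((size p)%:R * lam), (eps / 3 / A); split; first by rewrite divr_gt0.
  by rewrite mulr_ge0 // ltW.
move=> N Q Nq T NqN T0 close.
have {close}close := laplace_poly (ltW l0) close.
have cle : `|expect Nq (fun z => p.[expR (- lam * T z)]) -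
    gaussE (fun v => p.[expR (- lam * gqform W v)])| <= eps / 3.
  apply: (le_trans close); rewrite mulrA ler_pdivrMr // mulrC ler_wpM2l ?(ltW e3) // /A lerDr //.
have lower t : 0 <= t -> ((t <= a)%R)%:R - eps / 3 <= p.[expR (- lam * t)].
  move=> t0; have [/andP[p0 _] pa _] := pP t t0.
  by have [/pa|_] := leP t a => /=; lra.
have upper t : 0 <= t -> p.[expR (- lam * t)] <= ((t <= b)%R)%:R + eps / 3.
  move=> t0; have [/andP[_ p1] _ pb] := pP t t0.
  by have [_|/ltW/pb] := leP t b => /=; lra.
have bp (v : 'rV[R]_n) : `|p.[expR (- lam * gqform W v)]| <= 2.
  by have [/andP[p0 p1] _ _] := pP _ (W0 v); rewrite ger0_norm //; lra.
have mi c x : gmeasurable (fun v : 'rV[R]_n => ((gqform W v <= x)%R)%:R + c : R).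
  by apply: gmeasurableD; [exact: gmeasurable_qf_ind|exact: gmeasurable_cst].
have gi c x : gaussE (fun v : 'rV[R]_n => ((gqform W v <= x)%R)%:R + c) = gauss_qf_cdf W x + c.
  rewrite (@gaussED _ _ _ _ (1 + `|c|)) ?gaussE_cst ?gauss_qf_cdfE //.
  - exact: gmeasurable_qf_ind.
  - exact: gmeasurable_cst.
  - by move=> v; apply: (le_trans (ind_abs_le1 _ _)); rewrite lerDl.
  - by move=> v; rewrite lerDr.
pose K := 2 + eps.
have bi' c x (v : 'rV[R]_n) : `|c| <= eps / 3 -> `|((gqform W v <= x)%R)%:R + c : R| <= K.
  move=> c1; apply: (le_trans (ler_normD _ _)); have := ind_abs_le1 R (gqform W v <= x)%R.
  by rewrite /K; lra.
have bp' v : `|p.[expR (- lam * gqform W v)]| <= K.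
  by apply: (le_trans (bp v)); rewrite /K; lra.
have c1 : `|eps / 3| <= eps / 3 by rewrite ger0_norm // ltW.
have c2 : `|- (eps / 3)| <= eps / 3 by rewrite normrN.
have gu : gaussE (fun v => p.[expR (- lam * gqform W v)]) <= gauss_qf_cdf W b + eps / 3.
  rewrite -gi; apply: (le_gaussE (gmeasurable_poly_exp p lam) (mi (eps / 3) b) bp').
    by move=> v; apply: bi'.
  by move=> v; apply: upper.
have gl : gauss_qf_cdf W a - eps / 3 <= gaussE (fun v => p.[expR (- lam * gqform W v)]).
  rewrite -gi; apply: (le_gaussE (mi (- (eps / 3)) a) (gmeasurable_poly_exp p lam) _ bp').
    by move=> v; apply: bi'.
  by move=> v; apply: lower.
have eu : expect Nq (fun z => p.[expR (- lam * T z)]) <= prob R Nq (fun z => T z <= b) + eps / 3.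
  rewrite prob_expect -[X in _ + X](@expect_cst R N Q Nq NqN) -expectD.
  by apply: le_expect => z _; apply: upper.
have el : prob R Nq (fun z => T z <= a) - eps / 3 <= expect Nq (fun z => p.[expR (- lam * T z)]).
  rewrite prob_expect -[X in _ - X](@expect_cst R N Q Nq NqN) -expectB.
  by apply: le_expect => z _; apply: lower.
by move: cle; rewrite ler_norml => /andP[? ?]; split; lra.
Qed.

End OneMatrix.

(** The brackets from [x - h] to [x] and from [x] to [x + h] cost only the Gaussian mass near [x],
    small by continuity. The polynomial approximation lives on the half line, so [x - h] has to stay
    nonnegative; hence [0 < x]. *)
Theorem laplace_cdf n (W : 'M[R]_n.+1) (w x eps : R) : W^T = W -> 0 < w ->
  (forall i, w <= W i i) -> (forall v, 0 <= gqform W v) -> 0 < x -> 0 < eps ->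
  exists Th d, [/\ 0 < d, 0 <= Th & forall N Q (Nq : 'I_Q -> nat) (T : {ffun 'I_N -> 'I_Q} -> R),
  (\sum_q Nq q)%N = N -> (forall z, 0 <= T z) ->
  (forall th, 0 <= th <= Th ->
     `|expect Nq (fun z => expR (- th * T z)) - gaussE (fun v => expR (- th * gqform W v))| <= d) ->
  `|prob R Nq (fun z => T z <= x) - gauss_qf_cdf W x| <= eps].
Proof.
move=> sW w0 Ww W0 x0 e0; have e2 : 0 < eps / 2 by rewrite divr_gt0.
have [d d0 dP] := gauss_qf_cdf_continuous x sW w0 Ww e2.
pose h := Num.min d (x / 2); have h0 : 0 < h by rewrite lt_min d0 divr_gt0.
have hd : h <= d by rewrite ge_min lexx.
have hx : h <= x / 2 by rewrite ge_min lexx orbT.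
have a0 : 0 <= x - h by lra.
have [|Th1 [d1 [d10 Th10 P1]]] := laplace_bracket W0 a0 _ e2 (b := x); first by lra.
have [|Th2 [d2 [d20 Th20 P2]]] := laplace_bracket W0 (ltW x0) _ e2 (b := x + h); first by lra.
exists (Num.max Th1 Th2), (Num.min d1 d2); split; rewrite ?lt_min ?d10 ?le_max ?Th10 //.
move=> N Q Nq T NqN T0 close.
have [|_ L] := P1 N Q Nq T NqN T0.
  move=> th /andP[t0 t1]; apply: (le_trans (close _ _)); last by rewrite ge_min lexx.
  by rewrite t0 le_max t1.
have [|U _] := P2 N Q Nq T NqN T0.
  move=> th /andP[t0 t1]; apply: (le_trans (close _ _)); last by rewrite ge_min lexx orbT.
  by rewrite t0 le_max t1 orbT.
have := dP (x - h); have := dP (x + h).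
rewrite addrAC subrr add0r ger0_norm ?(ltW h0) // => /(_ hd); rewrite ler_norml => /andP[_ B1].
rewrite addrAC subrr add0r normrN ger0_norm ?(ltW h0) // => /(_ hd); rewrite ler_norml => /andP[B2 _].
by rewrite ler_norml; apply/andP; split; lra.
Qed.

End LaplaceCdf.

(** * Chi-square distributions approximated by random designs *)

Section ChiSquare.
Variable R : realType.
Local Notation Phi := (@std_normal_cdf R).

(** The units are triples of a coordinate, an index below [M] and a sign; two groups of equal size
    flip or keep the sign. Then [E U U^T] is [c^2 2 M N / (N - 1)] times the identity, which
    determines [c]; and [N e^2 = 16 H - 8 / M], whence [kap = 16]. *)
Lemma rademacher_array (H M : nat) : (0 < H)%N -> (0 < M)%N ->
  exists (N Q : nat) (Nq : 'I_Q -> nat) (a : 'I_N -> 'I_Q -> 'cV[R]_H) (e : R),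
    (M <= N)%N /\ standardized_array Nq a e 16.
Proof.
move=> H0 M0; pose T := ('I_H * 'I_M * bool)%type; pose N := #|{: T}|.
have cT : N = (H * M * 2)%N by rewrite /N !card_prod !card_ord card_bool.
have N2 : (2 <= N)%N by rewrite cT leq_pmull // muln_gt0 H0.
have Np : 0 < N%:R :> R by rewrite ltr0n ltnW.
have N1p : 0 < N%:R - 1 :> R by rewrite subr_gt0 ltr1n.
have MR : 0 < M%:R :> R by rewrite ltr0n.
have NR : N%:R = H%:R * M%:R * 2 :> R by rewrite cT !natrM.
pose c : R := Num.sqrt ((N%:R - 1) / (2 * M%:R * N%:R)).
have c2 : c ^+ 2 = (N%:R - 1) / (2 * M%:R * N%:R).
  by rewrite sqr_sqrtr // divr_ge0 ?(ltW N1p) // !mulr_ge0 // ltW.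
pose sg (b : bool) : R := if b then 1 else -1.
pose a (i : 'I_N) (q : 'I_2) : 'cV[R]_H :=
  (c * sg (q == 0) * sg (enum_val i).2) *: delta_mx (enum_val i).1.1 0.
have aE i q h : a i q h 0 = c * sg (q == 0) * sg (enum_val i).2 * (h == (enum_val i).1.1)%:R.
  by rewrite !mxE andbT.
have sumT (f : T -> R) : \sum_(i < N) f (enum_val i) = \sum_(h < H) \sum_(m < M) (f (h, m, true) + f (h, m, false)).
  rewrite -(big_enum_val f) /= pair_big /= (eq_bigr (fun t : T => f (t.1, t.2))) => [|[]] //.
  rewrite -(pair_big (fun _ => true) (fun _ => true) (fun (p : 'I_H * 'I_M) b => f (p, b))) /=.
  by apply: eq_bigr => [[h m]] _; rewrite big_bool.
have ac q h : \sum_i a i q h 0 = 0.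
  under eq_bigr do rewrite aE.
  rewrite (sumT (fun t => c * sg (q == 0) * sg t.2 * (h == t.1.1)%:R)) /=.
  by rewrite big1 // => h' _; rewrite big1 // => m _; rewrite /sg; ring.
have aa q q' h k : \sum_i a i q h 0 * a i q' k 0 = c ^+ 2 * (2 * M%:R) * (sg (q == 0) * sg (q' == 0)) * (h == k)%:R.
  under eq_bigr do rewrite !aE.
   rewrite (sumT (fun t => c * sg (q == 0) * sg t.2 * (h == t.1.1)%:R *
     (c * sg (q' == 0) * sg t.2 * (k == t.1.1)%:R))) /=.
  rewrite (bigD1 h) //= [X in _ + X]big1 ?addr0 => [|h' hh]; last first.
    by rewrite big1 // => m _; rewrite [h == h']eq_sym (negbTE hh) /=; ring.
  rewrite sumr_const card_ord eqxx -[_ *+ M]mulr_natl [k == h]eq_sym /sg /=. ring.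
pose Nq (q : 'I_2) := (H * M)%N.
have NqN : (\sum_q Nq q)%N = N by rewrite sum_nat_const card_ord cT mulnC.
exists N, 2%N, Nq, a, (4 * c); split.
  by rewrite cT -mulnA mulnCA leq_pmulr // muln_gt0 H0.
split.
- by rewrite (ltnW N2).
- by move=> q; apply/matrixP => h j; rewrite ord1 summxE ac mxE.
- split; first by rewrite mulr_ge0 // sqrtr_ge0.
  move=> i q; rewrite (_ : sqnorm _ = c ^+ 2); first by rewrite le_eqVlt; apply/orP; left; apply/eqP; ring.
  rewrite /sqnorm (bigD1 (enum_val i).1.1) //= big1 ?addr0 => [|h hh]; last first.
    by rewrite aE (negbTE hh) mulr0 expr0n.
  by rewrite aE eqxx /sg /=; do 2 case: ifP => _; ring.
- move=> h k.
  transitivity (expect Nq (fun z => (\sum_i a i (z i) h 0) * (\sum_i a i (z i) k 0))).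
    by apply: eq_expect => z _; rewrite /assignment_sum !summxE.
  rewrite (@expect_mul_centered _ _ _ _ NqN _ (fun i q => a i q h 0) (fun i q => a i q k 0)) ?(ltnW N2) //.
  under eq_bigr do rewrite aa.
  under [X in _ - X]eq_bigr do under eq_bigr do rewrite aa.
  rewrite !big_ord_recl !big_ord0 /= !addr0 /Nq natrM c2 NR /sg /=.
  have H_neq0 : H%:R != 0 :> R by rewrite pnatr_eq0 -lt0n.
  by field; rewrite H_neq0 (gt_eqF MR) -NR (gt_eqF N1p).
- split; first by rewrite ler1n.
  rewrite exprMn c2 NR.
  have H_neq0 : H%:R != 0 :> R by rewrite pnatr_eq0 -lt0n.
  have -> : H%:R * M%:R * 2 * (4 ^+ 2 * ((H%:R * M%:R * 2 - 1) / (2 * M%:R * (H%:R * M%:R * 2)))) =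
    16 * H%:R - 8 / M%:R :> R by field; rewrite H_neq0 gt_eqF.
  by rewrite gerBl divr_ge0 // ltW.
Qed.

Lemma gqformT n (W : 'M[R]_n) v : gqform W v = qform W v^T.
Proof. by rewrite /gqform /qform trmxK. Qed.

Lemma gqform_ge0 n (W : 'M[R]_n) v : is_psd W -> 0 <= gqform W v.
Proof. by move=> pW; rewrite gqformT; exact: pW.2. Qed.

Lemma qformZ n (W : 'M[R]_n) c v : qform (c *: W) v = c * qform W v.
Proof. by rewrite /qform -scalemxAr -scalemxAl mxE. Qed.

Lemma psdZ n (W : 'M[R]_n) c : 0 <= c -> is_psd W -> is_psd (c *: W).
Proof.
move=> c0 [sW pW]; split; first by rewrite linearZ /= sW.
by move=> v; rewrite qformZ mulr_ge0.
Qed.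

Lemma psd_trace_ge0 n (W : 'M[R]_n) : is_psd W -> 0 <= \tr W.
Proof. by move=> pW; apply: sumr_ge0 => i _; rewrite -qform_delta; exact: pW.2. Qed.

Lemma gaussE_exp_gqform n (W : 'M[R]_n) th : is_psd W -> 0 <= th ->
  gaussE (fun v => expR (- th * gqform W v)) = (Num.sqrt (\det (1%:M + (2 * th) *: W)))^-1.
Proof.
move=> pW t0; have := gaussE_exp_quad 0 0 (psdZ (mulr_ge0 (ler0n R 2) t0) pW).
rewrite !mul0mx [X in 2^-1 * X]mxE mulr0 addr0 expR0 mulr1 => <-.
apply: eq_gaussE => v; rewrite trmx0 mulmx0 [X in _ + X + _]mxE !addr0.
by rewrite (gqformT (_ *: _)) qformZ -gqformT; congr expR; field.
Qed.

Lemma laplace_array (N Q H : nat) (Nq : 'I_Q -> nat) (a : 'I_N -> 'I_Q -> 'cV[R]_H) (e kap : R)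
    (W : 'M[R]_H) th Th :
  standardized_array Nq a e kap -> is_psd W -> 0 <= th <= Th ->
  `|expect Nq (fun z => expR (- th * qform W (assignment_sum a z))) -
    gaussE (fun v => expR (- th * gqform W v))| <=
  50 * (1 + 2 * Th * \tr W) ^+ 3 * kap ^+ 4 * (H%:R ^+ 4 * (Num.sqrt N%:R)^-1).
Proof.
move=> arr pW /andP[t0 tT]; rewrite gaussE_exp_gqform //.
have t20 : 0 <= 2 * th by rewrite mulr_ge0.
have W0 := psd_trace_ge0 pW.
rewrite (eq_expect (g := fun z => expR (- 2^-1 * qform ((2 * th) *: W) (assignment_sum a z)))); last first.
  by move=> z _; rewrite qformZ; congr expR; field.
apply: (le_trans (laplace_psd arr (psdZ t20 pW))).
have [_ _ _ _ [k1 _]] := arr.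
have k0 : 0 <= kap := le_trans ler01 k1.
apply: ler_wpM2r; first by rewrite mulr_ge0 ?exprn_ge0 ?invr_ge0 ?sqrtr_ge0.
apply: ler_wpM2r; first exact: exprn_ge0.
rewrite ler_wpM2l // mxtraceZ lerXn2r ?nnegrE ?addr_ge0 ?mulr_ge0 //.
  exact: le_trans tT.
by rewrite lerD2l ler_wpM2r // ler_wpM2l.
Qed.

Lemma large_sample (H : nat) (eta : R) : 0 < eta ->
  exists2 M : nat, (0 < M)%N & forall N, (M <= N)%N -> H%:R ^+ 4 * (Num.sqrt N%:R)^-1 <= eta.
Proof.
move=> e0; pose b : R := (H%:R ^+ 4 / eta) ^+ 2.
exists (Num.Def.archi_bound b).+1 => // N MN.
have b0 : 0 <= H%:R ^+ 4 / eta by rewrite divr_ge0 ?exprn_ge0 // ltW.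
have bN : b <= N%:R.
  apply/ltW/(lt_le_trans (archi_boundP (sqr_ge0 _))).
  by rewrite ler_nat ltnW.
have N0 : 0 < Num.sqrt N%:R :> R by rewrite sqrtr_gt0 ltr0n (leq_trans _ MN).
rewrite ler_pdivrMr // mulrC -ler_pdivrMr // -(ger0_norm b0) -sqrtr_sqr.
exact: ler_wsqrtr.
Qed.

Lemma qform1_gqform n (v : 'rV[R]_n) : gqform 1%:M v = sqnorm v^T.
Proof. by rewrite gqformT qform1. Qed.

(** At fixed [H] the number of signs can be raised until the distribution function is as close as
    desired. Facts about finite averages thereby pass to [chi2_cdf]. *)
Lemma chi2_realized (H : nat) (x eps eta : R) : (0 < H)%N -> 0 < x -> 0 < eps -> 0 < eta ->
  exists (N Q : nat) (Nq : 'I_Q -> nat) (a : 'I_N -> 'I_Q -> 'cV[R]_H) (e : R),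
  [/\ standardized_array Nq a e 16, H%:R ^+ 4 * (Num.sqrt N%:R)^-1 <= eta &
      `|prob R Nq (fun z => sqnorm (assignment_sum a z) <= x) - chi2_cdf H x| <= eps].
Proof.
case: H => // n _ x0 e0 et0.
have [|||Th [d [d0 Th0 P]]] := @laplace_cdf R n 1%:M 1 x eps _ ltr01 _ _ x0 e0.
- by rewrite trmx1.
- by move=> i; rewrite mxE eqxx.
- by move=> v; apply: gqform_ge0; exact: psd1.
pose C : R := 50 * (1 + 2 * Th * \tr (1%:M : 'M[R]_n.+1)) ^+ 3 * 16 ^+ 4.
have C0 : 0 < C.
  apply: mulr_gt0; last exact: exprn_gt0.
  apply: mulr_gt0 => //; apply: exprn_gt0; apply: ltr_pwDl => //.
  by apply: mulr_ge0; [exact: mulr_ge0|exact: psd_trace_ge0 (psd1 _ _)].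
have et' : 0 < Num.min eta (d / C) by rewrite lt_min et0 divr_gt0.
have [M M0 large] := large_sample n.+1 et'.
have [N [Q [Nq [a [e [MN arr]]]]]] := rademacher_array (ltn0Sn n) M0.
have := large N MN; rewrite le_min => /andP[l1 l2].
exists N, Q, Nq, a, e; split=> //; have [[NqN _ _] _ _ _ _] := arr.
apply: P => // [z|th thT]; first exact: sqnorm_ge0.
have := laplace_array arr (psd1 _ _) thT.
under eq_expect do rewrite qform1.
move=> h; apply: (le_trans h); rewrite -/C mulrC -ler_pdivlMr //.
Qed.

(** Markov's inequality, taken over from the array sums, for which [E |U|^2 = H] is a finite
    computation. *)
Lemma chi2_tail (H : nat) (x : R) : (0 < H)%N -> 0 < x -> 1 - H%:R / x <= chi2_cdf H x.
Proof.
move=> H0 x0; rewrite -subr_ge0 leNgt; apply/negP => h.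
pose eps := - (chi2_cdf H x - (1 - H%:R / x)) / 2.
have e0 : 0 < eps by rewrite /eps; lra.
have [N [Q [Nq [a [e [arr _]]]]]] := chi2_realized H0 x0 e0 ltr01.
have [[NqN _ _] _ _ iso _] := arr; rewrite prob_expect => close.
have := @le_expect R N Q Nq (fun z => 1 - x^-1 * sqnorm (assignment_sum a z))
  (fun z => ((sqnorm (assignment_sum a z) <= x)%R)%:R).
rewrite expectB expectZ (expect_sqnorm iso) expect_cst // => L.
have {}L : 1 - x^-1 * H%:R <= expect Nq (fun z => ((sqnorm (assignment_sum a z) <= x)%R)%:R).
  apply: L => z _; have s0 := sqnorm_ge0 (assignment_sum a z).
  have [_|hx] := leP (sqnorm (assignment_sum a z)) x; first by rewrite gerBl mulr_ge0 // invr_ge0 ltW.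
  by rewrite subr_le0 mulrC ler_pdivlMr // mul1r ltW.
move: close; rewrite ler_norml mulrC in L *; move: L; rewrite /eps => L /andP[_ U].
move: U L h; lra.
Qed.

(** For each large [H] the array is taken with [N] so large that both approximations hold for it:
    [|U|^2] is close to [chi^2(H)] and, standardized, to the normal law. *)
Theorem chi2_clt (z eps : R) : 0 < eps -> exists H0 : nat, forall H : nat, (H0 <= H)%N ->
  `|chi2_cdf H (H%:R + Num.sqrt (2 * H%:R) * z) - Phi z| <= eps.
Proof.
move=> e0; have e2 : 0 < eps / 2 by rewrite divr_gt0.
have d01 : 0 < (1 : R) <= 1 by rewrite ltr01 lexx.
have k1 : 1 <= 16 :> R by rewrite ler1n.
have [eta et0 clt] := standardized_clt z k1 d01 e2.
(* [H > 1 / eta] serves the normal limit; [H > 2 z^2] makes [H + sqrt (2 H) z] positive, as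
   [chi2_realized] requires. *)
exists (Num.Def.archi_bound (Num.max eta^-1 (2 * z ^+ 2))).+1 => H HH.
have HR : Num.max eta^-1 (2 * z ^+ 2) < H%:R.
  apply: (lt_le_trans (archi_boundP _)); last by rewrite ler_nat ltnW.
  by rewrite le_max mulr_ge0 ?sqr_ge0 ?orbT.
move: HR; rewrite gt_max => /andP[He Hz].
have H0 : (0 < H)%N by apply: leq_trans HH.
have HR : 0 < H%:R :> R by rewrite ltr0n.
pose s : R := Num.sqrt (2 * H%:R).
have s0 : 0 < s by rewrite sqrtr_gt0 mulr_gt0.
have s2 : s ^+ 2 = 2 * H%:R by rewrite sqr_sqrtr // mulr_ge0 // ltW.
have x0 : 0 < H%:R + s * z.
  rewrite ltNge; apply/negP => le0.
  have : H%:R <= s * (- z) by rewrite mulrN; lra.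
  move=> h; have : H%:R ^+ 2 <= (s * - z) ^+ 2 by rewrite lerXn2r ?nnegrE ?(ltW HR) // (le_trans _ h) // ltW.
  rewrite exprMn s2 sqrrN expr2 => h2.
  suff : 0 < H%:R * (H%:R - 2 * z ^+ 2) :> R by lra.
  by rewrite mulr_gt0 // subr_gt0.
have [N [Q [Nq [a [e [arr He4 close]]]]]] := chi2_realized H0 x0 e2 et0.
have HI : H%:R^-1 <= eta by rewrite -[eta]invrK lef_pV2 ?posrE ?invr_gt0 // ltW.
have trE : \tr ((1%:M : 'M[R]_H) *m 1%:M) = H%:R by rewrite mulmx1 mxtrace1.
have cB : psd_contraction (1%:M : 'M[R]_H) by split; [exact: psd1|move=> v; rewrite qform1].
have := clt N Q H Nq a e 1%:M arr cB; rewrite trE mul1r => /(_ (lexx _) HI He4).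
have -> : prob R Nq (fun z0 => standardized_qform a 1%:M z0 <= z) =
  prob R Nq (fun z0 => sqnorm (assignment_sum a z0) <= H%:R + s * z).
  rewrite !prob_expect; apply: eq_expect => z0 _.
  rewrite /standardized_qform trE -/s qform1 mxtrace1 ler_pdivrMr // lerBlDr.
  by rewrite addrC (mulrC z).
move: close; rewrite -/s !ler_norml => /andP[? ?] /andP[? ?]; apply/andP; split; lra.
Qed.

End ChiSquare.

(** * Quantiles and limits of the test statistic *)

Section Quantile.
Variable R : realType.
Variables (H : nat) (alpha : R).
Hypothesis H_gt0 : (0 < H)%N.
Hypothesis alpha01 : 0 < alpha < 1.
Local Notation q := (chi2_upper_quantile H alpha).
Let A := [set x : R | 1 - alpha <= chi2_cdf H x].

Let A_nonempty : A !=set0.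
Proof.
have /andP[a0 a1] := alpha01; have H0 : 0 < H%:R :> R by rewrite ltr0n.
have x0 : 0 < H%:R / alpha by rewrite divr_gt0.
exists (H%:R / alpha); rewrite /A /=; have := chi2_tail H_gt0 x0.
by rewrite invf_div mulrCA mulfV ?mulr1 // gt_eqF.
Qed.

Let A_lower x : (forall y, y < x -> chi2_cdf H y < 1 - alpha) -> lbound A x.
Proof.
by move=> lt_x y Ay; rewrite leNgt; apply/negP => /lt_x; rewrite ltNge => /negP; apply.
Qed.

Let A_lbound : lbound A 0.
Proof.
have /andP[a0 a1] := alpha01; apply: A_lower => y y0.
rewrite /chi2_cdf gauss_qf_cdf_lt0 ?subr_gt0 // => v; apply: gqform_ge0; exact: psd1.
Qed.

Lemma chi2_quantile_ge x : chi2_cdf H x < 1 - alpha -> x <= q.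
Proof.
move=> hx; apply: lb_le_inf => //; apply: A_lower => y yx.
by apply: le_lt_trans hx; apply: gauss_qf_cdf_homo; exact: ltW.
Qed.

(** The quantile is an infimum; continuity of the distribution function makes it attain the
    level. *)
Lemma chi2_cdf_quantile : 1 - alpha <= chi2_cdf H q.
Proof.
have : [set x : R | 1 - alpha <= chi2_cdf H x] !=set0 := A_nonempty.
have : lbound [set x : R | 1 - alpha <= chi2_cdf H x] 0 := A_lbound.
rewrite /chi2_upper_quantile; case: H H_gt0 => // n _ Al An.
rewrite leNgt; apply/negP => h.
pose eps := (1 - alpha - chi2_cdf n.+1 (inf [set x | 1 - alpha <= chi2_cdf n.+1 x])) / 2.
have e0 : 0 < eps by rewrite divr_gt0 // subr_gt0.
have [||d d0 dP] := @gauss_qf_cdf_continuous R n 1%:M 1 (inf [set x | 1 - alpha <= chi2_cdf n.+1 x]) eps _ ltr01 _ e0.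
- by rewrite trmx1.
- by move=> i; rewrite mxE eqxx.
have [|x Ax xd] := @inf_adherent R [set x | 1 - alpha <= chi2_cdf n.+1 x] d d0.
  by split=> //; exists 0.
set q := inf _ in h dP xd *.
have : chi2_cdf n.+1 x <= chi2_cdf n.+1 (q + d) by apply: gauss_qf_cdf_homo; exact: ltW.
have := dP (q + d); rewrite addrAC subrr add0r ger0_norm ?(ltW d0) // => /(_ (lexx _)).
rewrite ler_norml => /andP[_]; rewrite -!/(chi2_cdf _ _) => h1 h2.
have : 1 - alpha <= chi2_cdf n.+1 x by [].
move: h h1 h2; rewrite /eps -/q; lra.
Qed.

End Quantile.

Section ApproximateForms.
Variable R : realType.
Local Notation Phi := (@std_normal_cdf R).

(* [T] is, up to a vanishing error, the form [U^T W U] in a standardized array sum [U]. *)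
Definition approx_form (kap w C : R) (N Q H : nat) (Nq : 'I_Q -> nat) (W : 'M[R]_H)
    (T : {ffun 'I_N -> 'I_Q} -> R) : Prop :=
  exists (a : 'I_N -> 'I_Q -> 'cV[R]_H) (e : R),
  [/\ standardized_array Nq a e kap,
      psd_contraction W /\ (forall v, w * sqnorm v <= qform W v),
      w ^+ 2 * H%:R <= \tr (W *m W),
      forall z, 0 <= T z &
      forall t, 0 < t -> expect Nq (fun z => ((t < `|T z - qform W (assignment_sum a z)|)%R)%:R) <=
         C * (1 + t^-1) * (H%:R ^+ 4 * (Num.sqrt N%:R)^-1)].

(** The constants come before the design. The rate [H^2] of [That_approx] is relaxed to the [H^4] of
    the Stein bounds, so that a single small quantity governs all errors. *)
Lemma That_approx_form (clo chi sigF c c' Delta nu Slo : R) :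
  0 < clo -> clo <= chi -> 1 <= sigF -> 0 < c -> 0 < c' -> 0 < Slo ->
  exists kap w C : R, [/\ 1 <= kap, 0 < w <= 1, 0 < C &
  forall (N Q H : nat) (Nq : 'I_Q -> nat) (Y : 'M[R]_(N, Q)) (F : 'M[R]_(Q, H)),
  design_conditions clo chi sigF c c' Delta nu Slo Nq Y F -> (1 < N)%N -> (0 < H)%N ->
  approx_form kap w C Nq (W_N Nq Y F) (That Nq Y F)].
Proof.
move=> h1 h2 h3 h4 h5 h6.
exists (design_kappa clo chi sigF c c' nu Slo), (sigF ^+ 2)^-1,
  (1 + `|design_C clo chi sigF c c' nu Slo|); split.
- exact: design_kappa_ge1.
- by rewrite invr_gt0 exprn_gt0 ?(lt_le_trans ltr01) //= invf_le1 ?exprn_gt0 ?exprn_ege1 // (lt_le_trans ltr01).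
- by rewrite ltr_pwDl.
move=> N Q H Nq Y F DC N1 H0.
exists (std_contribution Nq Y F), (design_e clo chi sigF c c' nu Slo N H); split.
- exact: design_standardized DC N1 H0.
- split; first exact: W_contraction DC N1.
  by move=> v; apply: (W_lower _ _ _ _ _ DC N1).
- by rewrite -exprVn -exprM exprVn; apply: (W_trace_sqr _ _ _ _ _ DC N1).
- exact: That_ge0 DC.
move=> t t0; apply: (le_trans (That_approx h1 h2 h3 h4 h5 h6 DC N1 H0 t0)).
have t1 : 0 <= 1 + t^-1 by rewrite addr_ge0 // invr_ge0 ltW.
have s0 : 0 <= (Num.sqrt N%:R)^-1 :> R by rewrite invr_ge0 sqrtr_ge0.
apply: (@le_trans _ _ ((1 + `|design_C clo chi sigF c c' nu Slo|) * (1 + t^-1) * (H%:R ^+ 2 * (Num.sqrt N%:R)^-1))).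
  apply: ler_wpM2r; first by rewrite mulr_ge0 ?sqr_ge0.
  by apply: ler_wpM2r => //; apply: (le_trans (ler_norm _)); rewrite lerDr.
apply: ler_wpM2l; first by rewrite mulr_ge0 // addr_ge0.
by apply: ler_wpM2r => //; apply: ler_weXn2l => //; rewrite ler1n.
Qed.

Lemma qform_entry_le n (D : 'M[R]_n) (eta : R) (u : 'cV[R]_n) : (forall i j, `|D i j| <= eta) ->
  `|qform D u| <= eta * n%:R * sqnorm u.
Proof.
move=> De; rewrite qformE bformE.
have -> : eta * n%:R * sqnorm u = \sum_i \sum_j eta * 2^-1 * (u i 0 ^+ 2 + u j 0 ^+ 2).
  have -> : \sum_i \sum_j eta * 2^-1 * (u i 0 ^+ 2 + u j 0 ^+ 2) =
      \sum_(i < n) eta * 2^-1 * (n%:R * u i 0 ^+ 2 + sqnorm u).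
    apply: eq_bigr => i _; rewrite -mulr_sumr big_split /= sumr_const card_ord.
    by rewrite mulr_natl.
  rewrite -mulr_sumr big_split /= -mulr_sumr sumr_const card_ord -/(sqnorm u) -[_ *+ n]mulr_natl.
  by field.
apply: (le_trans (ler_norm_sum _ _ _)); apply: ler_sum => i _.
apply: (le_trans (ler_norm_sum _ _ _)); apply: ler_sum => j _.
rewrite !normrM.
have e0 : 0 <= eta := le_trans (normr_ge0 _) (De i j).
apply: (@le_trans _ _ (eta * (`|u i 0| * `|u j 0|))).
  by rewrite mulrAC mulrC ler_wpM2r // mulr_ge0.
rewrite -mulrA ler_wpM2l // -[u i 0 ^+ 2]real_normK ?num_real // -[u j 0 ^+ 2]real_normK ?num_real //.
have := sqr_ge0 (`|u i 0| - `|u j 0|); lra.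
Qed.

End ApproximateForms.

Section Limits.
Variable R : realType.
Local Notation Phi := (@std_normal_cdf R).

Lemma exp_neg_lip (th x y : R) : 0 <= th -> 0 <= x -> 0 <= y ->
  `|expR (- th * x) - expR (- th * y)| <= th * `|x - y|.
Proof.
move=> t0; wlog xy : x y / x <= y => [hw x0 y0|x0 y0].
  have [xy|yx] := leP x y; first exact: hw.
  by rewrite distrC (distrC x); apply: hw => //; exact: ltW.
have e1 : expR (- th * x) <= 1 by rewrite -expR0 ler_expR mulNr oppr_le0 mulr_ge0.
have e0 := expR_ge0 (- th * x).
have hd : 1 - th * (y - x) <= expR (- th * (y - x)) by rewrite mulNr expR_ge1Dx.
have d0 : 0 <= th * (y - x) by rewrite mulr_ge0 // subr_ge0.
have -> : expR (- th * y) = expR (- th * x) * expR (- th * (y - x)).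
  by rewrite -expRD; congr expR; ring.
have d1 : expR (- th * (y - x)) <= 1 by rewrite -expR0 ler_expR mulNr oppr_le0.
rewrite (distrC x) (ger0_norm (x := y - x)) ?subr_ge0 // ger0_norm; last first.
  by rewrite subr_ge0 ler_piMr.
move: (expR (- th * x)) (expR (- th * (y - x))) (th * (y - x)) e1 e0 hd d0 d1 => a b c; nra.
Qed.

Lemma exp_neg_close (th Th t x y : R) : 0 <= th <= Th -> 0 < t -> 0 <= x -> 0 <= y ->
  `|expR (- th * x) - expR (- th * y)| <= Th * t + ((t < `|x - y|)%R)%:R.
Proof.
move=> /andP[t0 tT] tp x0 y0; have [h|h] := ltP t `|x - y|.
  have e1 u : 0 <= u -> 0 <= expR (- th * u) <= 1.
    by move=> u0; rewrite expR_ge0 -expR0 ler_expR mulNr oppr_le0 mulr_ge0.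
  have /andP[a0 a1] := e1 x x0; have /andP[b0 b1] := e1 y y0.
  have : 0 <= Th * t by rewrite mulr_ge0 ?(ltW tp) // (le_trans t0).
  by move=> ?; rewrite ler_norml; apply/andP; split; rewrite /=; lra.
rewrite addr0; apply: (le_trans (exp_neg_lip t0 x0 y0)).
by apply: ler_pM.
Qed.

(** The tolerance [d] for the transforms is spent in four quarters: the Lipschitz error [Th t], the
    probability that [T] is farther than [t] from its form, the change from [W] to [Winf], and the
    Gaussian limit for [Winf]. *)
Theorem fixed_dim_cdf n (kap w C : R) (Winf : 'M[R]_n.+1) (x eps : R) :
  1 <= kap -> 0 < w -> 0 < C -> psd_contraction Winf ->
  (forall v, w * sqnorm v <= qform Winf v) -> 0 < x -> 0 < eps ->
  exists2 eta : R, 0 < eta &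
  forall (N Q : nat) (Nq : 'I_Q -> nat) (W : 'M[R]_n.+1) T,
  approx_form kap w C (N := N) Nq W T -> (forall i j, `|W i j - Winf i j| <= eta) ->
  n.+1%:R ^+ 4 * (Num.sqrt N%:R)^-1 <= eta ->
  `|prob R Nq (fun z => T z <= x) - gauss_qf_cdf Winf x| <= eps.
Proof.
move=> k1 w0 C0 [pW cW] Ww x0 e0.
have Wd i : w <= Winf i i by rewrite -qform_delta -[X in X <= _]mulr1 -(sqnorm_delta R i).
have [Th [d [d0 Th0 P]]] := laplace_cdf pW.1 w0 Wd (fun v => gqform_ge0 v pW) x0 e0.
have k0 : 0 < kap := lt_le_trans ltr01 k1.
pose t : R := d / (4 * (Th + 1)).
have Th1 : 0 < Th + 1 by rewrite ltr_wpDl.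
have t0 : 0 < t by rewrite divr_gt0 // mulr_gt0.
have Tht : Th * t <= d / 4.
  rewrite /t; have -> : d / 4 = (Th + 1) * (d / (4 * (Th + 1))) by field; rewrite gt_eqF.
  by rewrite ler_wpM2r ?(ltW t0) // lerDl.
pose D1 := C * (1 + t^-1); pose D2 := 1 + Th * (n.+1%:R * n.+1%:R).
pose D3 := 50 * (1 + 2 * Th * \tr Winf) ^+ 3 * kap ^+ 4.
have D10 : 0 < D1 by rewrite mulr_gt0 // addr_gt0 // invr_gt0.
have D20 : 0 < D2 by apply: ltr_wpDr => //; apply: mulr_ge0 => //; exact: mulr_ge0.
have D30 : 0 < D3.
  apply: mulr_gt0; last exact: exprn_gt0.
  apply: mulr_gt0 => //; apply: exprn_gt0; apply: ltr_pwDl => //.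
  by apply: mulr_ge0; [exact: mulr_ge0|exact: psd_trace_ge0].
have S0 : 0 < D1 + D2 + D3 := addr_gt0 (addr_gt0 D10 D20) D30.
exists (d / (4 * (D1 + D2 + D3))); first by rewrite divr_gt0 // mulr_gt0.
set eta := d / _; move=> N Q Nq W T [a [e [arr [cWk _] _ T0 TW]]] close hN.
have eta0 : 0 < eta by rewrite divr_gt0 // mulr_gt0.
have De D : 0 <= D -> D <= D1 + D2 + D3 -> D * eta <= d / 4.
  move=> D0 DD; have -> : d / 4 = (D1 + D2 + D3) * eta.
    by rewrite /eta; field; rewrite gt_eqF.
  by rewrite ler_wpM2r // ltW.
have [[NqN _ _] _ _ iso _] := arr.
apply: P => // th thT.
pose U := assignment_sum a.
have s1 : `|expect Nq (fun z => expR (- th * T z)) - expect Nq (fun z => expR (- th * qform W (U z)))| <= d / 4 + d / 4.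
  rewrite -expectB; apply: (le_trans (normr_expect _ _)).
  apply: (@le_trans _ _ (expect Nq (fun z => Th * t + ((t < `|T z - qform W (U z)|)%R)%:R))).
    by apply: le_expect => z _; apply: exp_neg_close => //; exact: cWk.1.2.
  rewrite expectD expect_cst //; apply: lerD => //.
  apply: (le_trans (TW t t0)); apply: (@le_trans _ _ (D1 * eta)).
    by rewrite ler_wpM2l // ltW.
  by apply: De; rewrite ?(ltW D10) // -addrA lerDl addr_ge0 // ltW.
have s2 : `|expect Nq (fun z => expR (- th * qform W (U z))) - expect Nq (fun z => expR (- th * qform Winf (U z)))| <= d / 4.
  rewrite -expectB; apply: (le_trans (normr_expect _ _)).
  apply: (@le_trans _ _ (expect Nq (fun z => Th * (eta * n.+1%:R) * sqnorm (U z)))).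
    apply: le_expect => z _; have /andP[th0 thT'] := thT.
    apply: (le_trans (exp_neg_lip th0 (cWk.1.2 _) (pW.2 _))).
    rewrite -mulrA; apply: ler_pM => //.
    have -> : qform W (U z) - qform Winf (U z) = qform (W - Winf) (U z).
      by rewrite /qform mulmxBr mulmxBl [RHS]mxE [X in _ = _ + X]mxE.
    by apply: qform_entry_le => i j; have := close i j; rewrite 2!mxE.
  rewrite expectZ (expect_sqnorm iso).
  have -> : Th * (eta * n.+1%:R) * n.+1%:R = (Th * (n.+1%:R * n.+1%:R)) * eta by ring.
  apply: De; first by apply: mulr_ge0 => //; exact: mulr_ge0.
  apply: (@le_trans _ _ D2); first by rewrite lerDr.
  by rewrite addrAC lerDr addr_ge0 // ltW.
have s3 := laplace_array arr pW thT.
have {}s3 : `|expect Nq (fun z => expR (- th * qform Winf (U z))) - gaussE (fun v => expR (- th * gqform Winf v))| <= d / 4.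
  apply: (le_trans s3); rewrite -/D3; apply: (@le_trans _ _ (D3 * eta)).
    by rewrite ler_wpM2l // ltW.
  by apply: De; rewrite ?(ltW D30) // lerDr addr_ge0 // ltW.
move: s1 s2 s3; rewrite !ler_norml => /andP[l1 u1] /andP[l2 u2] /andP[l3 u3].
clear -l1 u1 l2 u2 l3 u3.
by apply/andP; split; lra.
Qed.

Lemma high_dim_clt (kap w C x eps : R) : 1 <= kap -> 0 < w <= 1 -> 0 < C -> 0 < eps ->
  exists2 eta : R, 0 < eta & forall (N Q H : nat) (Nq : 'I_Q -> nat) (W : 'M[R]_H) T,
  approx_form kap w C (N := N) Nq W T -> H%:R^-1 <= eta ->
  H%:R ^+ 4 * (Num.sqrt N%:R)^-1 <= eta ->
  `|prob R Nq (fun z => (T z - \tr W) / Num.sqrt (2 * \tr (W *m W)) <= x) - Phi x| <= eps.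
Proof.
move=> k1 /andP[w0 w1] C0 e0; have e3 : 0 < eps / 3 by rewrite divr_gt0.
have w2 : 0 < w ^+ 2 <= 1 by rewrite exprn_gt0 // exprn_ile1 // ltW.
have [eta1 eta10 P1] := standardized_clt (x - eps / 3) k1 w2 e3.
have [eta2 eta20 P2] := standardized_clt (x + eps / 3) k1 w2 e3.
(* The standard deviation [s] is at least [w], so an error of [t] in [T] moves the standardized
   value by at most [eps / 3]; [Phi] is 1-Lipschitz. *)
pose t := w * (eps / 3); have t0 : 0 < t by rewrite mulr_gt0.
pose D := C * (1 + t^-1).
have D0 : 0 < D by rewrite mulr_gt0 // addr_gt0 // invr_gt0.
exists (Num.min (eps / 3 / D) (Num.min eta1 eta2)).
  by rewrite !lt_min eta10 eta20 divr_gt0.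
move=> N Q H Nq W T [a [e [arr [cW _] trW _ TW]]].
rewrite !le_min => /and3P[_ hH1 hH2] /and3P[hN hN1 hN2].
have := P1 N Q H Nq a e W arr cW trW hH1 hN1; have := P2 N Q H Nq a e W arr cW trW hH2 hN2.
have [[NqN _ H0] _ _ _ _] := arr.
rewrite /standardized_qform; set s := Num.sqrt (2 * _); set U := assignment_sum a in TW *.
have sw : w <= s.
  rewrite -(ger0_norm (ltW w0)) -sqrtr_sqr; apply: ler_wsqrtr.
  have h1 : 1 <= H%:R :> R by rewrite ler1n.
  have : w ^+ 2 * 1 <= w ^+ 2 * H%:R by rewrite ler_wpM2l // sqr_ge0.
  have := sqr_ge0 w; lra.
have s0 : 0 < s := lt_le_trans w0 sw.
have err := le_trans (TW t t0) (ler_wpM2l (ltW D0) hN).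
have {}err : expect Nq (fun z => ((t < `|T z - qform W (U z)|)%R)%:R) <= eps / 3.
  by apply: (le_trans err); rewrite mulrC divfK // gt_eqF.
have ts : t <= s * (eps / 3) by rewrite ler_wpM2r // ltW.
have up : prob R Nq (fun z => (T z - \tr W) / s <= x) <=
    prob R Nq (fun z => (qform W (U z) - \tr W) / s <= x + eps / 3) + eps / 3.
  apply: le_trans (lerD (lexx _) err); rewrite !prob_expect -expectD; apply: le_expect => z _.
  have [h1|_] := leP ((T z - \tr W) / s) x; last by rewrite addr_ge0.
  have [h2|h2] := ltP t `|T z - qform W (U z)|; first by rewrite lerDr.
  rewrite addr0 ler_nat; move: h1; rewrite !ler_pdivrMr //.
  move: h2; rewrite ler_norml => /andP[h2 h3] h1.
  suff -> : qform W (U z) - \tr W <= (x + eps / 3) * s by [].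
  by rewrite mulrDl (mulrC (eps / 3)); lra.
have dn : prob R Nq (fun z => (qform W (U z) - \tr W) / s <= x - eps / 3) <=
    prob R Nq (fun z => (T z - \tr W) / s <= x) + eps / 3.
  apply: le_trans (lerD (lexx _) err); rewrite !prob_expect -expectD; apply: le_expect => z _.
  have [h1|_] := leP ((qform W (U z) - \tr W) / s) (x - eps / 3); last by rewrite addr_ge0.
  have [h2|h2] := ltP t `|T z - qform W (U z)|; first by rewrite lerDr.
  rewrite addr0 ler_nat; move: h1; rewrite !ler_pdivrMr //.
  move: h2; rewrite ler_norml => /andP[h2 h3] h1.
  suff -> : T z - \tr W <= x * s by [].
  by move: h1; rewrite mulrBl (mulrC (eps / 3)); lra.
have l1 := std_normal_cdf_lip (x + eps / 3) x; have l2 := std_normal_cdf_lip x (x - eps / 3).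
have d1 : `|x + eps / 3 - x| = eps / 3 by rewrite addrAC subrr add0r gtr0_norm.
have d2 : `|x - (x - eps / 3)| = eps / 3 by rewrite opprB addrC subrK gtr0_norm.
move: l1 l2; rewrite d1 d2 !ler_norml => /andP[_ l1] /andP[_ l2] /andP[_ c1] /andP[c2 _].
clear -l1 l2 c1 c2 up dn.
by apply/andP; split; lra.
Qed.

End Limits.

Section Quantiles.
Variable R : realType.
Local Notation Phi := (@std_normal_cdf R).

Lemma std_normal_cdf_surj (p : R) : 0 < p < 1 -> exists z, Phi z = p.
Proof.
move=> /andP[p0 p1]; have [u uP] := @std_normal_cdf_near0 R p p0.
have q0 : 0 < 1 - p by rewrite subr_gt0.
have [v v0 vP] := @std_normal_cdf_near1 R (1 - p) q0.
have uv : u <= v.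
  rewrite leNgt; apply/negP => vu; have := @std_normal_cdf_le R v u (ltW vu); lra.
have [||z _ zP] := @IVT R Phi u v p uv; last by exists z.
  by apply: continuous_subspaceT; exact: std_normal_cdf_continuous.
by rewrite ge_min le_max (ltW uP) /= orbC; apply/orP; left; lra.
Qed.

(** As [W] is a contraction, [T] is at most [|U|^2 + t] with high probability, so the normal limit
    is applied with [B = 1], whose mean and scale [H] and [sqrt (2 H)] are those of [chi^2(H)]. The
    quantile is then compared at the same centering. *)
Lemma high_dim_quantile (kap w C alpha eps : R) : 1 <= kap -> 0 < C ->
  0 < alpha < 1 -> 0 < eps ->
  exists (eta : R) (H0 : nat), 0 < eta /\
  forall (N Q H : nat) (Nq : 'I_Q -> nat) (W : 'M[R]_H) T,
  approx_form kap w C (N := N) Nq W T -> (H0 <= H)%N ->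
  H%:R ^+ 4 * (Num.sqrt N%:R)^-1 <= eta ->
  1 - alpha - eps <= prob R Nq (fun z => T z <= chi2_upper_quantile H alpha).
Proof.
move=> k1 C0 alpha01 e0; have /andP[a0 a1] := alpha01.
have e4 : 0 < eps / 4 by rewrite divr_gt0.
(* A level strictly between 0 and [1 - alpha]: the gap to [1 - alpha] absorbs the error of
   [chi2_clt] and places the normal quantile below the chi-square one. *)
pose p := Num.max ((1 - alpha) / 2) (1 - alpha - eps / 4).
have p01 : 0 < p < 1.
  rewrite lt_max gt_max; apply/andP; split; first by apply/orP; left; lra.
  by apply/andP; split; lra.
have pe : 1 - alpha - eps / 4 <= p by rewrite le_max lexx orbT.
have pa : p < 1 - alpha by rewrite gt_max; apply/andP; split; lra.
have [x xP] := std_normal_cdf_surj p01.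
have d01 : 0 < (1 : R) <= 1 by rewrite ltr01 lexx.
have [eta1 eta10 clt] := standardized_clt (x - eps / 4) k1 d01 e4.
pose g := (1 - alpha - p) / 2; have g0 : 0 < g by rewrite /g; lra.
have [H1 chi] := chi2_clt x g0.
pose t := eps / 4; pose D := C * (1 + t^-1).
have D0 : 0 < D by rewrite mulr_gt0 // addr_gt0 // invr_gt0.
exists (Num.min (eps / 4 / D) eta1), (maxn H1 (Num.Def.archi_bound eta1^-1).+1).
split; first by rewrite lt_min eta10 divr_gt0.
move=> N Q H Nq W T [a [e [arr [cW _] _ _ TW]]]; rewrite geq_max => /andP[HH1 HH2].
rewrite le_min => /andP[hN hN1]; have [[NqN _ H0] _ _ _ _] := arr.
have HR : 1 <= H%:R :> R by rewrite ler1n.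
have HI : H%:R^-1 <= eta1.
  have HR0 : 0 < H%:R :> R := lt_le_trans ltr01 HR.
  have i0 : 0 <= eta1^-1 by rewrite invr_ge0 ltW.
  rewrite -[eta1]invrK lef_pV2 ?posrE ?invr_gt0 //.
  apply/ltW/(lt_le_trans (archi_boundP i0)).
  by rewrite ler_nat ltnW.
pose s : R := Num.sqrt (2 * H%:R).
have s1 : 1 <= s by rewrite -[X in X <= _]sqrtr1 ler_wsqrtr //; lra.
have s0 : 0 < s := lt_le_trans ltr01 s1.
have q_ge : H%:R + s * x <= chi2_upper_quantile H alpha.
  apply: chi2_quantile_ge => //; have := chi H HH1; rewrite -/s xP ler_norml => /andP[_].
  by rewrite /g; lra.
have trE : \tr ((1%:M : 'M[R]_H) *m 1%:M) = H%:R by rewrite mulmx1 mxtrace1.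
have c1 : psd_contraction (1%:M : 'M[R]_H) by split; [exact: psd1|move=> v; rewrite qform1].
have tr1 : 1 * H%:R <= \tr ((1%:M : 'M[R]_H) *m 1%:M) by rewrite trE mul1r.
have := clt N Q H Nq a e 1%:M arr c1 tr1 HI hN1.
have err : expect Nq (fun z => ((t < `|T z - qform W (assignment_sum a z)|)%R)%:R) <= eps / 4.
  apply: (le_trans (le_trans (TW t e4) (ler_wpM2l (ltW D0) hN))).
  by rewrite mulrC divfK // gt_eqF.
have le_T : prob R Nq (fun z => standardized_qform a 1%:M z <= x - eps / 4) <=
    prob R Nq (fun z => T z <= chi2_upper_quantile H alpha) + eps / 4.
  apply: le_trans (lerD (lexx _) err); rewrite !prob_expect -expectD; apply: le_expect => z _.
  have [h1|_] := leP (standardized_qform a 1%:M z) (x - eps / 4); last by rewrite addr_ge0.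
  have [h2|h2] := ltP t `|T z - qform W (assignment_sum a z)|; first by rewrite lerDr.
  rewrite addr0 ler_nat.
  suff -> : T z <= chi2_upper_quantile H alpha by [].
  apply: le_trans q_ge; move: h1 h2.
  rewrite /standardized_qform trE -/s qform1 mxtrace1 ler_pdivrMr // ler_norml => h1 /andP[_ h2].
  have := cW.2 (assignment_sum a z); have : eps / 4 <= eps / 4 * s by rewrite ler_peMr // ltW.
  move: h1 h2; rewrite mulrBl (mulrC x) /t; lra.
have := std_normal_cdf_lip x (x - eps / 4).
have -> : `|x - (x - eps / 4)| = eps / 4 by rewrite opprB addrC subrK gtr0_norm.
rewrite xP !ler_norml => /andP[_ l1] /andP[l2 _]; lra.
Qed.

(** All the conditions are closed: each is verified for [Winf] up to an arbitrary [eps] on a nearby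
    [W]. *)
Lemma limit_contraction n (w : R) (Winf : 'M[R]_n) :
  (forall eta, 0 < eta -> exists W, [/\ psd_contraction W, forall v, w * sqnorm v <= qform W v &
     forall i j, `|W i j - Winf i j| <= eta]) ->
  psd_contraction Winf /\ forall v, w * sqnorm v <= qform Winf v.
Proof.
move=> lim.
have close v eps : 0 < eps -> exists W, [/\ psd_contraction W, w * sqnorm v <= qform W v &
    `|qform W v - qform Winf v| <= eps].
  move=> e0; have K0 : 0 < n%:R * sqnorm v + 1 :> R by rewrite ltr_wpDl // mulr_ge0 // sqnorm_ge0.
  have [W [cW wW WW]] := lim (eps / (n%:R * sqnorm v + 1)) (divr_gt0 e0 K0).
  exists W; split=> //.
  have -> : qform W v - qform Winf v = qform (W - Winf) v.
    by rewrite /qform mulmxBr mulmxBl [RHS]mxE [X in _ = _ + X]mxE.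
  apply: (le_trans (@qform_entry_le R n (W - Winf) _ v _)) => [i j|]; first by rewrite 2!mxE.
  by rewrite -mulrA mulrAC ler_pdivrMr // ler_wpM2l ?(ltW e0) // lerDl.
have sym i j : Winf j i = Winf i j.
  apply/eqP; rewrite -subr_eq0 -normr_le0; apply/ler_addgt0Pl => eps e0.
  have e2 : 0 < eps / 2 by rewrite divr_gt0.
  have [W [[[sW _] _] _ WW]] := lim _ e2.
  have := WW i j; have := WW j i; have -> : W j i = W i j by rewrite -[in LHS]sW mxE.
  by rewrite addr0 !ler_norml => /andP[? ?] /andP[? ?]; apply/andP; split; lra.
have lower v : w * sqnorm v <= qform Winf v.
  apply/ler_addgt0Pl => eps e0; have [W [_ wW]] := close v eps e0.
  by rewrite ler_norml => /andP[_ h]; lra.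
have psd v : 0 <= qform Winf v.
  apply/ler_addgt0Pl => eps e0; have [W [[pW _] _]] := close v eps e0.
  by rewrite ler_norml => /andP[_ h]; have := pW.2 v; lra.
have upper v : qform Winf v <= sqnorm v.
  apply/ler_addgt0Pl => eps e0; have [W [cW _]] := close v eps e0.
  by rewrite ler_norml => /andP[h _]; have := cW.2 v; lra.
split=> //; split=> //; split=> //; apply/matrixP => i j; rewrite mxE; exact: sym.
Qed.

Lemma prob_le (N Q : nat) (Nq : 'I_Q -> nat) (A B : {ffun 'I_N -> 'I_Q} -> bool) :
  (forall z, A z -> B z) -> prob R Nq A <= prob R Nq B.
Proof.
move=> AB; rewrite !prob_expect; apply: le_expect => z _; rewrite ler_nat.
by have := AB z; case: (A z) => // ->.
Qed.

(** For [x < 0] both sides vanish. At [x = 0] the probability is at most the one at a small [d > 0],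
    and by continuity the Gaussian distribution function at [d] is near its value at [- d], which is
    0. *)
Lemma fixed_dim_cdf_all n (kap w C : R) (Winf : 'M[R]_n.+1) (x eps : R) :
  1 <= kap -> 0 < w -> 0 < C -> psd_contraction Winf ->
  (forall v, w * sqnorm v <= qform Winf v) -> 0 < eps ->
  exists2 eta : R, 0 < eta &
  forall (N Q : nat) (Nq : 'I_Q -> nat) (W : 'M[R]_n.+1) T,
  approx_form kap w C (N := N) Nq W T -> (forall i j, `|W i j - Winf i j| <= eta) ->
  n.+1%:R ^+ 4 * (Num.sqrt N%:R)^-1 <= eta ->
  `|prob R Nq (fun z => T z <= x) - gauss_qf_cdf Winf x| <= eps.
Proof.
move=> k1 w0 C0 cW Ww e0; have pW := cW.1.
have Wd i : w <= Winf i i by rewrite -qform_delta -[X in X <= _]mulr1 -(sqnorm_delta R i).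
have W0 v : 0 <= gqform Winf v by exact: gqform_ge0.
have [x0|x0|->] := ltgtP x 0; [|exact: fixed_dim_cdf C0 cW Ww x0 e0|].
  exists 1 => // N Q Nq W T [a [e [[[NqN _ _] _ _ _ _] _ _ T0 _]]] _ _.
  rewrite gauss_qf_cdf_lt0 // subr0 prob_expect.
  rewrite (eq_expect (g := fun=> 0)) => [|z _]; last by rewrite leNgt (lt_le_trans x0 (T0 z)).
  by rewrite expect_cst // normr0 ltW.
have e4 : 0 < eps / 4 by rewrite divr_gt0.
have [d d0 dP] := gauss_qf_cdf_continuous 0 pW.1 w0 Wd e4.
have [eta et0 P] := fixed_dim_cdf k1 w0 C0 cW Ww d0 e4.
exists eta => // N Q Nq W T AF WW hN.
have := P N Q Nq W T AF WW hN; have := dP d; have := dP (- d).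
have nd : - d < 0 by rewrite oppr_lt0.
rewrite !subr0 normrN (gtr0_norm d0) (gauss_qf_cdf_lt0 W0 nd) sub0r normrN.
move=> /(_ (lexx _)) c0 /(_ (lexx _)) c1 c2.
have := gauss_qf_cdf_ge0 Winf 0.
have : prob R Nq (fun z => T z <= 0) <= prob R Nq (fun z => T z <= d).
  by apply: prob_le => z h; apply: le_trans h (ltW d0).
have : 0 <= prob R Nq (fun z => T z <= 0) by rewrite /prob divr_ge0.
move: c0 c1 c2; rewrite !ler_norml => /andP[? ?] /andP[? ?] /andP[? ?] ? ? ?.
by apply/andP; split; lra.
Qed.

(** The Stein bounds decay like [H^4 N^(-1/2)], and [H^4 <= H^(19/4)] for [H >= 1]. *)
Lemma powR_dimension (H N : nat) (eta : R) : (0 < H)%N ->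
  H%:R `^ (19 / 4) * N%:R `^ (- (1 / 2)) <= eta -> H%:R ^+ 4 * (Num.sqrt N%:R)^-1 <= eta.
Proof.
move=> H0; apply: le_trans; rewrite powRN mul1r powR12_sqrt //.
apply: ler_wpM2r; first by rewrite invr_ge0 sqrtr_ge0.
by rewrite -powR_mulrn //; apply: ler_powR; [rewrite ler1n|lra].
Qed.

End Quantiles.

Theorem theorem4 (R : realType)
    (clo chi sigF c c' Delta nu Slo alpha : R)
    (Hclo : 0 < clo) (Hchi : clo <= chi) (HsigF : 1 <= sigF)
    (Hc : 0 < c) (Hc' : 0 < c') (HSlo : 0 < Slo) (Halpha : 0 < alpha < 1) :
  (* (i) H fixed *)
  (forall (H : nat) (N Q : nat -> nat) (Nq : forall k, 'I_(Q k) -> nat)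
      (Y : forall k, 'M[R]_(N k, Q k)) (F : forall k, 'M[R]_(Q k, H))
      (Winf : 'M[R]_H),
    (0 < H)%N ->
    (forall M : nat, \forall k \near \oo, (M <= N k)%N) ->
    (forall k, design_conditions clo chi sigF c c' Delta nu Slo (Nq k) (Y k) (F k)) ->
    (forall i j, W_N (Nq k) (Y k) (F k) i j @[k --> \oo] --> Winf i j) ->
    [/\ (* \hat T converges in distribution to L = law of xi^T Winf xi *)
        (forall x : R, {for x, continuous (fun y : R => gauss_qf_cdf Winf y)} ->
           prob R (Nq k) (fun z => That (Nq k) (Y k) (F k) z <= x) @[k --> \oo]
             --> gauss_qf_cdf Winf x),
        (* L is stochastically dominated by chi^2(H) *)
        (forall x : R, chi2_cdf H x <= gauss_qf_cdf Winf x) &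
        (* lim P{ \hat T <= q_alpha } exists and is >= 1 - alpha *)
        exists l : R,
          prob R (Nq k) (fun z => That (Nq k) (Y k) (F k) z
                                <= chi2_upper_quantile H alpha) @[k --> \oo] --> l
          /\ 1 - alpha <= l])
  /\
  (* (ii) H -> oo with H^{19/4} N^{-1/2} -> 0 *)
  (forall (H N Q : nat -> nat) (Nq : forall k, 'I_(Q k) -> nat)
      (Y : forall k, 'M[R]_(N k, Q k)) (F : forall k, 'M[R]_(Q k, H k)),
    (forall M : nat, \forall k \near \oo, (M <= N k)%N) ->
    (forall M : nat, \forall k \near \oo, (M <= H k)%N) ->
    ((H k)%:R `^ (19 / 4) * (N k)%:R `^ (- (1 / 2)) @[k --> \oo] --> (0 : R)) ->
    (forall k, design_conditions clo chi sigF c c' Delta nu Slo (Nq k) (Y k) (F k)) ->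
    (* {\hat T - tr W_N} / sqrt(2 tr(W_N^2)) converges in distribution to N(0,1) *)
    (forall x : R,
       prob R (Nq k) (fun z => (That (Nq k) (Y k) (F k) z - \tr (W_N (Nq k) (Y k) (F k)))
                 / Num.sqrt (2 * \tr (W_N (Nq k) (Y k) (F k) *m W_N (Nq k) (Y k) (F k)))
                 <= x) @[k --> \oo]
         --> std_normal_cdf x)
    /\
    (* liminf P{ \hat T <= q_alpha } >= 1 - alpha *)
    (forall eps : R, 0 < eps ->
       \forall k \near \oo,
         1 - alpha - eps <=
         prob R (Nq k) (fun z => That (Nq k) (Y k) (F k) z
                               <= chi2_upper_quantile (H k) alpha))).
Proof.
have [kap [w [C [k1 w01 C0 AF]]]] := That_approx_form Delta nu Hclo Hchi HsigF Hc Hc' HSlo.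
have /andP[w0 w1] := w01.
split.
- case=> [//|n] N Q Nq Y F Winf _ Nlim DC Wlim.
  pose W k := W_N (Nq k) (Y k) (F k); pose T k := That (Nq k) (Y k) (F k).
  have Wnear eta : 0 < eta -> \forall k \near \oo, forall i j, `|W k i j - Winf i j| <= eta.
    move=> et0; apply: filter_forall => i; apply: filter_forall => j.
    have /cvgrPdist_le /(_ eta et0) := Wlim i j.
    by apply: filterS => k; rewrite distrC.
  have Nnear := Nlim 2%N.
  have [cW Ww] : psd_contraction Winf /\ forall v, w * sqnorm v <= qform Winf v.
    apply: limit_contraction => eta et0.
    have [k [N2 WW]] := filter_ex (filterI Nnear (Wnear eta et0)).
    have [a [e [_ [cWk Wwk] _ _ _]]] := AF _ _ _ _ _ _ (DC k) N2 (ltn0Sn n).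
    by exists (W k); split.
  have cdf_lim x : prob R (Nq k) (fun z => T k z <= x) @[k --> \oo] --> gauss_qf_cdf Winf x.
    apply/cvgrPdist_le => eps e0.
    have [eta et0 P] := fixed_dim_cdf_all x k1 w0 C0 cW Ww e0.
    have [M M0 large] := @large_sample R n.+1 eta et0.
    apply: (filterS _ (filterI (filterI Nnear (Nlim M)) (Wnear eta et0))) => k [[N2 NM] WW]; rewrite distrC.
    exact: P (AF _ _ _ _ _ _ (DC k) N2 (ltn0Sn n)) WW (large _ NM).
  have dom x : chi2_cdf n.+1 x <= gauss_qf_cdf Winf x.
    apply: gauss_qf_cdf_le => v; apply: le_trans.
    by rewrite qform1_gqform gqformT; exact: cW.2.
  (* [cdf_lim] holds at every point, in particular at the quantile, so the limit exists there;
     domination compares it with [chi2_cdf]. *)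
  split=> //; exists (gauss_qf_cdf Winf (chi2_upper_quantile n.+1 alpha)); split=> //.
  by apply: le_trans (dom _); exact: chi2_cdf_quantile.
- move=> H N Q Nq Y F Nlim Hlim HN DC.
  have Hnear (eta : R) : 0 < eta -> \forall k \near \oo, (H k)%:R^-1 <= eta.
    move=> et0; have i0 : 0 <= eta^-1 by rewrite invr_ge0 ltW.
    have := Hlim (Num.Def.archi_bound eta^-1).+1; apply: filterS => k hk.
    have H0 : 0 < (H k)%:R :> R by rewrite ltr0n (leq_trans _ hk).
    rewrite -[eta]invrK lef_pV2 ?posrE ?invr_gt0 //.
    by apply/ltW/(lt_le_trans (archi_boundP i0)); rewrite ler_nat ltnW.
  have HNnear (eta : R) : 0 < eta -> \forall k \near \oo,
      (H k)%:R ^+ 4 * (Num.sqrt (N k)%:R)^-1 <= eta.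
    move=> et0; have /cvgrPdist_le /(_ eta et0) h := HN.
    apply: (filterS _ (filterI (Hlim 1%N) h)) => k [H0 hk].
    apply: powR_dimension => //; apply: le_trans hk.
    by rewrite sub0r normrN ler_norm.
  have NHnear : \forall k \near \oo, (2 <= N k)%N /\ (1 <= H k)%N.
    by apply: filterI; [exact: Nlim|exact: Hlim].
  split.
    move=> x; apply/cvgrPdist_le => eps e0.
    have [eta et0 P] := high_dim_clt x k1 w01 C0 e0.
    apply: (filterS _ (filterI NHnear (filterI (Hnear eta et0) (HNnear eta et0)))) => k [[N2 H0] [hH hN]]; rewrite distrC.
    exact: P (AF _ _ _ _ _ _ (DC k) N2 H0) hH hN.
  move=> eps e0.
  have [eta [H0 [et0 P]]] := high_dim_quantile w k1 C0 Halpha e0.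
  apply: (filterS _ (filterI NHnear (filterI (Hlim H0) (HNnear eta et0)))) => k [[N2 Hk0] [hH hN]].
  exact: P (AF _ _ _ _ _ _ (DC k) N2 Hk0) hH hN.
Qed.
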